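(* Let $K,i,\kappa$ be positive integers and $\epsilon\in\{0,1\}$ such that $K>2$, $K=2\kappa-\epsilon$ and $1\le i\le\kappa$. Let $J_{K,i}(n,m)$ be the number of $K$-restricted jagged partitions $(n_1,\dots,n_m)$ of length $m$ with $\sum_j n_j=n$ containing at most $i-1$ pairs $01$, and let $J_{K,i}(n)=\sum_m J_{K,i}(n,m)$. Let further: - $E_{K,i}(2n,m)$ be the number of partitions $(p_1,\dots,p_m)$, $p_1\ge\cdots\ge p_m\ge1$, of $2n$ into $m$ parts such that every odd part occurs an even number of times, $p_l\ge p_{l+K-1}+2$ for all $1\le l\le m-K+1$, and there are at most $2i-2$ parts equal to $1$; - $R_{K,i}(2n)$ be the number of partitions of $2n$ all of whose successive ranks are odd and lie in the interval $[3-2i,\,2K-1-2i]$; - $O_{K,i}(n)$ be the number of overpartitions of $n$ in which no non-overlined part is congruent to $0$ or $\pm i$ modulo $K+1$, if $1\le 2i<K+1$; and the number of overpartitions of $n$ in which no part (overlined or not) is congruent to $0$ modulo $\kappa$, if $\epsilon=1$ and $i=\kappa$. Then for all integers $n,m\ge0$, $$J_{K,i}(n,m)=E_{K,i}(2n,m)\qquad\text{and}\qquad J_{K,i}(n)=R_{K,i}(2n)=O_{K,i}(n).$$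
   Context: **Jagged partitions.** A jagged partition of length $m$ is a sequence of non-negative integers $(n_1,\dots,n_m)$ with $n_j\ge n_{j+1}-1$ (for $1\le j\le m-1$), $n_j\ge n_{j+2}$ (for $1\le j\le m-2$), and $n_m\ge 1$. For $m=0$ the only one is the empty sequence. It is $K$-restricted if for every $1\le j\le m-K+1$ either $$n_j\ge n_{j+K-1}+1\qquad\text{or}\qquad n_j=n_{j+1}-1=n_{j+K-2}+1=n_{j+K-1}.$$ A pair $01$ is an index $j$ with $(n_j,n_{j+1})=(0,1)$. **Successive ranks.** For a partition $\lambda=(\lambda_1,\lambda_2,\dots)$ with conjugate $\lambda'$, let $d$ be the largest integer with $\lambda_d\ge d$, and put $s_j=\lambda_j-j$, $t_j=\lambda'_j-j$ for $1\le j\le d$. The successive ranks of $\lambda$ are $SR(j)=s_j-t_j$, $1\le j\le d$. **Overpartitions.** An overpartition of $n$ is a partition of $n$ in which the final occurrence of each part may be overlined. *)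

(* Defs.v *)
From mathcomp Require Import all_boot all_order all_algebra.
From mathcomp Require Import zify.

Set Implicit Arguments.
Unset Strict Implicit.
Unset Printing Implicit Defensive.

Import Order.TTheory GRing.Theory Num.Theory.

(* Finite sequences (n_1, ..., n_m) are of type                               *)
(* [seq nat], indexed from 0, so n_j is [nth 0 s (j - 1)].                    *)

Definition jagged (s : seq nat) : bool :=
  [&& [forall j : 'I_(size s),
         (j + 1 < size s) ==> (nth 0 s (j + 1) <= nth 0 s j + 1)],
      [forall j : 'I_(size s),
         (j + 2 < size s) ==> (nth 0 s (j + 2) <= nth 0 s j)]
    & (0 < size s) ==> (1 <= last 0 s)].

(* The subtractions n_(j+1) - 1 are moved to the other side, since            *)
(* subtraction on [nat] is truncated.                                         *)
Definition restricted (K : nat) (s : seq nat) : bool :=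
  [forall j : 'I_(size s), (j + K <= size s) ==>
     ((nth 0 s (j + K - 1) + 1 <= nth 0 s j)
      || [&& nth 0 s j + 1 == nth 0 s (j + 1),
             nth 0 s j == nth 0 s (j + K - 2) + 1
           & nth 0 s j == nth 0 s (j + K - 1)])].

Definition pairs01 (s : seq nat) : nat :=
  #|[set j : 'I_(size s) |
       [&& j + 1 < size s, nth 0 s j == 0 & nth 0 s (j + 1) == 1]]|.

Definition is_partition (s : seq nat) : bool :=
  sorted geq s && all (leq 1) s.

(* Number of sequences of length m and sum n satisfying P; the entries of     *)
(* such a sequence are at most n, so they may be taken in 'I_n.+1.            *)
Definition num_seqs (P : pred (seq nat)) (n m : nat) : nat :=
  #|[set t : m.-tuple 'I_n.+1 |
       (sumn [seq val x | x <- t] == n) && P [seq val x | x <- t]]|.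

Definition Jlen (K i n m : nat) : nat :=
  num_seqs (fun s => [&& jagged s, restricted K s & pairs01 s <= i - 1]) n m.

(* A jagged partition of n has length at most 2n, see [jagged_size].          *)
Definition J (K i n : nat) : nat := \sum_(0 <= m < (2 * n).+1) Jlen K i n m.

Definition Epred (K i : nat) (p : seq nat) : bool :=
  [&& is_partition p,
      all (fun x => odd x ==> ~~ odd (count_mem x p)) p,
      [forall l : 'I_(size p), (l + K <= size p) ==>
         (nth 0 p (l + K - 1) + 2 <= nth 0 p l)]
    & count_mem 1 p <= 2 * i - 2].

Definition E (K i N m : nat) : nat := num_seqs (Epred K i) N m.

(* [part s j] is the j-th part, j >= 1, with value 0 past the last part.      *)
Definition part (s : seq nat) (j : nat) : nat := nth 0 s j.-1.

Definition conj_part (s : seq nat) : seq nat :=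
  [seq count (leq j) s | j <- iota 1 (head 0 s)].

Definition durfee (s : seq nat) : nat :=
  \max_(1 <= d < (size s).+1 | d <= part s d) d.

Definition SR (s : seq nat) (j : nat) : int :=
  (((part s j)%:Z - j%:Z) - ((part (conj_part s) j)%:Z - j%:Z))%R.

Definition Rpred (K i : nat) (s : seq nat) : bool :=
  is_partition s &&
  [forall j : 'I_(durfee s), let r := SR s (j + 1) in
     [&& ~~ (2 %| r)%Z, (3 - (2 * i)%N%:Z <= r)%R
       & (r <= (2 * K)%N%:Z - 1 - (2 * i)%N%:Z)%R]].

(* A partition of N has at most N parts, see [is_partition_size].             *)
Definition R (K i N : nat) : nat :=
  \sum_(0 <= m < N.+1) num_seqs (Rpred K i) N m.

(* The boolean says whether the part is overlined; an overlined part differs  *)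
(* from all later parts, i.e. is the final occurrence of its value.           *)
Definition is_overpartition (l : seq (nat * bool)) : bool :=
  is_partition (unzip1 l) && pairwise (fun x y => x.2 ==> (y.1 != x.1)) l.

Definition Opred (K kappa eps i : nat) (l : seq (nat * bool)) : bool :=
  [&& is_overpartition l,
      (1 <= 2 * i < K + 1) ==>
        all (fun x => ~~ x.2 ==>
               ~~ [|| x.1 == 0 %[mod K + 1], x.1 == i %[mod K + 1]
                    | x.1 + i == 0 %[mod K + 1]]) l
    & ((eps == 1) && (i == kappa)) ==>
        all (fun x => x.1 != 0 %[mod kappa]) l].

(* When K = 2 * kappa - eps the two cases in [Opred] exclude each other and   *)
(* cover all 1 <= i <= kappa, see [Ocases].                                   *)
Definition O (K kappa eps i n : nat) : nat :=
  \sum_(0 <= m < n.+1)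
    #|[set t : m.-tuple ('I_n.+1 * bool) |
         let l := [seq (val x.1, x.2) | x <- t] in
         (sumn (unzip1 l) == n) && Opred K kappa eps i l]|.

Lemma is_partition_size s : is_partition s -> size s <= sumn s.
Proof.
case/andP=> _; elim: s => //= a s IHs /andP[a_gt0 /IHs]; lia.
Qed.

Lemma jagged_behead a b s : jagged (a :: b :: s) -> jagged (b :: s).
Proof.
case/and3P=> /forallP H1 /forallP H2 /= H3; apply/and3P; split=> //.
- apply/forallP=> j; apply/implyP=> Hj.
  have := implyP (H1 (lift ord0 j)); rewrite lift0 /= addSn; exact.
- apply/forallP=> j; apply/implyP=> Hj.
  have := implyP (H2 (lift ord0 j)); rewrite lift0 /= addSn; exact.
Qed.

Lemma jagged_head2 a b s : jagged (a :: b :: s) -> 0 < a + b.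
Proof.
elim: s a b => [|c s IHs] a b; first by case/and3P=> _ _ /=; lia.
move=> Habc; have := IHs _ _ (jagged_behead Habc).
case/and3P: Habc => _ /forallP/(_ ord0) /=; lia.
Qed.

Lemma jagged_size s : jagged s -> size s <= 2 * sumn s.
Proof.
have [k] := ubnP (size s); elim: k s => // k IHk [|a [|b s]] //=.
  by move=> _ /and3P[_ _ /=]; lia.
move=> Hk Hs; have Hab := jagged_head2 Hs.
have : size s <= 2 * sumn s.
  case: s Hk Hs => // c s Hk Hs; apply: IHk; first by move: Hk => /=; lia.
  exact: jagged_behead (jagged_behead Hs).
lia.
Qed.

Lemma Ocases K i kappa eps : 0 < i -> 0 < kappa -> eps \in [:: 0; 1] ->
  K = 2 * kappa - eps -> i <= kappa ->
  (1 <= 2 * i < K + 1) = ~~ ((eps == 1) && (i == kappa)).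
Proof. by rewrite !inE => ? ? /orP[]/eqP-> ? ?; apply/idP/idP; lia. Qed.

(* Main.v *)
Require Import Defs.
From mathcomp Require Import all_boot all_order all_algebra.
From mathcomp Require Import zify ring.

Set Implicit Arguments.
Unset Strict Implicit.
Unset Printing Implicit Defensive.

Import Order.TTheory GRing.Theory Num.Theory.

(* A jagged partition splits uniquely into pairs r, r + 1 and single entries; *)
(* sending a pair to two parts 2r + 1 and a single r to a part 2r gives       *)
(* J(n, m) = E(2n, m).                                                        *)
(*   For E = R, Burge's correspondence is run one step at a time: on the      *)
(* multiplicities (f_j) of a partition and on Frobenius symbols there are     *)
(* maps lowering the weight by d, the number of pairs {j - 1, j} into which   *)
(* the support of f is grouped, resp. the number of columns. Both families    *)
(* therefore obey the same recursion [burge_rec] in (a, d, o, n), where a     *)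
(* locates the admissible interval of ranks, and o counts the odd j with f_j  *)
(* odd, resp. the columns of odd weight s + t + 1, that is of even rank;      *)
(* E and R are its solutions with a = K + 1 - 2i and o = 0.                   *)
(*   The recursion is solved in closed form for fixed d: with p = q^2, the    *)
(* solution is a signed sum over j of powers of q times                       *)
(* (-p; p)_{d-1} / ((p; p)_{d-j} (p; p)_{d+j}), the upper limit of the ranks  *)
(* being enforced by the symmetry j -> -1 - j. The sum over d telescopes in   *)
(* j, leaving (-p; p)_oo / (p; p)_oo times                                    *)
(* sum_j (-1)^j p^((K+1)j(j+1)/2 - ij), which the triple product turns into   *)
(* the generating function of the overpartitions counted by O.                *)
(*   Power series are computed in a commutative ring with q^M = 0, finally    *)
(* taken to be Z[X]/(X^M).                                                    *)

(** * Counting *)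

(** J = E is a bijection ([Jlen_eq_E]). Under it the exceptional clause of K-restriction covers
    exactly the windows that open with the first part of an odd pair 2r + 3, 2r + 3 and close with
    the second part of a pair 2r + 1, 2r + 1 ([restricted_to_jagged]).

    For E = R no bijection is built. A Burge step lowers the weight by d and turns o into d - o,
    because every pair or column changes parity exactly once. Since d > 0, the counts are determined
    by those of smaller weight, so [burge_rec_uniq] identifies [mult_count] with [frob_count];
    [E_mult] and [R_frob] translate back.

    For R = O, a step exchanges o = 0 and o = d, so these two cases form a closed linear system in a
    ([strip_rec]), with a reflection at a = 0 and a wall at a = K - 1. It is solved by images: each
    mode j satisfies the interior equations by itself ([mode1], [mode2]), the symmetry j -> -j of
    the signed sum gives the reflection, and under j -> -1 - j the terms that violate the wall
    condition cancel ([Bhat_wall], [Ahat_wall]). The solution is unique because the right sides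
    carry positive powers of q ([strip_rec_uniq]). In the sum over d, the total factor of the j-th
    term of [theta] does not depend on j ([Ssum_Phi]), so the series of R is [Phi * theta]. The
    triple product makes this a product, which [over_residues] and [over_multiples] recognise as the
    series of O, and [gf_coef] compares coefficients. *)

Definition has_card (T : eqType) (P : pred T) (k : nat) : Prop :=
  exists s : seq T, [/\ uniq s, s =i P & size s = k].

Lemma has_card_uniq (T : eqType) (P : pred T) k l :
  has_card P k -> has_card P l -> k = l.
Proof.
move=> [s [us sP <-]] [t [ut tP <-]].
by apply/perm_size/uniq_perm => // x; rewrite sP tP.
Qed.

Lemma eq_has_card (T : eqType) (P Q : pred T) k :
  P =1 Q -> has_card P k -> has_card Q k.
Proof.
move=> PQ [s [us sP sk]]; exists s; split=> // x.
by rewrite sP -!topredE /= PQ.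
Qed.

Lemma has_card_bij (T U : eqType) (P : pred T) (Q : pred U) f g k :
  (forall x, P x -> Q (f x) /\ g (f x) = x) ->
  (forall y, Q y -> P (g y) /\ f (g y) = y) ->
  has_card P k -> has_card Q k.
Proof.
move=> fP gQ [s [us sP sk]]; exists (map f s); split; last by rewrite size_map.
  rewrite map_inj_in_uniq // => x y; rewrite !sP => /fP[_ fx] /fP[_ fy] E.
  by rewrite -fx E.
move=> y; apply/mapP/idP => [[x + ->]|Qy].
  by rewrite sP => /fP[].
by have [Py fy] := gQ y Qy; exists (g y); rewrite ?sP.
Qed.

Lemma has_card0 (T : eqType) (P : pred T) :
  (forall x, ~~ P x) -> has_card P 0.
Proof.
by move=> P0; exists [::]; split=> // x; apply/esym/negbTE/P0.
Qed.

Lemma has_card1 (T : eqType) (x : T) : has_card (pred1 x) 1.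
Proof. by exists [:: x]; split=> // y; rewrite inE. Qed.

Lemma has_cardU (T : eqType) (P Q : pred T) k l :
  (forall x, P x -> ~~ Q x) ->
  has_card P k -> has_card Q l -> has_card (fun x => P x || Q x) (k + l).
Proof.
move=> PQ [s [us sP <-]] [t [ut tQ <-]]; exists (s ++ t); split.
- rewrite cat_uniq us ut andbT /=; apply/hasPn => x.
  by rewrite tQ sP => Qx; apply/negP => /PQ; rewrite [Q x]Qx.
- by move=> x; rewrite mem_cat sP tQ.
- by rewrite size_cat.
Qed.

Lemma has_card_sum (T : eqType) (P : pred T) (st : T -> nat) (c : nat -> nat) N :
  (forall x, P x -> st x < N) ->
  (forall m, m < N -> has_card (fun x => P x && (st x == m)) (c m)) ->
  has_card P (\sum_(0 <= m < N) c m).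
Proof.
elim: N P => [|N IH] P stP cP.
  by rewrite big_geq //; apply: has_card0 => x; apply/negP => /stP.
rewrite big_nat_recr //=.
have H := has_cardU _ (IH (fun x => P x && (st x < N)) _ _) (cP N (ltnSn N)).
apply: eq_has_card (H _ _ _) => [x|x /andP[Px lt]|x /andP[]//|m mN] /=.
- rewrite -andb_orr; apply/andP/idP => [[]//|Px]; split=> //.
  by have := stP x Px; rewrite ltnS leq_eqVlt orbC.
- by rewrite Px /= neq_ltn lt.
- apply: eq_has_card (cP m (ltnW mN)) => x /=.
  by case: (st x =P m) => [->|_]; rewrite ?andbF // mN !andbT.
Qed.

Fixpoint seqs_upto (T : Type) (xs : seq T) (n : nat) : seq (seq T) :=
  if n is n'.+1 then [::] :: [seq x :: l | x <- xs, l <- seqs_upto xs n']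
  else [:: [::]].

Lemma mem_seqs_upto (T : eqType) (xs : seq T) n l :
  size l <= n -> all [in xs] l -> l \in seqs_upto xs n.
Proof.
elim: n l => [|n IH] [|x l] //= szl /andP[xx al].
by rewrite inE /=; apply/allpairsP; exists (x, l); split=> //; apply: IH.
Qed.

Definition fin_card (T : eqType) (P : pred T) (s : seq T) : nat :=
  size (undup (filter P s)).

Lemma fin_cardP (T : eqType) (P : pred T) s :
  (forall x, P x -> x \in s) -> has_card P (fin_card P s).
Proof.
move=> Ps; exists (undup (filter P s)); split=> // [|x]; first exact: undup_uniq.
rewrite mem_undup mem_filter; apply/andP/idP => [[]//|Px]; split=> //; exact: Ps.
Qed.

Lemma mem_le_sumn (s : seq nat) x : x \in s -> x <= sumn s.
Proof. by elim: s => //= y s IH; rewrite inE => /orP[/eqP->|/IH]; lia. Qed.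

(** Connects the counts of the statement, over tuples with bounded entries, to [has_card]; the
    second hypothesis says that the bound loses no sequence. *)
Lemma has_card_tuple (X : finType) (U : eqType) (v : X -> U) (P : pred (seq U)) m :
  injective v ->
  (forall s, P s -> forall y, y \in s -> exists x, v x = y) ->
  has_card (fun s => (size s == m) && P s)
           #|[set t : m.-tuple X | P [seq v x | x <- t]]|.
Proof.
move=> vI vP.
exists [seq [seq v x | x <- val t] | t : m.-tuple X in [set t : m.-tuple X | P [seq v x | x <- t]]].
split; last by rewrite size_map cardE.
  rewrite map_inj_uniq ?enum_uniq // => t u /inj_map E; exact/val_inj/E.
move=> s; apply/mapP/idP => [[t + ->]|].
  rewrite mem_enum inE => Pt.
  by rewrite -topredE /= size_map size_tuple eqxx.
rewrite -topredE /= => /andP[/eqP sz Ps].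
have [t ts] : exists t, map v t = s.
  have := vP s Ps; elim: (s) => [|y s' IH] H; first by exists [::].
  have [x <-] := H y (mem_head _ _).
  have [|t <-] := IH; last by exists (x :: t).
  by move=> z zs; apply: H; rewrite inE zs orbT.
have szt : size t == m by rewrite -sz -ts size_map.
exists (Tuple szt); last by rewrite /= ts.
by rewrite mem_enum inE /= ts.
Qed.

Lemma num_seqsP (P : pred (seq nat)) n m :
  has_card (fun s => (size s == m) && ((sumn s == n) && P s)) (num_seqs P n m).
Proof.
apply: (has_card_tuple (v := @nat_of_ord n.+1)
          (P := fun s => (sumn s == n) && P s)); first exact: val_inj.
move=> s /andP[/eqP <- _] y /mem_le_sumn ys.
by exists (inord y); rewrite inordK.
Qed.

(** * Burge's recursion for multiplicities *)

(** [T] tells which of the two kinds of step applies. As [0.-1 = 0], the down step reflects at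
    [a = 0]; at the other end, [a = K - 1], no up step exists, whence [burge_top]. *)
Record burge_rec (K : nat) (c : nat -> bool -> nat -> nat -> nat -> nat) : Prop :=
  BurgeRec {
  burge_d0 : forall a T o n, a < K ->
    c a T 0 o n = [&& ~~ T, o == 0 & n == 0];
  burge_small : forall a T d o n, a < K -> (n < d) || (d < o) ->
    c a T d o n = 0;
  burge_down : forall a d o o' n, a < K -> 0 < d -> o + o' = d ->
    c a false d o (n + d) = c a.-1 true d o' n + c a.-1 false d o' n;
  burge_up : forall a d o o' n, a.+1 < K -> 0 < d -> o + o' = d ->
    c a true d o (n + d) = c a.+1 true d o' n + c a.+1 false d.-1 o' n;
  burge_top : forall a d o n, a.+1 = K -> c a true d o n = 0 }.

Lemma burge_rec_uniq K c c' : burge_rec K c -> burge_rec K c' ->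
  forall a T d o n, a < K -> c a T d o n = c' a T d o n.
Proof.
move=> Hc Hc' a T d o n; elim/ltn_ind: n a T d o => n IH a T [|d] o aK.
  by rewrite (burge_d0 Hc) // (burge_d0 Hc').
case: (boolP ((n < d.+1) || (d.+1 < o))) => [small|].
  by rewrite (burge_small Hc) // (burge_small Hc').
rewrite negb_or -!leqNgt => /andP[dn od].
have o'E : o + (d.+1 - o) = d.+1 by rewrite subnKC.
have lt : n - d.+1 < n by lia.
rewrite -(subnK dn); case: T.
- case: (ltnP a.+1 K) => aK'; last first.
    by rewrite (burge_top Hc) ?(burge_top Hc'); lia.
  by rewrite (burge_up Hc _ _ _ o'E) // (burge_up Hc' _ _ _ o'E) // !IH.
- rewrite (burge_down Hc _ _ _ o'E) // (burge_down Hc' _ _ _ o'E) // !IH //; lia.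
Qed.

(* A partition is encoded by its list of multiplicities (f_1, f_2, ...),      *)
(* whose last entry is not 0. Reading the support from the right, indices are *)
(* greedily grouped in pairs {j - 1, j} with f_j > 0; the index j = 0 may     *)
(* occur. [top f] says whether the first index of f is the top of a pair.     *)
Fixpoint top (f : seq nat) : bool :=
  if f is x :: f' then (0 < x) && ~~ top f' else false.

Fixpoint npairs (f : seq nat) : nat :=
  if f is x :: f' then top f + npairs f' else 0.

(** [b] says whether the first index has the counted parity; [nodd true] looks at the odd part
    sizes. *)
Fixpoint nodd (b : bool) (f : seq nat) : nat :=
  if f is x :: f' then (b && odd x) + nodd (~~ b) f' else 0.

Fixpoint wt (k : nat) (f : seq nat) : nat :=
  if f is x :: f' then k * x + wt k.+1 f' else 0.

(** [a] acts as a multiplicity f_0: the condition f_(j-1) + f_j < K, taken from j = 1 on, bounds f_1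
    by K - 1 - a, which is 2i - 2 for a = K + 1 - 2i. *)
Fixpoint fits (K a : nat) (f : seq nat) : bool :=
  if f is x :: f' then (a + x < K) && fits K x f' else a < K.

(** Keeps the last entry nonzero, so that a partition has a single code. *)
Definition cons_trim (x : nat) (f : seq nat) : seq nat :=
  if (x == 0) && (f == [::]) then [::] else x :: f.

(* Burge's step: in each pair one unit moves from the top to the bottom.      *)
Fixpoint shift_down (f : seq nat) : seq nat :=
  if f is x :: f' then cons_trim (x - top f + top f') (shift_down f') else [::].

(** Runs the step backwards from left to right; [b] says that the index on the left has just given
    up a unit, at the start the virtual index 0. *)
Fixpoint shift_up (b : bool) (f : seq nat) : seq nat :=
  match f with
  | [::] => if b then [:: 1] else [::]
  | x :: f' => if b then x.+1 :: shift_up false f'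
               else if x is x'.+1 then x' :: shift_up true f'
               else 0 :: shift_up false f'
  end.

Definition trimmed (f : seq nat) : bool := last 1 f != 0.

Lemma trimmed_cons x f : trimmed (x :: f) -> trimmed f.
Proof. by case: f. Qed.

Lemma nodd_cons_trim b x f : nodd b (cons_trim x f) = nodd b (x :: f).
Proof. by rewrite /cons_trim; case: ifP => // /andP[/eqP-> /eqP->] /=; rewrite andbF. Qed.
Lemma wt_cons_trim k x f : wt k (cons_trim x f) = wt k (x :: f).
Proof. by rewrite /cons_trim; case: ifP => // /andP[/eqP-> /eqP->] /=; rewrite muln0. Qed.
Lemma fits_cons_trim K a x f : fits K a (x :: f) -> fits K a (cons_trim x f).
Proof. by rewrite /cons_trim; case: ifP => // /andP[/eqP-> /eqP->] /=; lia. Qed.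

Lemma trimmed_shift_down f : trimmed f -> trimmed (shift_down f).
Proof.
elim: f => //= x f IH nf; rewrite /cons_trim; case: ifP => //= H.
case E: (shift_down f) H (IH (trimmed_cons nf)) => [|//] /=.
by rewrite andbT /trimmed /= => ->.
Qed.

Lemma trimmed_shift_up b f : trimmed f -> trimmed (shift_up b f).
Proof.
elim: f b => [|x f IH] [] //= nf.
  have := IH false (trimmed_cons nf); rewrite /trimmed /=.
  by case: (shift_up false f).
case: x nf => [|x] nf; last first.
  have := IH true (trimmed_cons nf); rewrite /trimmed /=.
  by case: f {IH nf} => [|? ?].
case: f IH nf => // y f IH nf; have := IH false nf.
by rewrite /trimmed /=; case: y {IH nf}.
Qed.

(** Pairs formed greedily from the left before the shift up are found again greedily from the right
    after it; this makes the two shifts mutually inverse. *)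
Lemma top_shift_up b f : top (shift_up b f) = b.
Proof. by elim: f b => [|[|x] f IH] [] //=; rewrite IH //= andbF. Qed.

Lemma shift_upK b f : trimmed f -> shift_down (shift_up b f) = f.
Proof.
elim: f b => [|x f IH] [] //= nf; rewrite ?top_shift_up /=.
  rewrite IH ?(trimmed_cons nf) // /cons_trim subn1 addn0 /=.
  by case: x nf => [|x]; case: f {IH}.
case: x nf => [|x] nf /=; rewrite top_shift_up IH ?(trimmed_cons nf) // /cons_trim /=.
  by case: f {IH} nf.
by rewrite andbF subn0 addn1.
Qed.

Lemma shift_downK f : trimmed f -> shift_up (top f) (shift_down f) = f.
Proof.
elim: f => //= x f IH nf; have := IH (trimmed_cons nf).
rewrite /cons_trim; case: x nf => [|x] nf /=.
  case: (top f) => /= [->//|H]; case: eqP => [E|_]; last by rewrite /= H.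
  by move: H; rewrite E /=; case: f {IH E} nf.
case: (top f) => /= [->|]; first by rewrite ?subn0 ?addn1 /= ?subn0.
rewrite addn0 subn1 /=; case: (shift_down f =P [::]) => [->|_] /=; last by rewrite andbF => /= ->.
by rewrite andbT; case: x {nf} => [|x] /= <-.
Qed.

Lemma npairs_shift_up b f : npairs (shift_up b f) = npairs f + (b && ~~ top f).
Proof.
elim: f b => [|[|x] f IH] [] //=; rewrite ?top_shift_up ?IH //=; lia.
Qed.

(** Each pair loses 1. If the first index k is a top, its unit leaves the list for k - 1, so a
    further k - 1 is lost; for k = 1 this is 0. *)
Lemma wt_shift_down k f : 0 < k ->
  wt k (shift_down f) + npairs f + k.-1 * top f = wt k f.
Proof.
elim: f k => [|x f IH] k k0 /=; first by rewrite muln0.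
rewrite wt_cons_trim /= -(IH k.+1) //=.
by case: (top f); case: x => [|x] /=; nia.
Qed.

(** An index outside all pairs has multiplicity 0 before and after. Each pair contains one index of
    the counted parity, and its multiplicity changes by 1, so it is odd exactly once; the correction
    is the pair whose counted index lies before the list. *)
Lemma nodd_shift_down b f :
  nodd b (shift_down f) + nodd b f + (~~ b && top f) = npairs f.
Proof.
elim: f b => [|x f IH] b /=; first by rewrite andbF.
rewrite nodd_cons_trim /=; have {IH} := IH (~~ b).
have odd1 y : odd y + odd y.+1 = 1 by rewrite /=; case: (odd y).
by have := odd1 x.-1; case: b; case: (top f); case: x => [|x];
  rewrite ?andbT ?andbF ?subn1 ?addn1 ?subn0 ?addn0 /=; lia.
Qed.

Lemma fits_lt K a f : fits K a f -> a < K.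
Proof. by case: f => //= x f /andP[]; lia. Qed.

(** If index 1 is a top, index 0 receives its unit. Otherwise f_1 grows by at most 1, and only when
    f_2 > 0, so at [a = 0] the bound f_1 + f_2 < K still suffices. *)
Lemma fits_shift_down K a f : fits K a f ->
  fits K (if top f then a.+1 else a.-1) (shift_down f).
Proof.
elim: f a => [|x f IH] a /=; first by lia.
case/andP=> ax xf; apply: fits_cons_trim; have := IH x xf => /=.
have : top f -> x.+1 < K.
  by case: (f) xf => //= y f' /andP[+ _] /andP[+ _]; lia.
by case: (top f); case: x ax {xf IH} => [|x] ax /=; rewrite ?subn1 ?addn1 ?subn0 ?addn0 => ? ->; rewrite ?andbT; lia.
Qed.

Lemma fits_shift_up K a f : 1 < K -> fits K a f ->
  (0 < a -> fits K a.-1 (shift_up true f)) /\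
  (forall a', a' <= a.+1 -> a' < K -> fits K a' (shift_up false f)).
Proof.
move=> K1; elim: f a => [|x f IH] a /=; first by split; lia.
case/andP=> ax xf; have [H1 H2] := IH x xf; split=> [a0|a' a'a a'K].
  by rewrite H2; lia.
by case: x ax H1 H2 {xf IH} => [|x] /= ax H1 H2; rewrite ?H1 ?H2; lia.
Qed.

Definition mult_set K a T d o n (f : seq nat) : bool :=
  [&& trimmed f, fits K a f, top f == T, npairs f == d, nodd true f == o
    & wt 1 f == n].

Definition mult_count K a T d o n : nat :=
  fin_card (mult_set K a T d o n) (seqs_upto (iota 0 n.+1) n).

Lemma size_le_wt k f : trimmed f -> 0 < k -> size f <= wt k f.
Proof.
case: f => [//|x f] nf k0; suff: size (x :: f) + k.-1 <= wt k (x :: f) by lia.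
elim: f x k nf k0 => [|y f IH] x k nf k0; last first.
  by have := IH y k.+1 nf isT; rewrite /=; lia.
by move: nf; rewrite /trimmed /=; nia.
Qed.

Lemma mem_le_wt k f x : x \in f -> 0 < k -> x <= wt k f.
Proof.
elim: f k => //= y f IH k; rewrite inE => /orP[/eqP->|xf] k0; first by nia.
by have := IH k.+1 xf isT; lia.
Qed.

Lemma mult_countP K a T d o n :
  has_card (mult_set K a T d o n) (mult_count K a T d o n).
Proof.
apply: fin_cardP => f /and5P[nf _ _ _ /andP[_ /eqP <-]].
apply: mem_seqs_upto; first exact: size_le_wt.
by apply/allP => x xf; rewrite inE mem_iota; have := mem_le_wt xf (ltn0Sn 0); lia.
Qed.

Lemma npairs0 f : trimmed f -> npairs f = 0 -> f = [::].
Proof.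
elim: f => //= x f IH nf; case: x nf => [|x] nf /= H.
  have E := IH (trimmed_cons nf) H; by rewrite E in nf.
have [tf df] : top f /\ npairs f = 0 by case: (top f) H; lia.
by rewrite (IH (trimmed_cons nf) df) in tf.
Qed.

Lemma mult_set_weights K a T d o n f : mult_set K a T d o n f -> (d <= n) && (o <= d).
Proof.
case/and5P=> _ _ _ /eqP <- /andP[/eqP <- /eqP <-].
have := wt_shift_down f (ltn0Sn 0); have := nodd_shift_down true f; lia.
Qed.

Lemma mult_shift_down K a T d o o' n f : 0 < d -> o + o' = d ->
  mult_set K a T d o (n + d) f ->
  [/\ trimmed (shift_down f), fits K (if T then a.+1 else a.-1) (shift_down f),
      nodd true (shift_down f) = o', wt 1 (shift_down f) = n
    & npairs (shift_down f) = if T then d - ~~ top (shift_down f) else d].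
Proof.
move=> d0 oo' /and5P[nf af /eqP tf /eqP df /andP[/eqP of_ /eqP wf]].
have := wt_shift_down f (ltn0Sn 0); have := nodd_shift_down true f => /= Ho Hw.
split; try lia; first exact: trimmed_shift_down.
  by rewrite -tf; apply: fits_shift_down.
have := npairs_shift_up T (shift_down f); rewrite -{1}tf shift_downK // df => ->.
by case: (T); rewrite ?addnK ?addn0.
Qed.

Lemma mult_countS K a d o o' n : a < K -> 1 < K -> 0 < d -> o + o' = d ->
  mult_count K a false d o (n + d)
  = mult_count K a.-1 true d o' n + mult_count K a.-1 false d o' n.
Proof.
move=> aK K1 d0 oo'; apply: has_card_uniq (mult_countP _ _ _ _ _ _) _.
have := has_cardU _ (mult_countP K a.-1 true d o' n) (mult_countP K a.-1 false d o' n).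
move=> /(_ _)-[f /and5P[_ _ /eqP tf _ _]|s Hs]; first by rewrite /mult_set tf !andbF.
move: {s Hs}(ex_intro _ s Hs : has_card _ _).
apply: (has_card_bij (f := shift_up false) (g := shift_down)) => [f|f Hf]; last first.
  have [nf ff of_ wf df] := mult_shift_down d0 oo' Hf.
  have /and5P[nf' _ /eqP tf _ _] := Hf.
  have := shift_downK nf'; rewrite tf => ->; split=> //.
  by rewrite /mult_set nf ff of_ wf df !eqxx; case: top.
rewrite /mult_set => Hf.
have [nf [af [df [of_ wf]]]] : trimmed f /\ fits K a.-1 f /\ npairs f = d /\ nodd true f = o' /\ wt 1 f = n.
  by case/orP: Hf => /and5P[-> -> _ /eqP-> /andP[/eqP-> /eqP->]].
have fK := shift_upK false nf.
rewrite fK; split=> //.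
have := wt_shift_down (shift_up false f) (ltn0Sn 0).
have := nodd_shift_down true (shift_up false f).
rewrite fK top_shift_up npairs_shift_up /= => Ho Hw.
rewrite trimmed_shift_up // (fits_shift_up K1 af).2 //; last by lia.
by rewrite /=; lia.
Qed.

(** The number of pairs drops, by one, exactly when index 1 is a top before the step and no longer
    after it. *)
Lemma mult_countN K a d o o' n : a.+1 < K -> 0 < d -> o + o' = d ->
  mult_count K a true d o (n + d)
  = mult_count K a.+1 true d o' n + mult_count K a.+1 false d.-1 o' n.
Proof.
move=> aK d0 oo'; apply: has_card_uniq (mult_countP _ _ _ _ _ _) _.
have := has_cardU _ (mult_countP K a.+1 true d o' n) (mult_countP K a.+1 false d.-1 o' n).
move=> /(_ _)-[f /and5P[_ _ /eqP tf _ _]|s Hs]; first by rewrite /mult_set tf !andbF.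
move: {s Hs}(ex_intro _ s Hs : has_card _ _).
apply: (has_card_bij (f := shift_up true) (g := shift_down)) => [f|f Hf]; last first.
  have [nf ff of_ wf df] := mult_shift_down d0 oo' Hf.
  have /and5P[nf' _ /eqP tf _ _] := Hf.
  have := shift_downK nf'; rewrite tf => ->; split=> //.
  by rewrite /mult_set nf ff of_ wf df !eqxx; case: top; rewrite /= ?subn0 ?subn1 eqxx.
rewrite /mult_set => Hf.
have [nf [af [df [of_ wf]]]] : trimmed f /\ fits K a.+1 f /\ npairs f + ~~ top f = d /\ nodd true f = o' /\ wt 1 f = n.
  by case/orP: Hf => /and5P[-> -> /eqP-> /eqP-> /andP[/eqP-> /eqP->]]; do !split; lia.
have fK := shift_upK true nf.
rewrite fK; split=> //.
have := wt_shift_down (shift_up true f) (ltn0Sn 0).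
have := nodd_shift_down true (shift_up true f).
rewrite fK top_shift_up npairs_shift_up /= => Ho Hw.
rewrite trimmed_shift_up // (fits_shift_up _ af).1 //; last by lia.
by rewrite /=; lia.
Qed.

Lemma mult_burge K : 1 < K -> burge_rec K (mult_count K).
Proof.
move=> K1; split=> [a T o n aK|a T d o n aK small|a d o o' n aK d0 oo'|a d o o' n aK d0 oo'|a d o n aK].
- apply: has_card_uniq (mult_countP _ _ _ _ _ _) _.
  case: (boolP [&& ~~ T, o == 0 & n == 0]) => [/and3P[T0 /eqP-> /eqP->]|H].
    apply: eq_has_card (has_card1 ([::] : seq nat)) => f.
    apply/eqP/idP => [->|/and5P[nf _ _ /eqP/(npairs0 nf) //]].
    by rewrite /mult_set /= aK (negbTE T0).
  apply: has_card0 => f; apply: contra H => /and5P[nf _ tf /eqP/(npairs0 nf) f0].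
  by move: tf; rewrite f0 => /eqP<- /andP[/eqP<- /eqP<-].
- apply: has_card_uniq (mult_countP _ _ _ _ _ _) _.
  by apply: has_card0 => f; apply/negP => /mult_set_weights; lia.
- exact: mult_countS.
- exact: mult_countN.
(* A top at index 1 would make the shifted list fit with [a.+1 = K]. *)
- apply: has_card_uniq (mult_countP _ _ _ _ _ _) _; apply: has_card0 => f.
  apply/negP => /and5P[_ ff /eqP tf _ _].
  have := fits_lt (fits_shift_down ff); rewrite tf; lia.
Qed.

(** * Burge's recursion for Frobenius symbols *)

(* A Frobenius symbol is the list of its columns (s, t), smallest first; a    *)
(* column weighs s + t + 1 and has rank s - t. In [in_strip K a] the rank     *)
(* lies in [2 - K + a, K + a - 1].                                            *)
Definition lt2 (u v : nat * nat) : bool := (u.1 < v.1) && (u.2 < v.2).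
Definition colw (u : nat * nat) : nat := u.1 + u.2 + 1.
Definition in_strip (K a : nat) (u : nat * nat) : bool :=
  (u.2 + a + 2 <= u.1 + K) && (u.1 < u.2 + K + a).
Definition low (F : seq (nat * nat)) : bool :=
  if F is u :: _ then u.1 == 0 else false.
Definition fwt (F : seq (nat * nat)) : nat := sumn (map colw F).
Definition fodd (F : seq (nat * nat)) : nat := count (fun u => odd (colw u)) F.

Definition frob_set K a T d o n (F : seq (nat * nat)) : bool :=
  [&& sorted lt2 F, all (in_strip K a) F, low F == T, size F == d, fodd F == o
    & fwt F == n].

Definition frob_count K a T d o n : nat :=
  fin_card (frob_set K a T d o n)
    (seqs_upto [seq (x, y) | x <- iota 0 n, y <- iota 0 n] n).

Lemma lt2_trans : transitive lt2.
Proof. by move=> v u w; rewrite /lt2; lia. Qed.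

Lemma size_le_fwt F : size F <= fwt F.
Proof.
rewrite /fwt; elim: F => //= u F IH.
have : 0 < colw u by rewrite /colw addn1.
lia.
Qed.

Lemma frob_countP K a T d o n :
  has_card (frob_set K a T d o n) (frob_count K a T d o n).
Proof.
apply: fin_cardP => F /and5P[_ _ _ _ /andP[_ /eqP <-]].
apply: mem_seqs_upto; first exact: size_le_fwt.
apply/allP => [[x y] xF]; apply/allpairsP; exists (x, y).
have := mem_le_sumn (map_f colw xF); rewrite -/(fwt F) /colw /= => H.
by rewrite !mem_iota /=; split=> //; lia.
Qed.

Lemma fwt_map (f : nat * nat -> nat * nat) (F : seq (nat * nat)) :
  (forall u, u \in F -> colw (f u) + 1 = colw u) ->
  fwt (map f F) + size F = fwt F.
Proof.
rewrite /fwt; elim: F => //= u F IH H.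
rewrite -IH => [|v vF]; last by apply: H; rewrite inE vF orbT.
by rewrite -(H u) ?mem_head //; lia.
Qed.

Lemma fodd_map (f : nat * nat -> nat * nat) (F : seq (nat * nat)) :
  (forall u, u \in F -> colw (f u) + 1 = colw u) ->
  fodd (map f F) + fodd F = size F.
Proof.
rewrite /fodd; elim: F => //= u F IH H.
rewrite -IH => [|v vF]; last by apply: H; rewrite inE vF orbT.
by rewrite -(H u) ?mem_head // addn1 /=; case: odd => /=; lia.
Qed.

Lemma sorted_lt2_map (f : nat * nat -> nat * nat) (F : seq (nat * nat)) :
  {in F &, forall u v, lt2 u v -> lt2 (f u) (f v)} ->
  sorted lt2 F -> sorted lt2 (map f F).
Proof.
move=> H sF; rewrite sorted_map.
by apply: (sub_in_sorted (P := mem F) _ _ sF) => //; apply/allP.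
Qed.

Lemma low_pos F : sorted lt2 F -> ~~ low F -> forall u : nat * nat, u \in F -> 0 < u.1.
Proof.
case: F => // u F /= /(order_path_min lt2_trans)/allP H u0 v.
by rewrite inE => /orP[/eqP->|/H/andP[]]; lia.
Qed.

Lemma low_pos2 u F : sorted lt2 (u :: F) -> 0 < u.2 ->
  forall v : nat * nat, v \in u :: F -> 0 < v.2.
Proof.
move=> /= /(order_path_min lt2_trans)/allP H u0 v.
by rewrite inE => /orP[/eqP->|/H/andP[]]; lia.
Qed.

(* Lowering all s by 1 moves the strip from a to a - 1; the strip of -1 is    *)
(* the conjugate of the strip of 0, whence the exchange of s and t at a = 0.  *)
Definition col_down (a : nat) (u : nat * nat) : nat * nat :=
  if a == 0 then (u.2, u.1.-1) else (u.1.-1, u.2).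
Definition col_up (a : nat) (u : nat * nat) : nat * nat :=
  if a == 0 then (u.2.+1, u.1) else (u.1.+1, u.2).

(** Lowering all t by 1 moves the strip from a to a + 1. A column (0, 0) cannot be lowered and is
    deleted instead, which also removes weight 1; [row_up] restores it exactly when no column has s
    = 0. *)
Definition row_down (F : seq (nat * nat)) : seq (nat * nat) :=
  [seq (u.1, u.2.-1) | u <- (if head (1, 1) F == (0, 0) then behead F else F)].
Definition row_up (F : seq (nat * nat)) : seq (nat * nat) :=
  let F' := [seq (u.1, u.2.+1) | u <- F] in
  if low F then F' else (0, 0) :: F'.

Lemma frob_set_weights K a T d o n F :
  frob_set K a T d o n F -> (d <= n) && (o <= d).
Proof.
case/and5P=> _ _ _ /eqP <- /andP[/eqP <- /eqP <-].
by rewrite size_le_fwt /fodd count_size.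
Qed.

Lemma frob_countS K a d o o' n : a < K -> 0 < d -> o + o' = d ->
  frob_count K a false d o (n + d)
  = frob_count K a.-1 true d o' n + frob_count K a.-1 false d o' n.
Proof.
move=> aK d0 oo'; apply: has_card_uniq (frob_countP _ _ _ _ _ _) _.
have := has_cardU _ (frob_countP K a.-1 true d o' n) (frob_countP K a.-1 false d o' n).
move=> /(_ _)-[F /and5P[_ _ /eqP tF _ _]|s Hs]; first by rewrite /frob_set tF !andbF.
move: {s Hs}(ex_intro _ s Hs : has_card _ _).
apply: (has_card_bij (f := map (col_up a)) (g := map (col_down a))) => [F|F]; change (seq (nat * nat)) in F.
- move=> HF.
  have [sF [rF [dF [oF wF]]]] : sorted lt2 F /\ all (in_strip K a.-1) F /\ size F = d /\ fodd F = o' /\ fwt F = n.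
    by case/orP: HF => /and5P[-> -> _ /eqP-> /andP[/eqP-> /eqP->]].
  have upK : map (col_down a) (map (col_up a) F) = F.
    rewrite -map_comp -[RHS]map_id; apply: eq_map => -[x y].
    by rewrite /= /col_up /col_down; case: eqP.
  split=> //.
  have wu u : u \in map (col_up a) F -> colw (col_down a u) + 1 = colw u.
    case/mapP => v _ ->; rewrite /colw /col_up /col_down; case: eqP => /=; lia.
  have := fwt_map wu; have := fodd_map wu; rewrite upK size_map => H1 H2.
  apply/and5P; split.
  + apply: sorted_lt2_map sF => -[x1 y1] [x2 y2] _ _; rewrite /lt2 /col_up; case: eqP => /=; lia.
  + rewrite all_map; apply/allP => -[x1 y1] /(allP rF).
    by rewrite /in_strip /= /col_up; case: eqP => /=; lia.
  + by case: (F) => //= u F'; rewrite /col_up; case: (a == 0).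
  + by rewrite size_map dF.
  + by lia.
- case/and5P => sF rF /eqP lF /eqP dF /andP[/eqP oF /eqP wF].
  have pF := low_pos sF (negbT lF).
  split; last first.
    rewrite -map_comp -[RHS]map_id; apply/eq_in_map => -[x y] /pF /=.
    by rewrite /= /col_up /col_down; case: eqP => /= _ ?; rewrite prednK.
  have wu u : u \in F -> colw (col_down a u) + 1 = colw u.
    by move/pF; rewrite /colw /col_down; case: eqP => /=; lia.
  have := fwt_map wu; have := fodd_map wu => H1 H2.
  have H : [/\ sorted lt2 (map (col_down a) F), all (in_strip K a.-1) (map (col_down a) F),
     size (map (col_down a) F) = d, fodd (map (col_down a) F) = o' & fwt (map (col_down a) F) = n].
    split; rewrite ?size_map //; try lia.
    + apply: sorted_lt2_map sF => -[x1 y1] [x2 y2] /pF /= u0 /pF /= v0; rewrite /lt2 /col_down; case: eqP => /=; lia.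
    + rewrite all_map; apply/allP => -[x1 y1] uF; move: (pF _ uF) (allP rF _ uF).
      by rewrite /in_strip /= /col_down; case: eqP => /=; lia.
  by rewrite /frob_set; case: H => -> -> -> -> ->; rewrite !eqxx; case: low.
Qed.

Lemma frob_countN K a d o o' n : a.+1 < K -> 0 < d -> o + o' = d ->
  frob_count K a true d o (n + d)
  = frob_count K a.+1 true d o' n + frob_count K a.+1 false d.-1 o' n.
Proof.
move=> aK d0 oo'; apply: has_card_uniq (frob_countP _ _ _ _ _ _) _.
have := has_cardU _ (frob_countP K a.+1 true d o' n) (frob_countP K a.+1 false d.-1 o' n).
move=> /(_ _)-[F /and5P[_ _ /eqP tF _ _]|s Hs]; first by rewrite /frob_set tF !andbF.
move: {s Hs}(ex_intro _ s Hs : has_card _ _).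
pose up := fun u : nat * nat => (u.1, u.2.+1).
pose dn := fun u : nat * nat => (u.1, u.2.-1).
apply: (has_card_bij (f := row_up) (g := row_down)) => [F|F]; change (seq (nat * nat)) in F.
- move=> HF.
  have [sF [rF [dF [oF wF]]]] : sorted lt2 F /\ all (in_strip K a.+1) F /\ size F + ~~ low F = d /\ fodd F = o' /\ fwt F = n.
    by case/orP: HF => /and5P[-> -> /eqP-> /eqP-> /andP[/eqP-> /eqP->]]; do !split; lia.
  have upK : map dn (map up F) = F.
    by rewrite -map_comp -[RHS]map_id; apply: eq_map => -[x y].
  have wu u : u \in map up F -> colw (dn u) + 1 = colw u.
    by case/mapP => v _ ->; rewrite /colw /=; lia.
  have := fwt_map wu; have := fodd_map wu; rewrite upK size_map => H1 H2.
  have sF' : sorted lt2 (map up F) by apply: sorted_lt2_map sF => -[x1 y1] [x2 y2] _ _; rewrite /lt2 /=; lia.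
  have rF' : all (in_strip K a) (map up F).
    rewrite all_map; apply/allP => -[x1 y1] /(allP rF).
    by rewrite /in_strip /=; lia.
  rewrite /row_up -/up; case: (boolP (low F)) dF => lF dF.
    have -> : row_down (map up F) = F.
      rewrite /row_down -/dn; case: (F) lF upK => // u F' _ upK.
      by rewrite ifN //= xpair_eqE andbF.
    split=> //; rewrite /frob_set sF' rF' size_map.
    have -> : low (map up F) by case: (F) lF.
    by lia.
  have -> : row_down ((0, 0) :: map up F) = F by rewrite /row_down.
  split=> //; rewrite /frob_set /= rF' size_map {1}/in_strip /= /fodd /fwt /=.
  rewrite -/(fodd _) -/(fwt _) path_min_sorted ?sF' //; last first.
    by apply/allP => u /mapP[v /(low_pos sF lF) v0 ->]; rewrite /lt2 /= v0.
  by rewrite /colw /=; lia.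
- case/and5P => sF rF /eqP lF /eqP dF /andP[/eqP oF /eqP wF].
  case: F sF rF lF dF oF wF => // -[x y] F sF rF /eqP /= x0 dF oF wF.
  rewrite /row_down /= -/dn; have [E|NE] := eqVneq (x, y) (0, 0).
    case: E sF rF dF oF wF => -> -> {x y x0} sF /= /andP[_ rF] dF oF wF.
    have pF v : v \in F -> (0 < v.1) && (0 < v.2).
      by move: sF => /(order_path_min lt2_trans)/allP H /H.
    have wu u : u \in F -> colw (dn u) + 1 = colw u.
      by move/pF; rewrite /colw /=; lia.
    have := fwt_map wu; have := fodd_map wu => H1 H2.
    have lF : ~~ low (map dn F) by case: (F) pF => //= u F' /(_ u (mem_head _ _)); lia.
    split; last first.
      rewrite /row_up (negbTE lF) -map_comp; congr cons.
      rewrite -[RHS]map_id; apply/eq_in_map => -[x y] /pF /=.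
      by case: y => //; rewrite andbF.
    apply/orP; right; rewrite /frob_set (negbTE lF) size_map.
    rewrite sorted_lt2_map ?(path_sorted sF) //=; last first.
      by move=> -[x1 y1] [x2 y2] /pF /= u0 /pF /= v0; rewrite /lt2 /=; lia.
    have {}oF : 1 + fodd F = o := oF.
    have {}wF : 1 + fwt F = n + d := wF.
    have -> : all (in_strip K a.+1) (map dn F).
      rewrite all_map; apply/allP => -[x1 y1] uF; move: (pF _ uF) (allP rF _ uF).
      by rewrite /in_strip /=; lia.
    by lia.
  have y0 : 0 < y by move: NE; rewrite x0; case: (y).
  have pF := low_pos2 sF y0.
  have wu u : u \in (x, y) :: F -> colw (dn u) + 1 = colw u.
    by move/pF; rewrite /colw /=; lia.
  have := fwt_map wu; have := fodd_map wu => H1 H2.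
  split; last first.
    rewrite /row_up /= x0 -map_comp prednK //; congr cons.
    rewrite -[RHS]map_id; apply/eq_in_map => -[x' y'] H.
    by rewrite /= prednK // (pF (x', y')) // inE H orbT.
  apply/orP; left; rewrite /frob_set sorted_lt2_map ?sF //; last first.
    by move=> -[x1 y1] [x2 y2] /pF /= u0 /pF /= v0; rewrite /lt2 /=; lia.
  have -> : all (in_strip K a.+1) (map dn ((x, y) :: F)).
    rewrite all_map; apply/allP => -[x1 y1] uF; move: (pF _ uF) (allP rF _ uF).
    by rewrite /in_strip /=; lia.
  have {}oF : fodd ((x, y) :: F) = o := oF.
  have {}dF : size ((x, y) :: F) = d := dF.
  have -> : low (map dn ((x, y) :: F)) = true by rewrite /= x0.
  by rewrite size_map dF; lia.
Qed.

Lemma frob_burge K : 1 < K -> burge_rec K (frob_count K).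
Proof.
move=> K1; split=> [a T o n aK|a T d o n aK small|a d o o' n aK d0 oo'|a d o o' n aK d0 oo'|a d o n aK].
- apply: has_card_uniq (frob_countP _ _ _ _ _ _) _.
  case: (boolP [&& ~~ T, o == 0 & n == 0]) => [/and3P[T0 /eqP-> /eqP->]|H].
    apply: eq_has_card (has_card1 ([::] : seq (nat * nat))) => F.
    apply/eqP/idP => [->|/and5P[_ _ _ /nilP //]].
    by rewrite /frob_set /=; case: (T) T0.
  apply: has_card0 => F; apply: contra H => /and5P[_ _ tF /nilP F0].
  by move: tF; rewrite F0 => /eqP<- /andP[/eqP<- /eqP<-].
- apply: has_card_uniq (frob_countP _ _ _ _ _ _) _.
  by apply: has_card0 => F; apply/negP => /frob_set_weights; lia.
- exact: frob_countS.
- exact: frob_countN.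
(* A smallest column (0, t) has rank at most 0, below the lower end 2 - K + a = 1 of the strip. *)
- apply: has_card_uniq (frob_countP _ _ _ _ _ _) _; apply: has_card0 => F.
  apply/negP => /and5P[_]; case: F => //= u F /andP[+ _] /eqP + _ _.
  by rewrite /in_strip; lia.
Qed.

(** * Partitions and their Frobenius symbols *)

Lemma has_card_image (T U : eqType) (P : pred T) (Q : pred U) (f : T -> U) k :
  (forall x y, P x -> P y -> f x = f y -> x = y) ->
  (forall x, P x -> Q (f x)) ->
  (forall y, Q y -> exists2 x, P x & f x = y) ->
  has_card P k -> has_card Q k.
Proof.
move=> fI fP fQ [s [us sP <-]]; exists (map f s); split; last by rewrite size_map.
  by rewrite map_inj_in_uniq // => x y; rewrite !sP; apply: fI.
move=> y; apply/mapP/idP => [[x + ->]|/fQ[x Px <-]]; first by rewrite sP; apply: fP.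
by exists x; rewrite ?sP.
Qed.

(* The partition with Frobenius columns D, largest first: the hook of the     *)
(* first column is wrapped around the partition of the remaining ones.        *)
Fixpoint unhook (D : seq (nat * nat)) : seq nat :=
  if D is (x, y) :: D' then
    x.+1 :: map S (unhook D') ++ nseq (y - size (unhook D')) 1
  else [::].

Definition gt2 (u v : nat * nat) : bool := lt2 v u.

Lemma unhook_cons x y D : unhook ((x, y) :: D)
  = x.+1 :: map S (unhook D) ++ nseq (y - size (unhook D)) 1.
Proof. by []. Qed.

Lemma size_unhook x y D : sorted gt2 ((x, y) :: D) ->
  size (unhook D) <= y /\ size (unhook ((x, y) :: D)) = y.+1.
Proof.
elim: D x y => [|[x' y'] D IH] x y sD; first by rewrite /= size_nseq; lia.
have /andP[/andP[_ yy'] sD'] := sD; rewrite /= in yy'.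
have [le1 eq1] := IH x' y' sD'; rewrite eq1; split=> //.
by rewrite unhook_cons -cat1s !size_cat size_map size_nseq eq1 /=; lia.
Qed.

Lemma size_le_unhook D : size D <= size (unhook D).
Proof.
elim: D => [|[x y] D IH] //; rewrite unhook_cons /= size_cat size_map; lia.
Qed.

Lemma head_unhook x y D : sorted gt2 ((x, y) :: D) -> head 0 (unhook D) <= x.
Proof. by case: D => [|[x' y'] D] //=; rewrite /gt2 /lt2 /=; lia. Qed.

Lemma sumn_unhook D : sorted gt2 D -> sumn (unhook D) = fwt D.
Proof.
elim: D => [|[x y] D IH] // sD; have [le _] := size_unhook sD.
have {}IH := IH (path_sorted sD).
rewrite unhook_cons [sumn _]/= sumn_cat sumn_nseq /fwt /= -/(fwt D) -IH /colw /=.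
suff -> : sumn (map S (unhook D)) = sumn (unhook D) + size (unhook D) by lia.
by elim: (unhook D) => //= z s ->; lia.
Qed.

Lemma unhook_partition D : sorted gt2 D -> is_partition (unhook D).
Proof.
elim: D => [|[x y] D IH] // sD.
have /andP[so ge1] := IH (path_sorted sD).
rewrite /is_partition /= all_cat all_nseq orbT andbT.
have -> /= : all (leq 1) (map S (unhook D)) by rewrite all_map; apply/allP.
rewrite andbT cat_path; apply/andP; split.
  have := head_unhook sD; case: (unhook D) so => //= z s so zx.
  apply/andP; split=> //.
  by rewrite path_map.
by case: (y - _) => //= n; rewrite last_map /=; elim: n => //= n ->.
Qed.

Lemma sorted_gt2_size x y D : sorted gt2 ((x, y) :: D) -> size D <= x.
Proof.
elim: D x y => [|[x' y'] D IH] x y //= /andP[/andP[/= xx' _] /IH]; lia.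
Qed.

Lemma nth_unhook D j : sorted gt2 D -> j < size D ->
  nth 0 (unhook D) j = (nth (0, 0) D j).1 + j.+1.
Proof.
elim: D j => [|[x y] D IH] [|j] // sD jD; first by rewrite /= addn1.
have jD2 : j < size D := jD.
have jD' := leq_trans jD2 (size_le_unhook D).
rewrite unhook_cons [nth 0 _ _]/= nth_cat size_map jD' (nth_map 0) // IH ?(path_sorted sD) //.
by rewrite /= !addnS.
Qed.

Lemma count_unhook D j : sorted gt2 D -> j < size D ->
  count (leq j.+1) (unhook D) = (nth (0, 0) D j).2 + j.+1.
Proof.
elim: D j => [|[x y] D IH] [|j] // sD jD.
  have /andP[_] := unhook_partition sD; rewrite all_count => /eqP->.
  by have [_ ->] := size_unhook sD; rewrite addn1.
have jD2 : j < size D := jD.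
have := sorted_gt2_size sD.
rewrite unhook_cons [count _ _]/= count_cat count_map count_nseq /= => lx.
rewrite (@eq_count _ _ (leq j.+1)) => [|z]; last by rewrite /= ltnS.
by rewrite IH ?(path_sorted sD) //; lia.
Qed.

(** Bounds the Durfee square by the number of columns. *)
Lemma nth_unhook_small D j : size D <= j -> nth 0 (unhook D) j <= j.
Proof.
elim: D j => [|[x y] D IH] [|j] // jD; rewrite unhook_cons /= nth_cat size_map.
case: ifP => jD'; first by rewrite (nth_map 0) // ltnS IH.
by rewrite nth_nseq; case: ifP.
Qed.

Lemma durfee_unhook D : sorted gt2 D -> durfee (unhook D) = size D.
Proof.
move=> sD; apply/eqP; rewrite eqn_leq /durfee; apply/andP; split.
  apply/bigmax_leqP_seq => d; rewrite mem_index_iota => /andP[d0 _].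
  rewrite /part => dle; rewrite leqNgt; apply/negP => lt.
  by have := @nth_unhook_small D d.-1; lia.
have [->//|D0] := posnP (size D).
apply: (leq_bigmax_seq (F := id)); last first.
  by rewrite /part nth_unhook //; lia.
by rewrite mem_index_iota D0 ltnS size_le_unhook.
Qed.

Lemma SR_unhook D j : sorted gt2 D -> j < size D ->
  SR (unhook D) (j + 1)
  = (((nth (0, 0) D j).1)%:Z - ((nth (0, 0) D j).2)%:Z)%R.
Proof.
move=> sD jD; rewrite /SR /part addn1 /= nth_unhook //.
have hD : j < head 0 (unhook D).
  case: D sD jD => [|[x y] D] //= /sorted_gt2_size; lia.
rewrite /conj_part (nth_map 0) ?size_iota // nth_iota // add1n count_unhook //.
rewrite !PoszD; ring.
Qed.

Lemma unhook_inj D D' : sorted gt2 D -> sorted gt2 D' ->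
  unhook D = unhook D' -> D = D'.
Proof.
move=> sD sD' E; have sz : size D = size D'.
  by rewrite -durfee_unhook // E durfee_unhook.
apply: (@eq_from_nth _ (0, 0)) => // j jD; have jD' := jD; rewrite sz in jD'.
have := nth_unhook sD jD; rewrite E nth_unhook // => /addIn E1.
have := count_unhook sD jD; rewrite E count_unhook // => /addIn E2.
by case: (nth _ D j) (nth _ D' j) E1 E2 => [? ?] [? ?] /= -> ->.
Qed.

Lemma unhook_surj s : is_partition s -> exists2 D, sorted gt2 D & unhook D = s.
Proof.
have [n] := ubnP (size s); elim: n s => // n IH [|x l]; first by exists [::].
rewrite ltnS => szl /andP[so /andP[x1 l1]].
(* [m] is what remains when the first row and the first column are removed. *)
pose m := map predn (filter (leq 2) l).
have sol := path_sorted so.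
have mP : is_partition m.
  rewrite /is_partition; apply/andP; split; last first.
    by rewrite all_map; apply/allP => y; rewrite mem_filter => /andP[/= + _]; case: y.
  rewrite sorted_map; apply: sub_sorted (sorted_filter _ _ sol).
    by move=> y z /=; lia.
  by move=> ? ? ?; exact: (fun A B => leq_trans B A).
have szm : size m <= size l by rewrite size_map size_filter count_size.
have [D sD Dm] := IH m (leq_ltn_trans szm szl) mP.
exists ((x.-1, size l) :: D); last first.
  rewrite unhook_cons Dm prednK //; congr cons.
  rewrite -map_comp size_map size_filter {IH szl so mP szm D sD Dm m}.
  elim: l l1 sol => //= y l IH /andP[y1 l1] so.
  case: leqP => y2; last first.
    by rewrite add1n subSS /= IH ?(path_sorted so) // prednK.
  have y1E : y = 1 by lia.
  have l0 : filter (leq 2) l = [::].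
    apply/nilP; rewrite /nilp size_filter -leqn0 leqNgt -has_count -all_predC.
    apply/allP => z zl /=.
    have /allP/(_ z zl) /= := order_path_min (fun b a c A B => leq_trans B A) so.
    by lia.
  have := IH l1 (path_sorted so); rewrite -size_filter l0 /= !subn0 y1E.
  by move=> E; rewrite -{2}E.
case: D sD Dm => [|[a b] D]; first by [].
move=> sD Dm; have [_ szD] := size_unhook sD; rewrite Dm in szD.
apply/andP; split=> //; rewrite /gt2 /lt2 -szD szm andbT [(_, _).1]/= [(_, _).1]/=.
move: Dm; rewrite unhook_cons; case E: m => [//|z m'] [-> _].
have : z \in m by rewrite E mem_head.
case/mapP => y; rewrite mem_filter => /andP[/= y2 yl] ->.
have /allP/(_ y yl) /= := order_path_min (fun b a c A B => leq_trans B A) so.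
lia.
Qed.

(** The strip ends at 2K - 2i, which is even, so for odd ranks the bound is 2K - 1 - 2i; and s + t +
    1 is even exactly when s - t is odd. *)
Lemma rank_in_range K i x y : 0 < i -> 2 * i <= K + 1 ->
  [&& ~~ (2 %| (x%:Z - y%:Z)%R)%Z, (3 - (2 * i)%N%:Z <= x%:Z - y%:Z)%R
    & (x%:Z - y%:Z <= (2 * K)%N%:Z - 1 - (2 * i)%N%:Z)%R]
  = in_strip K (K + 1 - 2 * i) (x, y) && ~~ odd (colw (x, y)).
Proof. by move=> i0 iK; rewrite /in_strip /colw /=; lia. Qed.

Lemma Rpred_unhook K i D : 0 < i -> 2 * i <= K + 1 -> sorted gt2 D ->
  Rpred K i (unhook D) = all (in_strip K (K + 1 - 2 * i)) D && (fodd D == 0).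
Proof.
move=> i0 iK sD; rewrite /Rpred unhook_partition // durfee_unhook //=.
have -> : (fodd D == 0) = all (fun u => ~~ odd (colw u)) D.
  by rewrite /fodd -leqn0 leqNgt -has_count -all_predC.
rewrite -all_predI; apply/forallP/allP => [H u uD|H j].
  have jD : index u D < size D by rewrite index_mem.
  have := H (Ordinal jD); rewrite SR_unhook //= rank_in_range //.
  by rewrite -surjective_pairing nth_index.
rewrite SR_unhook //= rank_in_range // -surjective_pairing.
exact/H/mem_nth.
Qed.

Lemma R_frob K i N : 0 < i -> 2 * i <= K + 1 ->
  R K i N = \sum_(0 <= d < N.+1)
    (frob_count K (K + 1 - 2 * i) true d 0 N
     + frob_count K (K + 1 - 2 * i) false d 0 N).
Proof.
move=> i0 iK; set a := K + 1 - 2 * i.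
apply: (@has_card_uniq _ (fun s => (sumn s == N) && Rpred K i s)).
  apply: (has_card_sum (st := size)) => [s /andP[/eqP <- /andP[/is_partition_size]]//|m _].
  by apply: eq_has_card (num_seqsP _ _ _) => s; rewrite /= andbC.
pose Q F := [&& sorted lt2 F, all (in_strip K a) F, fodd F == 0 & fwt F == N].
have HQ : has_card Q (\sum_(0 <= d < N.+1)
    (frob_count K a true d 0 N + frob_count K a false d 0 N)).
  apply: (has_card_sum (st := size)) => [F /and4P[_ _ _ /eqP <-]|d _].
    by rewrite ltnS size_le_fwt.
  apply: eq_has_card (has_cardU _ (frob_countP K a true d 0 N) (frob_countP K a false d 0 N)).
    move=> F; rewrite /Q /frob_set.
    by case: (low F); rewrite /= ?andbF ?orbF ?andbT /=; do !case: (_ == _); rewrite ?andbF ?andbT.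
  by move=> F /and5P[_ _ /eqP tF _ _]; rewrite /frob_set tF !andbF.
(* [unhook] wants the largest column first, [frob_set] the smallest, hence the reversal. *)
have sE (F : seq (nat * nat)) : sorted gt2 (rev F) = sorted lt2 F by rewrite rev_sorted.
have aE (F : seq (nat * nat)) : all (in_strip K a) (rev F) = all (in_strip K a) F by rewrite all_rev.
have oE F : fodd (rev F) = fodd F by rewrite /fodd count_rev.
have wE F : fwt (rev F) = fwt F by rewrite /fwt map_rev sumn_rev.
apply: (has_card_image (f := unhook \o rev) _ _ _ HQ) => [F F'|F|s].
- move=> /and4P[sF _ _ _] /and4P[sF1 _ _ _] /= E.
  by apply: (can_inj revK); apply: unhook_inj E; rewrite sE.
- case/and4P => sF aF oF wF /=.
  by rewrite sumn_unhook ?Rpred_unhook ?sE // wE wF aE oE aF oF.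
- case/andP => wF Rs; have /andP[/unhook_surj[D sD DE] _] := Rs.
  rewrite -DE sumn_unhook // in wF; rewrite -DE Rpred_unhook // in Rs.
  have [aD oD] := andP Rs; exists (rev D); last by rewrite /= revK.
  by rewrite /Q -sE -aE -oE -wE revK sD aD oD wF.
Qed.

(** * Partitions and their multiplicities *)

Lemma geq_trans : transitive geq.
Proof. by move=> y x z xy yz; apply: leq_trans yz xy. Qed.

Lemma path_geq_all x s : path geq x s -> all (geq x) s.
Proof. exact: order_path_min geq_trans. Qed.

Lemma nth_geq_count s v k : sorted geq s -> 0 < v ->
  (v <= nth 0 s k) = (k < count (leq v) s).
Proof.
move=> + v0; elim: s k => [|x s IH] k so; first by rewrite nth_nil /=; lia.
have c0 : x < v -> count (leq v) s = 0.
  move=> xv; apply/eqP; rewrite eqn0Ngt -has_count -all_predC.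
  by apply/allP => y /(allP (path_geq_all so)) /=; lia.
case: k => [|k] /=; last rewrite IH ?(path_sorted so) //.
  by case: leqP c0 => [_ _|xv /(_ isT) ->]; lia.
by case: leqP c0 => [_ _|xv /(_ isT) ->]; lia.
Qed.

Lemma count_leq_step v s : count (leq v) s = count_mem v s + count (leq v.+1) s.
Proof. by elim: s => //= x s ->; case: ltngtP; lia. Qed.

(** In a nonincreasing sequence, K consecutive parts that differ by at most 1 are K parts among two
    neighbouring values. *)
Lemma windowP K p : 0 < K -> is_partition p ->
  reflect (forall v, 0 < v -> count_mem v p + count_mem v.+1 p < K)
    [forall l : 'I_(size p), (l + K <= size p) ==>
         (nth 0 p (l + K - 1) + 2 <= nth 0 p l)].
Proof.
move=> K0 /andP[so p1].
have cE v : count (leq v) p = count_mem v p + count_mem v.+1 p + count (leq v.+2) p.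
  by rewrite -addnA -!count_leq_step.
have csz v : count (leq v) p <= size p by apply: count_size.
apply: (iffP forallP) => [H v v0|H l]; last first.
  apply/implyP => lK; set v := nth 0 p (l + K - 1).
  have lK1 : l + K - 1 < size p by lia.
  have v0 : 0 < v by apply: (allP p1); apply: mem_nth lK1.
  have : v <= nth 0 p (l + K - 1) by [].
  rewrite nth_geq_count // cE addn2 nth_geq_count //.
  by have := H v v0; lia.
rewrite ltnNge; apply/negP => Kc.
(* [l] is the position of the first part at most v + 1. *)
have := cE v; set l := count (leq v.+2) p => lE.
have lv := csz v.
have l_lt : l < size p by lia.
have lK : l + K <= size p by lia.
have /= /implyP/(_ lK) := H (Ordinal l_lt).
suff : v <= nth 0 p (l + K - 1).
  have : ~~ (v.+2 <= nth 0 p l) by rewrite nth_geq_count // -/l ltnn.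
  by lia.
by rewrite nth_geq_count //; lia.
Qed.

Fixpoint ascending (k : nat) (f : seq nat) : seq nat :=
  if f is x :: f' then nseq x k ++ ascending k.+1 f' else [::].

Definition of_mults (f : seq nat) : seq nat := rev (ascending 1 f).

Lemma ascending_ge k f : all (leq k) (ascending k f).
Proof.
elim: f k => //= x f IH k; rewrite all_cat all_nseq leqnn orbT /=.
by apply: sub_all (IH k.+1) => y; apply: ltnW.
Qed.

Lemma sorted_ascending k f : sorted leq (ascending k f).
Proof.
elim: f k => //= x f IH k; elim: x => [|x IHx] //=.
rewrite path_min_sorted ?IHx // all_cat all_nseq leqnn orbT /=.
by apply: sub_all (ascending_ge k.+1 f) => y; apply: ltnW.
Qed.

Lemma of_mults_partition f : is_partition (of_mults f).
Proof. by rewrite /is_partition rev_sorted sorted_ascending all_rev ascending_ge. Qed.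

Lemma sumn_of_mults f : sumn (of_mults f) = wt 1 f.
Proof.
rewrite sumn_rev; elim: f 1 => //= x f IH k.
by rewrite sumn_cat sumn_nseq IH.
Qed.

Lemma count_of_mults f v : count_mem v.+1 (of_mults f) = nth 0 f v.
Proof.
rewrite count_rev -[v.+1]/(1 + v); elim: f 1 v => [|x f IH] k v /=; first by rewrite nth_nil.
rewrite count_cat count_nseq /=; case: v => [|v].
  rewrite addn0 eqxx mul1n (count_memPn _) ?addn0 //.
  by apply/negP => /(allP (ascending_ge _ _)); rewrite /= ltnn.
by rewrite addnS -addSn IH /=; case: eqP => //; lia.
Qed.

Lemma trimmed_inj f g : trimmed f -> trimmed g ->
  (forall v, nth 0 f v = nth 0 g v) -> f = g.
Proof.
move=> nf ng E; suff sz : size f = size g by apply: eq_from_nth => // i _; apply: E.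
have last_nth0 (h : seq nat) : 0 < size h -> trimmed h -> 0 < nth 0 h (size h).-1.
  by case: h => // x h _; rewrite /trimmed nth_last /= lt0n.
case: (ltngtP (size f) (size g)) => // lt.
  by have := last_nth0 g (leq_ltn_trans (leq0n _) lt) ng; rewrite -E nth_default //; lia.
by have := last_nth0 f (leq_ltn_trans (leq0n _) lt) nf; rewrite E nth_default //; lia.
Qed.

Lemma of_mults_inj f g : trimmed f -> trimmed g -> of_mults f = of_mults g -> f = g.
Proof.
by move=> nf ng E; apply: trimmed_inj => // v; rewrite -!count_of_mults E.
Qed.

Lemma of_mults_surj p : is_partition p -> exists2 f, trimmed f & of_mults f = p.
Proof.
move=> pP; have /andP[so p1] := pP.
pose f := [seq count_mem j p | j <- iota 1 (head 0 p)]; exists f.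
  rewrite /f; case: p so p1 {pP f} => //= x p _ /andP[x0 _].
  by case: x x0 => // x _; rewrite -[x.+1]addn1 iotaD map_cat /trimmed last_cat /= add1n addn1 eqxx.
have antig : antisymmetric geq by move=> a b H; apply/anti_leq; rewrite andbC.
apply: (sorted_eq geq_trans antig); [by case/andP: (of_mults_partition f)| exact: so |].
apply/allP => v _; apply/eqP; case: v => [|v].
  rewrite !(count_memPn _) //; apply/negP; first by move/(allP p1).
  by case/andP: (of_mults_partition f) => _ /allP H /H.
rewrite count_of_mults; case: (ltnP v (head 0 p)) => lt.
  by rewrite (nth_map 0) ?size_iota // nth_iota // add1n.
rewrite nth_default ?size_map ?size_iota //; apply/esym/count_memPn/negP.
case: p so lt {pP p1 f} => //= x p so lt; rewrite inE => /orP[/eqP|/(allP (path_geq_all so)) /=]; lia.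
Qed.

Lemma fitsP K a f : reflect (forall j, nth 0 (a :: f) j + nth 0 f j < K) (fits K a f).
Proof.
elim: f a => [|x f IH] a /=.
  by apply: (iffP idP) => [aK [|j]|/(_ 0)] /=; rewrite ?nth_nil ?addn0 //; lia.
apply: (iffP andP) => [[ax /IH H] [|j]|H] //; first exact: (H j).
split; first exact: (H 0).
by apply/IH => j; apply: (H j.+1).
Qed.

Lemma nodd0P b f :
  reflect (forall j, b (+) odd j -> ~~ odd (nth 0 f j)) (nodd b f == 0).
Proof.
elim: f b => [|x f IH] b /=.
  by constructor => j _; rewrite nth_nil.
have E j : b (+) odd j.+1 = ~~ b (+) odd j by rewrite /= addbN addNb.
rewrite addn_eq0; apply: (iffP andP) => [[bx /IH H] [|j]|H].
- by rewrite addbF /= => bT; move: bx; rewrite bT; case: odd.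
- by rewrite E; apply: H.
split; last by apply/IH => j; rewrite -E; apply: (H j.+1).
by move: (H 0); rewrite addbF /=; case: (b) => // /(_ isT); case: odd.
Qed.

Lemma Epred_of_mults K i f : 0 < i -> 2 * i <= K + 1 ->
  Epred K i (of_mults f) = fits K (K + 1 - 2 * i) f && (nodd true f == 0).
Proof.
move=> i0 iK; have K0 : 0 < K by lia.
have pP := of_mults_partition f; rewrite /Epred pP andTb.
apply/and3P/andP => [[c2 c3' c1]|[/fitsP F /nodd0P Od]].
  have c3 := elimT (windowP K0 pP) c3'; split.
    apply/fitsP => -[|j] /=; first by move: c1; rewrite count_of_mults; lia.
    by have := c3 j.+1 isT; rewrite !count_of_mults.
  apply/nodd0P => j oj; rewrite -count_of_mults.
  have oj1 : odd j.+1 by move: oj; rewrite /=; case: odd.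
  case: (boolP (j.+1 \in of_mults f)) => [jp|/count_memPn -> //].
  exact: (implyP (allP c2 _ jp) oj1).
split.
- apply/allP => -[//|j] _; apply/implyP => oj; rewrite count_of_mults.
  by apply: Od; move: oj; rewrite /=; case: odd.
- by apply/(windowP K0 pP) => -[//|v] _; rewrite !count_of_mults; apply: (F v.+1).
- by have := F 0; rewrite count_of_mults /=; lia.
Qed.

Lemma E_mult K i N : 0 < i -> 2 * i <= K + 1 ->
  \sum_(0 <= m < N.+1) E K i N m = \sum_(0 <= d < N.+1)
    (mult_count K (K + 1 - 2 * i) true d 0 N
     + mult_count K (K + 1 - 2 * i) false d 0 N).
Proof.
move=> i0 iK; set a := K + 1 - 2 * i.
apply: (@has_card_uniq _ (fun s => (sumn s == N) && Epred K i s)).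
  apply: (has_card_sum (st := size)) => [s /andP[/eqP <- /andP[/is_partition_size]]//|m _].
  by apply: eq_has_card (num_seqsP _ _ _) => s; rewrite /= andbC.
pose Q f := [&& trimmed f, fits K a f, nodd true f == 0 & wt 1 f == N].
have HQ : has_card Q (\sum_(0 <= d < N.+1)
    (mult_count K a true d 0 N + mult_count K a false d 0 N)).
  apply: (has_card_sum (st := npairs)) => [f /and4P[_ _ _ /eqP <-]|d _].
    by have := wt_shift_down f (ltn0Sn 0); lia.
  apply: eq_has_card (has_cardU _ (mult_countP K a true d 0 N) (mult_countP K a false d 0 N)).
    move=> f; rewrite /Q /mult_set.
    by case: (top f); rewrite /= ?andbF ?orbF ?andbT /=; do !case: (_ == _); rewrite ?andbF ?andbT.
  by move=> f /and5P[_ _ /eqP tf _ _]; rewrite /mult_set tf !andbF.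
apply: (has_card_image (f := of_mults) _ _ _ HQ) => [f g|f|s].
- by move=> /and4P[nf _ _ _] /and4P[ng _ _ _]; apply: of_mults_inj.
- by case/and4P => nf af of_ wf; rewrite sumn_of_mults Epred_of_mults // wf af.
- case/andP => wf Rs; have /andP[/of_mults_surj[f nf fE] _] := Rs.
  rewrite -fE sumn_of_mults in wf; rewrite -fE Epred_of_mults // in Rs.
  by have [aD oD] := andP Rs; exists f; rewrite // /Q nf aD oD wf.
Qed.

Theorem E_eq_R K i N : 1 < K -> 0 < i -> 2 * i <= K + 1 ->
  \sum_(0 <= m < N.+1) E K i N m = R K i N.
Proof.
move=> K1 i0 iK; rewrite E_mult // R_frob //; apply: eq_bigr => d _.
by rewrite !(burge_rec_uniq (mult_burge K1) (frob_burge K1)) //; lia.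
Qed.

(** * Jagged partitions *)

Fixpoint to_jagged (p : seq nat) : seq nat :=
  match p with
  | [::] => [::]
  | x :: p' =>
    if odd x then if p' is _ :: p'' then x./2 :: x./2.+1 :: to_jagged p'' else [::]
    else x./2 :: to_jagged p'
  end.

Fixpoint of_jagged (s : seq nat) : seq nat :=
  match s with
  | [::] => [::]
  | a :: s' =>
    if s' is b :: s'' then
      if b == a.+1 then a.*2.+1 :: a.*2.+1 :: of_jagged s''
      else a.*2 :: of_jagged s'
    else [:: a.*2]
  end.

Fixpoint paired (p : seq nat) : bool :=
  match p with
  | [::] => true
  | x :: p' =>
    if odd x then if p' is y :: p'' then (y == x) && paired p'' else false
    else paired p'
  end.

Lemma seq_ind2 (T : Type) (P : seq T -> Prop) :
  P [::] -> (forall x, P [:: x]) ->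
  (forall x y s, P s -> P (y :: s) -> P (x :: y :: s)) -> forall s, P s.
Proof.
move=> P0 P1 P2 s; suff [] : P s /\ forall x, P (x :: s) by [].
by elim: s => [|x s [IH1 IH2]]; split=> // y; apply: P2.
Qed.

Lemma of_jaggedK s : to_jagged (of_jagged s) = s.
Proof.
elim/seq_ind2: s => [|a|a b s IH1 IH2] //=; first by rewrite odd_double doubleK.
case: eqP => [->|_] /=; first by rewrite odd_double /= uphalf_double IH1.
by rewrite odd_double doubleK [to_jagged _]IH2.
Qed.

Lemma of_jagged_cons a b s : of_jagged (a :: b :: s) =
  if b == a.+1 then a.*2.+1 :: a.*2.+1 :: of_jagged s
  else a.*2 :: of_jagged (b :: s).
Proof. by []. Qed.

Lemma to_jagged_cons x p : to_jagged (x :: p) =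
  if odd x then if p is _ :: p' then x./2 :: x./2.+1 :: to_jagged p' else [::]
  else x./2 :: to_jagged p.
Proof. by []. Qed.

Lemma paired_cons x p : paired (x :: p) =
  if odd x then if p is y :: p' then (y == x) && paired p' else false
  else paired p.
Proof. by []. Qed.

(** An even part 2r creates no false pair r, r + 1: the next entry is half of a part that is at most
    2r. *)
Lemma to_jaggedK p : sorted geq p -> paired p -> of_jagged (to_jagged p) = p.
Proof.
elim/seq_ind2: p => [|x|x y p IH1 IH2] //.
  by rewrite /=; case: ifP => //= ox _ _; have := odd_double_half x; rewrite ox => {2}<-.
move=> so; rewrite paired_cons to_jagged_cons; have := odd_double_half x.
case: ifP => ox xE.
  move=> /andP[/eqP yx pp]; rewrite of_jagged_cons eqxx.
  by rewrite IH1 ?(path_sorted (path_sorted so)) // yx -[_.*2.+1]add1n xE.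
move=> pp; have := IH2 (path_sorted so) pp.
case E: (to_jagged (y :: p)) => [//|b s] IHE.
rewrite of_jagged_cons IHE -[_.*2]add0n xE ifN //; apply/eqP => bE.
have by2 : b = y./2.
  by move: E => /=; case: (odd y) => [|[] //]; case: (p) => // ? ? [].
by have /andP[xy _] := so; have := half_leq xy; lia.
Qed.

Lemma paired_even_mult p v : paired p -> odd v -> ~~ odd (count_mem v p).
Proof.
move=> + ov; elim/seq_ind2: p => [|x|x y p IH1 IH2] //=.
  by case: ifP => // ox _; case: eqP => // E; rewrite E ov in ox.
case: ifP => ox; last by move/IH2; case: eqP => // E; rewrite E ov in ox.
by case/andP => /eqP -> /IH1; rewrite addnA oddD addnn odd_double.
Qed.

Lemma even_mult_paired p : sorted geq p ->
  (forall v, odd v -> ~~ odd (count_mem v p)) -> paired p.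
Proof.
elim/seq_ind2: p => [|x|x y p IH1 IH2] //.
  by move=> _ /(_ x) /=; rewrite eqxx; case: odd => // /(_ isT).
move=> so H; rewrite paired_cons; case: ifP => ox; last first.
  apply: IH2 (path_sorted so) _ => v ov; have := H v ov; rewrite /=.
  by case: (x =P v) => [E|//]; rewrite E ov in ox.
have yx : y = x.
  have Hx : ~~ odd (1 + count_mem x (y :: p)) by have := H x ox; rewrite /= eqxx.
  have : x \in y :: p.
    by apply/negPn/negP => /count_memPn C; rewrite C in Hx.
  rewrite inE => /orP[/eqP//|xp]; apply/eqP; rewrite eqn_leq.
  move: so => /= /andP[-> so]; exact: (allP (path_geq_all so)).
rewrite yx eqxx; apply: IH1 (path_sorted (path_sorted so)) _ => v ov.
by have := H v ov; rewrite /= yx addnA oddD addnn odd_double.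
Qed.

Lemma paired_allP p : sorted geq p ->
  all (fun x => odd x ==> ~~ odd (count_mem x p)) p = paired p.
Proof.
move=> so; apply/allP/idP => [H|pp x _]; last first.
  by apply/implyP => ox; apply: paired_even_mult.
apply: even_mult_paired so _ => v ov.
case: (boolP (v \in p)) => [vp|/count_memPn -> //]; exact: (implyP (H v vp) ov).
Qed.

Lemma size_to_jagged p : paired p -> size (to_jagged p) = size p.
Proof.
elim/seq_ind2: p => [|x|x y p IH1 IH2] //; rewrite paired_cons to_jagged_cons.
  by case: ifP.
by case: ifP => _; [move=> /andP[_ /IH1 /= ->] | move=> /IH2 /= ->].
Qed.

Lemma sumn_to_jagged p : paired p -> sumn p = 2 * sumn (to_jagged p).
Proof.
elim/seq_ind2: p => [|x|x y p IH1 IH2] //; rewrite paired_cons to_jagged_cons.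
  by case: ifP => //= ox _; have := odd_double_half x; rewrite ox; lia.
case: ifP => ox; have := odd_double_half x; rewrite ox.
  by move=> xE /andP[/eqP-> /IH1 /= ->]; lia.
by move=> xE /IH2 /=; lia.
Qed.

Lemma pairs01_cons a s :
  pairs01 (a :: s) = [&& 0 < size s, a == 0 & head 0 s == 1] + pairs01 s.
Proof.
rewrite /pairs01 -!sum1_card big_mkcond /= big_ord_recl; congr (_ + _).
  by rewrite inE -nth0 addn1 ltnS /=; case: ifP.
rewrite [RHS]big_mkcond; apply: eq_bigr => j _.
by rewrite !inE lift0 !addn1 ltnS.
Qed.

Lemma pairs01_to_jagged p : paired p -> all (leq 1) p ->
  count_mem 1 p = 2 * pairs01 (to_jagged p).
Proof.
have p0 : pairs01 [::] = 0 by rewrite /pairs01; apply: eq_card0 => -[].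
elim/seq_ind2: p => [|x|x y p IH1 IH2]; first by rewrite p0.
  rewrite paired_cons to_jagged_cons; case: ifP => // ox _ _.
  rewrite pairs01_cons /= p0; case: eqP ox => [->|] //.
rewrite paired_cons to_jagged_cons; case: ifP => ox.
  move=> /andP[/eqP -> pp] /and3P[x0 _ al].
  rewrite !pairs01_cons /= IH1 // andbF add0n.
  have <- : (x == 1) = (x./2 == 0) && (x./2.+1 == 1).
    by move: ox; case: x {x0} => [|[|[|x]]].
  lia.
move=> pp /andP[x0 al]; rewrite [count_mem _ _]/= -/(count_mem 1 (y :: p)) IH2 // pairs01_cons.
have -> : x == 1 = false by case: eqP ox => [->|].
have -> : x./2 == 0 = false by move: ox x0; case: x => [|[|x]].
by rewrite andbF.
Qed.

(** For a paired sequence, this parity says that [l] is the second place of a pair of odd parts. *)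
Definition inside (p : seq nat) (l : nat) : bool := odd (count odd (take l p)).

Lemma insideS p l : l < size p -> inside p l.+1 = inside p l (+) odd (nth 0 p l).
Proof.
move=> lp; rewrite /inside (take_nth 0 lp) -cats1 count_cat oddD /=.
by case: (odd (nth 0 p l)).
Qed.

Lemma nth_to_jagged p l : paired p ->
  nth 0 (to_jagged p) l = (nth 0 p l)./2 + inside p l.
Proof.
elim/seq_ind2: p l => [|x|x y p IH1 IH2] l; first by rewrite !nth_nil /inside.
  rewrite paired_cons to_jagged_cons; case: ifP => // ox _.
  by case: l => [|l]; rewrite /= ?addn0 // !nth_nil /inside /= ox.
rewrite paired_cons to_jagged_cons; case: ifP => ox.
  move=> /andP[/eqP -> pp]; case: l => [|[|l]]; rewrite /= ?addn0 //.
    by rewrite /inside /= ?take0 /= ox addn1.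
  by rewrite IH1 // /inside /= ox /= negbK.
move=> pp; case: l => [|l]; first by rewrite /= addn0.
by rewrite -[nth 0 (_ :: _) l.+1]/(nth 0 (to_jagged (y :: p)) l) IH2 // /inside /= ox.
Qed.

Lemma paired_first p l : paired p -> l < size p -> ~~ inside p l ->
  odd (nth 0 p l) -> (l.+1 < size p) && (nth 0 p l.+1 == nth 0 p l).
Proof.
elim/seq_ind2: p l => [|x|x y p IH1 IH2] l //.
  by case: l => [|l] //=; case: ifP.
rewrite paired_cons; case: ifP => ox.
  case/andP => yx pp; case: l => [|[|l]] //=.
    by rewrite /inside /= ?take0 ox.
  by move=> lp H; apply: IH1 => //; move: H; rewrite /inside /= (eqP yx) ox /= negbK.
move=> pp; case: l => [|l] //=; first by rewrite ox.
by move=> lp H; apply: IH2 => //; move: H; rewrite /inside /= ox.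
Qed.

Lemma paired_second p l : paired p -> inside p l.+1 ->
  [&& l.+1 < size p, nth 0 p l.+1 == nth 0 p l, odd (nth 0 p l) & ~~ inside p l].
Proof.
elim/seq_ind2: p l => [|x|x y p IH1 IH2] l.
- by rewrite /inside.
- by rewrite /inside /=; case: ifP => // ->.
rewrite paired_cons; case: ifP => ox.
  case/andP => yx pp; case: l => [|[|l]].
  + by rewrite /inside /= ox yx.
  + by rewrite /inside /= ?take0 (eqP yx) ox.
  by move=> H; have := IH1 l pp; rewrite /inside /= (eqP yx) ox /= !negbK; apply; move: H; rewrite /inside /= (eqP yx) ox /= negbK.
move=> pp; case: l => [|l]; first by rewrite /inside /= ox.
by move=> H; have := IH2 l pp; rewrite /inside /= ox; apply; move: H; rewrite /inside /= ox.
Qed.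

Section ToJagged.
Variables (p : seq nat).
Hypotheses (pP : is_partition p) (pp : paired p).
Let s := to_jagged p.

Lemma part_mono i j : i <= j -> j < size p -> nth 0 p j <= nth 0 p i.
Proof.
have /andP[so _] := pP => ij jp.
have := (sorted_leq_nth geq_trans leqnn 0 so) i j.
by rewrite !inE; apply=> //; apply: leq_ltn_trans jp.
Qed.

Lemma to_jagged_first l : l < size p -> ~~ inside p l -> odd (nth 0 p l) ->
  [/\ l.+1 < size p, nth 0 p l.+1 = nth 0 p l & inside p l.+1].
Proof.
move=> lp tl ol; have /andP[-> /eqP->] := paired_first pp lp tl ol.
by rewrite insideS // ol (negbTE tl).
Qed.

Lemma to_jagged_second l : inside p l -> l < size p ->
  exists2 k, l = k.+1 & [/\ ~~ inside p k, odd (nth 0 p l) & nth 0 p k = nth 0 p l].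
Proof.
case: l => [|k] H lp; first by move: H; rewrite /inside take0.
exists k => //.
by have /and4P[_ /eqP-> -> ->] := paired_second pp H.
Qed.

Lemma inside_even l : l < size p -> ~~ odd (nth 0 p l) -> ~~ inside p l /\ ~~ inside p l.+1.
Proof.
move=> lp ol; have tl : ~~ inside p l.
  by apply/negP => H; have [k _ [_ ol']] := to_jagged_second H lp; rewrite ol' in ol.
by rewrite insideS // (negbTE ol) (negbTE tl).
Qed.

Lemma inside_after l : inside p l -> l < size p -> ~~ inside p l.+1.
Proof.
by move=> tl lp; have [k _ [_ ol _]] := to_jagged_second tl lp; rewrite insideS // ol tl.
Qed.

Lemma jagged_to_jagged : jagged s.
Proof.
have N l : nth 0 s l = (nth 0 p l)./2 + inside p l := nth_to_jagged l pp.
have sz : size s = size p := size_to_jagged pp.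
apply/and3P; split.
- apply/forallP => -[j _] /=; apply/implyP; rewrite sz !N addn1 => jp.
  have := part_mono (leqnSn j) jp; case: (boolP (inside p j)) => tj.
    by have := inside_after tj; lia.
  by lia.
- apply/forallP => -[j _] /=; apply/implyP; rewrite sz !N addn2 => jp.
  have m1 := part_mono (leqnSn j.+1) jp; have m2 := part_mono (leqnSn j) (ltnW jp).
  case: (boolP (inside p j.+2)) => t2; last by lia.
  have [_ [<-] [t1 o2 E]] := to_jagged_second t2 jp.
  case: (boolP (inside p j)) => tj; first by lia.
  case: (ltngtP (nth 0 p j.+1) (nth 0 p j)) => E2; try lia.
  have oj : odd (nth 0 p j) by rewrite -E2 E.
  by have [_ _] := to_jagged_first (ltn_trans (ltnSn _) (ltnW jp)) tj oj; rewrite (negbTE t1).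
- apply/implyP; rewrite sz => p0; rewrite -nth_last N sz.
  have lp : (size p).-1 < size p by lia.
  have : 0 < nth 0 p (size p).-1 by case/andP: pP => _ /allP; apply; apply: mem_nth.
  case: (boolP (inside _ _)) => t; first by lia.
  case: (boolP (odd (nth 0 p (size p).-1))) => o; last by lia.
  by have [] := to_jagged_first lp t o; lia.
Qed.

(** The entry at l is half of p_l, plus 1 at the second place of an odd pair. A drop of 2 in p gives
    a drop of at least 1 in the entries, except from the first place of a pair 2r + 3 to the second
    place of a pair 2r + 1, which is the second alternative. Conversely, a window of p that is too
    flat contradicts restriction at l or at a neighbouring window. *)
Lemma restricted_to_jagged K : 2 < K -> restricted K s =
  [forall l : 'I_(size p), (l + K <= size p) ==>
     (nth 0 p (l + K - 1) + 2 <= nth 0 p l)].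
Proof.
case: K => [|[|[|K]]] // _.
have N l : nth 0 s l = (nth 0 p l)./2 + inside p l := nth_to_jagged l pp.
have sz : size s = size p := size_to_jagged pp.
have a1 l : l + K.+3 - 1 = (l + K).+2 by lia.
have a2 l : l + K.+3 - 2 = (l + K).+1 by lia.
apply/forallP/forallP => H.
- suff W l : l + K.+3 <= size p -> nth 0 p (l + K).+2 + 2 <= nth 0 p l.
    by move=> l; apply/implyP; rewrite a1; apply: W.
  have {H}H l' : l' + K.+3 <= size p ->
      nth 0 s (l' + K).+2 + 1 <= nth 0 s l' \/
      [/\ nth 0 s l' + 1 = nth 0 s l'.+1, nth 0 s l' = nth 0 s (l' + K).+1 + 1
        & nth 0 s l' = nth 0 s (l' + K).+2].
    move=> lK; have ls : l' < size s by lia.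
    have /implyP := H (Ordinal ls); rewrite /= sz a1 a2 !addn1 => /(_ lK).
    by case/orP => [?|/and3P[/eqP ? /eqP ? /eqP ?]]; [left | right].
  move=> lK; rewrite leqNgt; apply/negP => bad.
  have m1 : nth 0 p (l + K).+2 <= nth 0 p (l + K).+1 by apply: part_mono; lia.
  have m2 : nth 0 p (l + K).+1 <= nth 0 p (l + K) by apply: part_mono; lia.
  case: (boolP (inside p l)) => tl.
    (* [l] is the second place of a pair: the window one place to the left is too flat as well. *)
    have lp : l < size p by lia.
    have [k E [tk ol Ek]] := to_jagged_second tl lp.
    have kK : k + K.+3 <= size p by lia.
    have := H k kK; rewrite !N (_ : (k + K).+2 = (l + K).+1); last by lia.
    by rewrite (_ : (k + K).+1 = l + K) -?E ?tl ?(negbTE tk) ?Ek; [case=> [|[]] | ]; lia.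
  have := H l lK; rewrite !N (negbTE tl).
  case: (boolP (odd (nth 0 p l))) => ol; first by case=> [|[]]; lia.
  have lp : l < size p by lia.
  have [_ /negbTE tl1] := inside_even lp ol.
  have m3 : nth 0 p l.+1 <= nth 0 p l by apply: part_mono; lia.
  rewrite tl1 => alt.
  (* For p_l = 2r, the window can only end at the first place of a pair 2r - 1; then the window one
     place to the right fails. *)
  have [t'] : ~~ inside p (l + K).+2 /\ odd (nth 0 p (l + K).+2) by case: alt => [|[]]; lia.
  have lp' : (l + K).+2 < size p by lia.
  move=> o'; have [sz' E' i'] := to_jagged_first lp' t' o'.
  have lK1 : l.+1 + K.+3 <= size p by lia.
  have := H l.+1 lK1; rewrite !N !addSn E' i' tl1.
  case: (boolP (odd (nth 0 p l.+1))) => ol1; first by case=> [|[]]; lia.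
  have lp1 : l.+1 < size p by lia.
  have [_ /negbTE ->] := inside_even lp1 ol1.
  have m4 : nth 0 p l.+2 <= nth 0 p l.+1 by apply: part_mono; lia.
  by case=> [|[]]; lia.
- move=> [l ls] /=; apply/implyP; rewrite sz a1 a2 !N !addn1 => lK.
  have lp : l < size p by lia.
  have := implyP (H (Ordinal lp)); rewrite /= a1 => /(_ lK) big.
  case: (boolP (inside p (l + K).+2)) => t'; last by apply/orP; left; lia.
  have lp' : (l + K).+2 < size p by lia.
  have [_ [<-] [t1 o' E]] := to_jagged_second t' lp'.
  case: (boolP (inside p l)) => tl; first by apply/orP; left; lia.
  case: (boolP (odd (nth 0 p l))) => ol; last by apply/orP; left; lia.
  by have [_ -> ->] := to_jagged_first lp tl ol; rewrite E (negbTE t1); lia.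
Qed.

End ToJagged.

Lemma head_of_jagged b s : head 0 (of_jagged (b :: s)) <= b.*2.+1.
Proof.
by case: s => [|c s]; rewrite /= ?leqnSn //; case: eqP => /= _; rewrite ?leqnSn.
Qed.

Lemma jagged_le2 a b c s : jagged (a :: b :: c :: s) -> c <= a.
Proof. by case/and3P=> _ /forallP/(_ ord0). Qed.

Lemma jagged_le1 a b s : jagged (a :: b :: s) -> b <= a.+1.
Proof. by case/and3P=> /forallP/(_ ord0) /=; rewrite addn1. Qed.

Lemma of_jagged_partition s : jagged s ->
  is_partition (of_jagged s) /\ paired (of_jagged s).
Proof.
have consP x p : 0 < x -> head 0 p <= x -> is_partition p -> is_partition (x :: p).
  move=> x0 px /andP[so p1]; rewrite /is_partition /= x0 p1 andbT.
  by case: p px so {p1} => //= y p -> ->.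
elim/seq_ind2: s => [|a|a b s IH1 IH2] //.
  by case/and3P => _ _ /= a0; rewrite /is_partition /= odd_double andbT double_gt0 a0.
move=> js; have ab := jagged_head2 js; have ba := jagged_le1 js.
have js1 := jagged_behead js.
rewrite of_jagged_cons; case: eqP => bE.
  have [pP pp] : is_partition (of_jagged s) /\ paired (of_jagged s).
    by case: s {IH2} IH1 js js1 => // c s IH1 js js1; apply/IH1/(jagged_behead js1).
  split; last by rewrite paired_cons /= odd_double eqxx.
  apply: (consP) => //; apply: (consP) => //.
  case: s js js1 {IH1 IH2 pP pp} => // c s js js1.
  apply: leq_trans (head_of_jagged _ _) _.
  by have := jagged_le2 js; lia.
have [pP pp] := IH2 js1; rewrite paired_cons odd_double; split=> //.
apply: (consP) => //; first by lia.
case: s js js1 {IH1 IH2 pP pp} => [|c s] js js1; first by rewrite /=; lia.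
by rewrite of_jagged_cons; case: eqP => cE /=; have := jagged_le2 js; lia.
Qed.

Theorem Jlen_eq_E K i n m : 2 < K -> 0 < i -> Jlen K i n m = E K i (2 * n) m.
Proof.
move=> K2 i0; apply: has_card_uniq (num_seqsP _ _ _) _.
have key p : is_partition p -> paired p ->
   [&& jagged (to_jagged p), restricted K (to_jagged p) & pairs01 (to_jagged p) <= i - 1]
   = Epred K i p.
  move=> pP pp; rewrite jagged_to_jagged // restricted_to_jagged // /Epred pP /=.
  have [so p1] := andP pP; rewrite paired_allP // pp /=; congr (_ && _).
  by rewrite pairs01_to_jagged //; lia.
apply: (has_card_bij (f := to_jagged) (g := of_jagged)) (num_seqsP _ _ _) => [p|s].
  case/and3P => szp sp Ep; have pP : is_partition p by case/andP: Ep.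
  have [so _] := andP pP.
  have pp : paired p by rewrite -paired_allP //; case/and4P: Ep.
  rewrite to_jaggedK //; split=> //; rewrite size_to_jagged // szp key // Ep andbT /=.
  by have := sumn_to_jagged pp; lia.
case/and3P => szs ss Js; have [pP pp] := of_jagged_partition (proj1 (andP Js)).
rewrite of_jaggedK; split=> //.
rewrite -key // sumn_to_jagged // -size_to_jagged // of_jaggedK szs Js andbT /=.
by lia.
Qed.

Theorem J_eq_R K i n : 2 < K -> 0 < i -> 2 * i <= K + 1 ->
  J K i n = R K i (2 * n).
Proof.
move=> K2 i0 iK; rewrite -E_eq_R //; last by lia.
by apply: eq_bigr => m _; apply: Jlen_eq_E.
Qed.

(** * Overpartitions *)

Definition allowed (u o : pred nat) (x : nat * bool) : bool :=
  if x.2 then o x.1 else u x.1.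

Definition over_set (u o : pred nat) (r n : nat) (l : seq (nat * bool)) : bool :=
  [&& is_overpartition l, all (fun x => x.1 <= r) l, all (allowed u o) l
    & sumn (unzip1 l) == n].

Definition over_count u o r n : nat :=
  fin_card (over_set u o r n)
    (seqs_upto [seq (x, b) | x <- iota 0 n.+1, b <- [:: true; false]] n).

Lemma over_countP u o r n : has_card (over_set u o r n) (over_count u o r n).
Proof.
apply: fin_cardP => l /and4P[/andP[lP _] _ _ /eqP <-].
apply: mem_seqs_upto; first by rewrite -(size_map fst); apply: is_partition_size.
apply/allP => -[x b] xl; apply/allpairsP; exists (x, b).
have := mem_le_sumn (map_f fst xl); rewrite mem_iota /= add0n ltnS => ->.
by case: (b).
Qed.

Lemma is_overpartition_cons v b l : is_overpartition ((v, b) :: l) =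
  [&& 0 < v, all (fun y => y.1 <= v) l, b ==> all (fun y => y.1 != v) l
    & is_overpartition l].
Proof.
rewrite /is_overpartition /is_partition /= path_sortedE; last exact: geq_trans.
rewrite all_map -!andbA; case: (0 < v); rewrite ?andbF //=.
have -> : all (preim fst (geq v)) l = all (fun y => y.1 <= v) l by apply: eq_all.
case: b => /=; last first.
  have -> : all (fun=> true) l by apply/allP.
  by rewrite !andTb.
by case: (all _ l) => //=; case: (sorted _ _); rewrite /= ?andbF //; case: (all _ (unzip1 l)); rewrite /= ?andbF.
Qed.

(** An overlined part is the last of its value, so after an overlined [r.+1] the bound drops to
    [r]. *)
Lemma over_set_cons u o r n b l :
  over_set u o r.+1 n ((r.+1, b) :: l) =
  [&& r.+1 <= n, allowed u o (r.+1, b)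
    & over_set u o (if b then r else r.+1) (n - r.+1) l].
Proof.
rewrite /over_set is_overpartition_cons /= leqnn /=.
have -> : (r.+1 + sumn (unzip1 l) == n) = (r.+1 <= n) && (sumn (unzip1 l) == n - r.+1) by lia.
case: (r.+1 <= n); rewrite /= ?andbF //; case: (allowed u o _); rewrite /= ?andbF //.
case: b => /=; last by case: (all _ l); rewrite /= ?andbF.
have -> : all (fun x => x.1 <= r) l = all (fun x => x.1 <= r.+1) l && all (fun x => x.1 != r.+1) l.
  by rewrite -all_predI; apply: eq_all => x /=; lia.
by case: (all (fun x => x.1 <= r.+1) l); case: (all _ l); rewrite /= ?andbF.
Qed.

Lemma over_count_rec u o r n : over_count u o r.+1 n =
  over_count u o r n
  + ((if (r < n) && o r.+1 then over_count u o r (n - r.+1) else 0)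
     + (if (r < n) && u r.+1 then over_count u o r.+1 (n - r.+1) else 0)).
Proof.
apply: has_card_uniq (over_countP _ _ _ _) _.
pose H b (l : seq (nat * bool)) := if l is x :: _ then x == (r.+1, b) else false.
have part b : has_card (fun l => over_set u o r.+1 n l && H b l)
   (if (r < n) && allowed u o (r.+1, b)
    then over_count u o (if b then r else r.+1) (n - r.+1) else 0).
  case: ifP => [rn|Nrn]; last first.
    apply: has_card0 => -[|x l] /=; first by rewrite andbF.
    by apply/negP => /andP[Pl /eqP xE]; move: Pl; rewrite xE over_set_cons andbA Nrn.
  apply: (has_card_image (f := cons (r.+1, b)) _ _ _ (over_countP _ _ _ _)).
  - by move=> l l' _ _ [].
  - by move=> l Pl; rewrite /= eqxx over_set_cons andbA rn Pl.
  - move=> [|x l]; rewrite ?andbF //= => /andP[Ql /eqP xE]; move: Ql.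
    by rewrite xE over_set_cons => /and3P[_ _ Pl]; exists l.
have disj l : over_set u o r.+1 n l && H true l -> ~~ (over_set u o r.+1 n l && H false l).
  case/andP => _; case: l => //= x l /eqP ->; rewrite negb_and; apply/orP; right.
  by apply/eqP.
have low l : over_set u o r n l ->
    ~~ (over_set u o r.+1 n l && H true l || over_set u o r.+1 n l && H false l).
  case: l => [|[v b] l] /and4P[_ vr _ _]; first by rewrite !andbF.
  move: vr => /= /andP[vr _]; rewrite -andb_orr negb_and negb_or.
  by apply/orP; right; apply/andP; split; apply/eqP => -[vE _]; lia.
apply: eq_has_card (has_cardU low (over_countP u o r n) (has_cardU disj (part true) (part false))) => l.
rewrite -andb_orr.
case: l => [|[v b] l] //=; first by rewrite andbF orbF.
apply/orP/idP => [[/and4P[op vr ok sm]|/andP[]//]|Pl].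
  rewrite /over_set op ok sm !andbT; apply: sub_all vr => x; exact: leqW.
have /and4P[op vr ok sm] := Pl; have /andP[/= v_le _] := vr.
move: v_le; rewrite leq_eqVlt => /orP[/eqP vE|v_lt].
  by right; rewrite Pl vE; case: (b); rewrite eqxx ?orbT.
left; rewrite /over_set op ok sm !andbT andTb.
move: op; rewrite is_overpartition_cons => /and4P[_ av _ _]; apply/andP; split; first exact: v_lt.
by apply: sub_all av => x xv; rewrite -ltnS; exact: leq_ltn_trans xv v_lt.
Qed.


Definition over_u (K kappa eps i : nat) (x : nat) : bool :=
  if (eps == 1) && (i == kappa) then x != 0 %[mod kappa]
  else ~~ [|| x == 0 %[mod K + 1], x == i %[mod K + 1] | x + i == 0 %[mod K + 1]].

Definition over_o (kappa eps i : nat) (x : nat) : bool :=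
  if (eps == 1) && (i == kappa) then x != 0 %[mod kappa] else true.

Lemma O_over K i kappa eps n r : 0 < i -> 0 < kappa -> eps \in [:: 0; 1] ->
  K = 2 * kappa - eps -> i <= kappa -> n <= r ->
  O K kappa eps i n
  = over_count (over_u K kappa eps i) (over_o kappa eps i) r n.
Proof.
move=> i0 k0 he hK ik nr; apply: has_card_uniq (over_countP _ _ _ _).
have key l : (sumn (unzip1 l) == n) && Opred K kappa eps i l
    = over_set (over_u K kappa eps i) (over_o kappa eps i) r n l.
  rewrite /Opred /over_set (Ocases i0 k0 he hK ik).
  case: (sumn (unzip1 l) =P n) => [sn|_]; last by rewrite !andbF.
  rewrite andbT /=; congr (_ && _).
  have -> : all (fun x => x.1 <= r) l.
    apply/allP => x xl; have : x.1 <= sumn (unzip1 l) := mem_le_sumn (map_f fst xl).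
    by rewrite sn => xn; apply: leq_trans nr.
  rewrite /= /allowed /over_u /over_o.
  case: ((eps == 1) && (i == kappa)); rewrite /= ?andbT.
    by apply: eq_all => -[x []].
  by apply: eq_all => -[x []].
apply: (eq_has_card key).
apply: (has_card_sum (st := size)) => [l|m _].
  rewrite key => /and4P[/andP[lP _] _ _ /eqP <-].
  by rewrite ltnS -(size_map fst); apply: is_partition_size.
apply: (eq_has_card (P := fun l => (size l == m) && ((sumn (unzip1 l) == n) && Opred K kappa eps i l))).
  by move=> l; rewrite /= andbC.
apply: (has_card_tuple (v := fun x : 'I_n.+1 * bool => (val x.1, x.2))
  (P := fun l => (sumn (unzip1 l) == n) && Opred K kappa eps i l)).
  by move=> [x b] [y c] [] /val_inj -> ->.
move=> l /andP[/eqP sn _] [y b] yl.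
have yn : y <= sumn (unzip1 l) := mem_le_sumn (map_f fst yl).
rewrite sn in yn.
by exists (inord y, b); rewrite /= inordK.
Qed.


Local Open Scope ring_scope.

(** * Solution of the recursion *)

Section QSeries.
Variables (A : comNzRingType) (q : A) (M : nat).
Hypothesis qM : q ^+ M = 0.

Lemma qbig n : (M <= n)%N -> q ^+ n = 0.
Proof. by move=> Mn; rewrite -(subnKC Mn) exprD qM mul0r. Qed.

(* q^z, only meaningful for z >= 0. *)
Definition qpow (z : int) : A := q ^+ `|z|%N.

Lemma qpowD x y : 0 <= x -> 0 <= y -> qpow (x + y) = qpow x * qpow y.
Proof. by move=> x0 y0; rewrite /qpow -exprD; congr (_ ^+ _); lia. Qed.

Lemma qpow_nat (n : nat) : qpow n%:Z = q ^+ n.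
Proof. by []. Qed.

Lemma qpow_big z : M%:Z <= z -> qpow z = 0.
Proof. by move=> Mz; apply: qbig; lia. Qed.

Definition geom (n : nat) : A := \sum_(l < M) q ^+ (n * l).

Lemma geomP n : (0 < n)%N -> (1 - q ^+ n) * geom n = 1.
Proof.
move=> n0; rewrite /geom (eq_bigr (fun l : 'I_M => (q ^+ n) ^+ l)) => [|l _]; last first.
  by rewrite exprM.
rewrite -opprB mulNr -subrX1 -exprM qbig ?sub0r ?opprK //; nia.
Qed.

(* ipoch n = 1/(q^2; q^2)_n, extended by 0 to negative indices;
   npoch n = (-q^2; q^2)_n. *)
Definition ipoch (z : int) : A :=
  if z is Posz n then \prod_(r < n) geom (2 * r.+1) else 0.

Definition npoch (n : nat) : A := \prod_(r < n) (1 + q ^+ (2 * r.+1)).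

Lemma ipoch_neg z : z < 0 -> ipoch z = 0.
Proof. by case: z. Qed.

Lemma ipoch_step z : 0 <= z -> ipoch (z - 1) = (1 - qpow (2 * z)) * ipoch z.
Proof.
case: z => // -[|n] _; first by rewrite /qpow /= expr0 subrr mul0r.
have -> : Posz n.+1 - 1 = n by lia.
rewrite /= big_ord_recr /= mulrCA (_ : 2 * Posz n.+1 = (2 * n.+1)%N) //.
by rewrite qpow_nat geomP ?mulr1.
Qed.

Lemma npochS n : npoch n.+1 = npoch n * (1 + qpow (2 * n.+1%:Z)).
Proof. by rewrite /npoch big_ord_recr /= (_ : 2 * Posz n.+1 = (2 * n.+1)%N). Qed.

Definition zsum (D : nat) (F : int -> A) : A :=
  \sum_(k < D.*2.+1) F (k%:Z - D%:Z).

Lemma eq_zsum D F G : (forall j, - D%:Z <= j <= D%:Z -> F j = G j) ->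
  zsum D F = zsum D G.
Proof. by move=> E; apply: eq_bigr => k _; apply: E; have := ltn_ord k; lia. Qed.

Lemma zsumD D F G : zsum D (fun j => F j + G j) = zsum D F + zsum D G.
Proof. exact: big_split. Qed.

Lemma zsumB D F G : zsum D (fun j => F j - G j) = zsum D F - zsum D G.
Proof. by rewrite /zsum -sumrB. Qed.

Lemma zsumZ D c F : zsum D (fun j => c * F j) = c * zsum D F.
Proof. by rewrite /zsum mulr_sumr. Qed.

Lemma zsum_opp D F : zsum D (fun j => F (- j)) = zsum D F.
Proof.
rewrite /zsum (reindex_inj rev_ord_inj) /=; apply: eq_bigr => k _; congr F.
by have := ltn_ord k; lia.
Qed.

(** j -> -1 - j is an involution without fixed points on [-D, D - 1]; only j = D has no partner. *)
Lemma zsum_antisym D F : (forall j, F (-1 - j) = - F j) -> F D%:Z = 0 ->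
  zsum D F = 0.
Proof.
move=> Fa FD; rewrite /zsum -addnn big_ord_recr /= (_ : (D + D)%N%:Z - D%:Z = D%:Z) ?FD ?addr0; last by lia.
rewrite big_split_ord /= [X in _ + X](reindex_inj rev_ord_inj) -big_split big1 //= => k _.
have -> : (D + (D - k.+1))%N%:Z - D%:Z = -1 - (k%:Z - D%:Z) by have := ltn_ord k; lia.
by rewrite Fa addrN.
Qed.

Definition sg (j : int) : A := (-1) ^+ `|j|%N.

Lemma sgN j : sg (- j) = sg j.
Proof. by rewrite /sg abszN. Qed.

Lemma sg_refl j : sg (-1 - j) = - sg j.
Proof.
rewrite /sg; have [->|->] : `|(-1 - j : int)|%N = `|j|%N.+1 \/ `|j|%N = `|(-1 - j : int)|%N.+1 by lia.
  by rewrite exprS mulN1r.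
by rewrite exprS mulN1r opprK.
Qed.

Variable K : nat.

(** A parity correction, 0 at a = K + 1 - 2i, chosen so that exponents at neighbouring a differ by
    exactly j: [xB (a - 1) = xA a - j] and [xB (a + 1) = xA a + j], and likewise with A and B
    exchanged. *)
Definition eps (a : int) : int := if (2 %| (a + K%:Z + 1))%Z then 0 else 1.

Lemma epsS a : eps (a + 1) = 1 - eps a.
Proof. by rewrite /eps; case: ifP; case: ifP; lia. Qed.

Lemma epsB a : eps (a - 1) = 1 - eps a.
Proof. by rewrite /eps; case: ifP; case: ifP; lia. Qed.

Lemma eps01 a : 0 <= eps a <= 1.
Proof. by rewrite /eps; case: ifP. Qed.

Definition coefA (d : nat) (j : int) : A :=
  npoch d.-1 * ipoch (d%:Z - j) * ipoch (d%:Z + j).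
Definition coefB (d : nat) (j : int) : A :=
  npoch d * ipoch (d%:Z - j) * ipoch (d%:Z + j).

Lemma coefA_big d j : ~~ (- d%:Z <= j <= d%:Z) -> coefA d j = 0.
Proof.
rewrite negb_and -!ltNge /coefA => /orP[lt|lt].
  by rewrite [ipoch (d%:Z + j)]ipoch_neg ?mulr0 //; lia.
by rewrite ipoch_neg ?mulr0 ?mul0r //; lia.
Qed.

Lemma coefB_wA d j : (0 < d)%N -> coefB d j = coefA d j * (1 + qpow (2 * d%:Z)).
Proof. by case: d => // d _; rewrite /coefB /coefA npochS; ring. Qed.

Lemma coefB_pred d j : (0 < d)%N -> - d%:Z <= j <= d%:Z ->
  coefB d.-1 j = coefA d j * (1 - qpow (2 * (d%:Z - j))) * (1 - qpow (2 * (d%:Z + j))).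
Proof.
move=> d0 jd; rewrite /coefB /coefA.
have -> : d.-1%:Z - j = d%:Z - j - 1 by lia.
have -> : d.-1%:Z + j = d%:Z + j - 1 by lia.
by rewrite !ipoch_step; [ring | lia | lia].
Qed.

Definition xA (a : int) (d : nat) (j : int) : int :=
  j * a + K%:Z * j ^+ 2 + eps a * j + (d ^ 2)%N%:Z.
Definition xB (a : int) (d : nat) (j : int) : int :=
  j * a + K%:Z * j ^+ 2 + (1 - eps a) * j + (d ^ 2)%N%:Z.

Definition Aterm a d j : A :=
  sg j * (coefA d j * (qpow (xA a d j + d%:Z + j) + qpow (xA a d j + d%:Z - j))).
Definition Bterm a d j : A := sg j * (coefB d j * qpow (xB a d j)).

(** |j c| is at most (K + 1) j^2, and j^2 at most d^2. Nonnegativity is what [qpowD] asks for. *)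
Lemma expo_ge0 (c j : int) (d : nat) : - d%:Z <= j <= d%:Z ->
  `|c| <= K%:Z + 1 -> 0 <= j * c + K%:Z * j ^+ 2 + (d ^ 2)%N%:Z.
Proof.
move=> jd cK; have : j * c + (K%:Z + 1) * j ^+ 2 >= 0.
  rewrite expr2; have := ler_norm (- (j * c)); rewrite normrN normrM => H.
  have : `|j| * `|c| <= `|j| * (K%:Z + 1) by apply: ler_wpM2l.
  have : `|j| * (K%:Z + 1) <= j * j * (K%:Z + 1).
    by apply: ler_wpM2r => //; nia.
  by lia.
have : j ^+ 2 <= (d ^ 2)%N%:Z by rewrite expr2 expnS expn1 PoszM; nia.
by lia.
Qed.

(** The interior equations hold for each j separately; only the boundary equations need the sum over
    j. *)
Lemma mode1 a d j : 0 <= a <= K%:Z - 1 -> (0 < d)%N ->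
  Aterm a d j * (1 + qpow (2 * d%:Z))
  = qpow d%:Z * (Bterm (a - 1) d j + Bterm (a + 1) d j).
Proof.
move=> aK d0; rewrite /Aterm /Bterm !(coefB_wA _ d0).
case: (boolP (- d%:Z <= j <= d%:Z)) => [jd|/coefA_big ->]; last by ring.
have xm : xB (a - 1) d j = xA a d j - j by rewrite /xA /xB epsB; ring.
have xp : xB (a + 1) d j = xA a d j + j by rewrite /xA /xB epsS; ring.
have bm : 0 <= xA a d j - j.
  have := @expo_ge0 (a + eps a - 1) j d jd; rewrite /xA; have := eps01 a.
  by move: (eps a) => e; lia.
have bp : 0 <= xA a d j + j.
  have := @expo_ge0 (a + eps a + 1) j d jd.
  have : a + eps a <= K%:Z by rewrite /eps; case: ifP; lia.
  by rewrite /xA; have := eps01 a; move: (eps a) => e; lia.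
rewrite xm xp (_ : xA a d j + d%:Z + j = d%:Z + (xA a d j + j)); last by ring.
rewrite (_ : xA a d j + d%:Z - j = d%:Z + (xA a d j - j)); last by ring.
by rewrite ![qpow (d%:Z + _)]qpowD //; ring.
Qed.

(** Let P, u, v be the powers with exponents 2d, 2(d - j), 2(d + j). Then P^2 = u v, and the claim
    becomes (1 + P)^2 = (P + u + v + P) + (1 - u)(1 - v), the last product being the term with d -
    1. *)
Lemma mode2 a d j : 0 <= a <= K%:Z - 1 -> (0 < d)%N ->
  Bterm a d j * (1 + qpow (2 * d%:Z))
  = qpow d%:Z * (Aterm (a - 1) d j + Aterm (a + 1) d j)
    + qpow (2 * d%:Z - 1) * Bterm a d.-1 j.
Proof.
move=> aK d0; rewrite /Aterm /Bterm !(coefB_wA _ d0).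
case: (boolP (- d%:Z <= j <= d%:Z)) => [jd|Njd]; last first.
  rewrite coefA_big // (_ : coefB d.-1 j = 0); first by ring.
  move: Njd; rewrite negb_and -!ltNge /coefB => /orP[lt|lt].
    by rewrite [ipoch (d.-1%:Z + j)]ipoch_neg ?mulr0 //; lia.
  by rewrite ipoch_neg ?mulr0 ?mul0r //; lia.
set y := xB a d j.
have xm : xA (a - 1) d j = y - j by rewrite /y /xA /xB epsB; ring.
have xp : xA (a + 1) d j = y + j by rewrite /y /xA /xB epsS; ring.
have bm : 0 <= y - j.
  have := @expo_ge0 (a + (1 - eps a) - 1) j d jd; rewrite /y /xB; have := eps01 a.
  by move: (eps a) => e; lia.
have bp : 0 <= y + j.
  have := @expo_ge0 (a + (1 - eps a) + 1) j d jd; rewrite /y /xB; have := eps01 a.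
  by move: (eps a) => e; lia.
have y0 : 0 <= y by lia.
have u0 : 0 <= 2 * (d%:Z - j) by lia.
have v0 : 0 <= 2 * (d%:Z + j) by lia.
have uv : qpow (2 * d%:Z) * qpow (2 * d%:Z) = qpow (2 * (d%:Z - j)) * qpow (2 * (d%:Z + j)).
  by rewrite -!qpowD; try lia; congr qpow; ring.
have e1 : qpow d%:Z * qpow (y - j + d%:Z + j) = qpow y * qpow (2 * d%:Z).
  by rewrite -!qpowD; try lia; congr qpow; ring.
have e2 : qpow d%:Z * qpow (y - j + d%:Z - j) = qpow y * qpow (2 * (d%:Z - j)).
  by rewrite -!qpowD; try lia; congr qpow; ring.
have e3 : qpow d%:Z * qpow (y + j + d%:Z + j) = qpow y * qpow (2 * (d%:Z + j)).
  by rewrite -!qpowD; try lia; congr qpow; ring.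
have e4 : qpow d%:Z * qpow (y + j + d%:Z - j) = qpow y * qpow (2 * d%:Z).
  by rewrite -!qpowD; try lia; congr qpow; ring.
have e5 : coefB d.-1 j * (qpow (2 * d%:Z - 1) * qpow (xB a d.-1 j)) = coefB d.-1 j * qpow y.
  case: (boolP (- d.-1%:Z <= j <= d.-1%:Z)) => jd'; last first.
    have -> : coefB d.-1 j = 0; last by rewrite !mul0r.
    rewrite coefB_pred // ; have [-> | ->] : j = d%:Z \/ j = - d%:Z by lia.
      by rewrite subrr /qpow expr0; ring.
    by rewrite subrr /qpow expr0; ring.
  have E : xB a d.-1 j = y - (2 * d%:Z - 1).
    by rewrite /y /xB; case: (d) d0 => // d' _; rewrite /= !expnS !expn0; lia.
  congr (_ * _); rewrite -qpowD; [congr qpow; rewrite E; ring | lia |].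
  by have := @expo_ge0 (a + (1 - eps a)) j d.-1 jd'; rewrite /xB; have := eps01 a; move: (eps a) => e; lia.
rewrite xm xp [RHS](_ : _ = sg j * coefA d j * (qpow d%:Z * qpow (y - j + d%:Z + j)
  + qpow d%:Z * qpow (y - j + d%:Z - j) + qpow d%:Z * qpow (y + j + d%:Z + j)
  + qpow d%:Z * qpow (y + j + d%:Z - j))
  + sg j * (coefB d.-1 j * (qpow (2 * d%:Z - 1) * qpow (xB a d.-1 j)))); last by ring.
rewrite e1 e2 e3 e4 e5 coefB_pred //; move: uv.
move: (qpow (2 * d%:Z)) (qpow (2 * (d%:Z - j))) (qpow (2 * (d%:Z + j))) => P u v uv.
have -> : sg j * (coefA d j * (1 + P) * qpow y) * (1 + P)
   = sg j * coefA d j * qpow y * (1 + P + P + P * P) by ring.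
by rewrite uv; ring.
Qed.

(* Closed forms of the generating functions of Frobenius symbols with d       *)
(* columns, all of odd rank (Ahat, for d > 0) or all of even rank (Bhat).     *)
Variable D : nat.
Definition Ahat (a : int) (d : nat) : A := zsum D (Aterm a d).
Definition Bhat (a : int) (d : nat) : A := zsum D (Bterm a d).

Lemma coefA_opp d j : coefA d (- j) = coefA d j.
Proof. by rewrite /coefA opprK; ring. Qed.
Lemma coefB_opp d j : coefB d (- j) = coefB d j.
Proof. by rewrite /coefB opprK; ring. Qed.

Lemma Ahat_sym d : Ahat (-1) d = Ahat 0 d.
Proof.
rewrite /Ahat -zsum_opp; apply: eq_zsum => j _.
rewrite /Aterm sgN coefA_opp; congr (_ * (_ * _)).
have -> : xA (-1) d (- j) = xA 0 d j.
  by rewrite /xA (_ : (-1 : int) = 0 - 1) // epsB; ring.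
by rewrite opprK addrC.
Qed.

Lemma Bhat_sym d : Bhat (-1) d = Bhat 0 d.
Proof.
rewrite /Bhat -zsum_opp; apply: eq_zsum => j _.
rewrite /Bterm sgN coefB_opp; congr (_ * (_ * qpow _)).
by rewrite /xB (_ : (-1 : int) = 0 - 1) // epsB; ring.
Qed.

Lemma Ahat_rec a d : 0 <= a <= K%:Z - 1 -> (0 < d)%N ->
  Ahat a d * (1 + qpow (2 * d%:Z)) = qpow d%:Z * (Bhat (a - 1) d + Bhat (a + 1) d).
Proof.
move=> aK d0; rewrite /Ahat /Bhat mulrC -!zsumD -!zsumZ.
by apply: eq_zsum => j _; rewrite mulrC mode1.
Qed.

Lemma Bhat_rec a d : 0 <= a <= K%:Z - 1 -> (0 < d)%N ->
  Bhat a d * (1 + qpow (2 * d%:Z)) = qpow d%:Z * (Ahat (a - 1) d + Ahat (a + 1) d)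
    + qpow (2 * d%:Z - 1) * Bhat a d.-1.
Proof.
move=> aK d0; rewrite /Ahat /Bhat mulrC -!zsumD -!zsumZ -zsumD.
by apply: eq_zsum => j _; rewrite mulrC mode2.
Qed.

(** The terms by which the boundary equations fail mode by mode. Under j -> -1 - j the two [ipoch]
    factors are exchanged and the sign changes, so the sum vanishes when [g] is symmetric. *)
Definition wall (g : int -> int) (d : nat) (j : int) : A :=
  sg j * (npoch d.-1 * ipoch (d%:Z - 1 - j) * ipoch (d%:Z + j) * qpow (g j)).

Lemma wall0 g d : (d < D)%N -> (forall j, g (-1 - j) = g j) ->
  zsum D (wall g d) = 0.
Proof.
move=> dD gs; apply: zsum_antisym => [j|].
  rewrite /wall sg_refl gs (_ : d%:Z - 1 - (-1 - j) = d%:Z + j); last by ring.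
  by rewrite (_ : d%:Z + (-1 - j) = d%:Z - 1 - j); ring.
by rewrite /wall (@ipoch_neg (d%:Z - 1 - D%:Z)); [ring | lia].
Qed.

Lemma wall_wA d j : (0 < d)%N -> - d%:Z <= j <= d%:Z ->
  npoch d.-1 * ipoch (d%:Z - 1 - j) * ipoch (d%:Z + j) = coefA d j * (1 - qpow (2 * (d%:Z - j))).
Proof.
move=> d0 jd; rewrite /coefA (_ : d%:Z - 1 - j = d%:Z - j - 1); last by ring.
by rewrite ipoch_step; [ring | lia].
Qed.

Lemma wall_big d j : ~~ (- d%:Z <= j <= d%:Z) ->
  npoch d.-1 * ipoch (d%:Z - 1 - j) * ipoch (d%:Z + j) = 0.
Proof.
rewrite negb_and -!ltNge => /orP[lt|lt].
  by rewrite [ipoch (d%:Z + j)]ipoch_neg ?mulr0 //; lia.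
by rewrite ipoch_neg ?mulr0 ?mul0r //; lia.
Qed.

Lemma epsK1 : eps (K%:Z - 1) = 0.
Proof. by rewrite /eps ifT //; lia. Qed.

Lemma epsK : eps K%:Z = 1.
Proof. by rewrite /eps ifF //; lia. Qed.

Lemma jj1_ge0 (j : int) : 0 <= j * (j + 1).
Proof. by have [?|?] := lerP 0 j; nia. Qed.

(** The value at a = K, just outside the strip, that turns the interior equation at K - 1 into
    [strip_Ftop]. Mode by mode the difference is (1 + P) - (P + u) = 1 - u, the factor of a [wall]
    term. *)
Lemma Bhat_wall d : (0 < d < D)%N ->
  Bhat K%:Z d = qpow d%:Z * Ahat (K%:Z - 1) d.
Proof.
move=> /andP[d0 dD]; apply/eqP; rewrite -subr_eq0; apply/eqP.
pose g (j : int) := K%:Z * (j * (j + 1)) + (d ^ 2)%N%:Z.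
rewrite -(@wall0 g d dD) => [|j]; last by rewrite /g; ring.
rewrite /Bhat /Ahat -zsumZ -zsumB; apply: eq_zsum => j _.
rewrite /wall /Bterm /Aterm coefB_wA //.
case: (boolP (- d%:Z <= j <= d%:Z)) => [jd|Njd]; last first.
  by rewrite wall_big // coefA_big //; ring.
rewrite wall_wA //; have gB : xB K%:Z d j = g j by rewrite /xB /g epsK; ring.
have gA : xA (K%:Z - 1) d j = g j - j by rewrite /xA /g epsK1; ring.
have g0 : 0 <= g j by rewrite /g; have := jj1_ge0 j; nia.
have gm : 0 <= g j - j.
  by rewrite -gA; have := @expo_ge0 (K%:Z - 1) j d jd; rewrite /xA epsK1; lia.
have e1 : qpow d%:Z * qpow (g j - j + d%:Z + j) = qpow (g j) * qpow (2 * d%:Z).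
  by rewrite -!qpowD; try lia; congr qpow; ring.
have e2 : qpow d%:Z * qpow (g j - j + d%:Z - j) = qpow (g j) * qpow (2 * (d%:Z - j)).
  by rewrite -!qpowD; try lia; congr qpow; ring.
rewrite gB gA.
rewrite [X in _ - X](_ : _ = sg j * coefA d j * (qpow d%:Z * qpow (g j - j + d%:Z + j)
   + qpow d%:Z * qpow (g j - j + d%:Z - j))); last by ring.
by rewrite e1 e2; ring.
Qed.

(** The counterpart for [strip_Gtop]: (v + P) - (1 + P) P + (1 - u)(1 - v) = 1 - u, because P^2 = u
    v. *)
Lemma Ahat_wall d : (0 < d < D)%N ->
  Ahat K%:Z d = qpow d%:Z * Bhat (K%:Z - 1) d - qpow (d%:Z - 1) * Bhat (K%:Z - 1) d.-1.
Proof.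
move=> /andP[d0 dD]; apply/eqP; rewrite -subr_eq0 opprB addrA; apply/eqP.
pose g (j : int) := K%:Z * (j * (j + 1)) + (d ^ 2)%N%:Z - d%:Z.
rewrite -(@wall0 g d dD) => [|j]; last by rewrite /g; ring.
rewrite /Bhat /Ahat -!zsumZ -zsumD -zsumB; apply: eq_zsum => j _.
rewrite /wall /Bterm /Aterm !(coefB_wA _ d0).
case: (boolP (- d%:Z <= j <= d%:Z)) => [jd|Njd]; last first.
  rewrite wall_big // coefA_big // (_ : coefB d.-1 j = 0); first by ring.
  move: Njd; rewrite negb_and -!ltNge /coefB => /orP[lt|lt].
    by rewrite [ipoch (d.-1%:Z + j)]ipoch_neg ?mulr0 //; lia.
  by rewrite ipoch_neg ?mulr0 ?mul0r //; lia.
rewrite wall_wA // coefB_pred //.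
have g0 : 0 <= g j by rewrite /g; have := jj1_ge0 j; rewrite expnS expn1; nia.
have gA : xA K%:Z d j = g j + d%:Z + j by rewrite /xA /g epsK; ring.
have gB : xB (K%:Z - 1) d j = g j + d%:Z by rewrite /xB /g epsK1; ring.
have gB1 : xB (K%:Z - 1) d.-1 j = g j - (d%:Z - 1).
  by rewrite /xB /g epsK1; case: (d) d0 => // d' _; rewrite /= !expnS !expn0; lia.
have g1 : 0 <= g j - (d%:Z - 1).
  by rewrite -gB1 /xB epsK1; have := jj1_ge0 j; nia.
rewrite gA gB gB1.
have e1 : qpow (g j + d%:Z + j + d%:Z + j) = qpow (g j) * qpow (2 * (d%:Z + j)).
  by rewrite -!qpowD; try lia; congr qpow; ring.
have e2 : qpow (g j + d%:Z + j + d%:Z - j) = qpow (g j) * qpow (2 * d%:Z).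
  by rewrite -!qpowD; try lia; congr qpow; ring.
have e3 : qpow d%:Z * qpow (g j + d%:Z) = qpow (g j) * qpow (2 * d%:Z).
  by rewrite -!qpowD; try lia; congr qpow; ring.
have e4 : qpow (d%:Z - 1) * qpow (g j - (d%:Z - 1)) = qpow (g j).
  by rewrite -!qpowD; try lia; congr qpow; ring.
have uv : qpow (2 * d%:Z) * qpow (2 * d%:Z) = qpow (2 * (d%:Z - j)) * qpow (2 * (d%:Z + j)).
  by rewrite -!qpowD; try lia; congr qpow; ring.
move: e3 e4 uv; rewrite e1 e2.
move: (qpow (2 * d%:Z)) (qpow (2 * (d%:Z - j))) (qpow (2 * (d%:Z + j))) => P u v.
move: (qpow (d%:Z - 1)) (qpow (g j - (d%:Z - 1))) => m h.
move: (qpow (g j + d%:Z)) => l e3 e4 uv.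
have -> : m * (sg j * (coefA d j * (1 - u) * (1 - v) * h))
  = sg j * coefA d j * (1 - u) * (1 - v) * (m * h) by ring.
have -> : qpow d%:Z * (sg j * (coefA d j * (1 + P) * l))
  = sg j * coefA d j * (1 + P) * (qpow d%:Z * l) by ring.
rewrite e3 e4.
have -> : sg j * coefA d j * (1 + P) * (qpow (g j) * P)
  = sg j * coefA d j * qpow (g j) * (P + P * P) by ring.
by rewrite uv; ring.
Qed.

End QSeries.

(** * Uniqueness of the solution, and generating functions of the counts *)

Section Uniq.
Variables (A : comNzRingType) (q : A) (M : nat).
Hypothesis qM : q ^+ M = 0.

Definition qdiv (k : nat) (x : A) : Prop := exists c, x = q ^+ k * c.

Lemma qdivD k x y : qdiv k x -> qdiv k y -> qdiv k (x + y).
Proof. by move=> [c ->] [c' ->]; exists (c + c'); rewrite mulrDr. Qed.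
Lemma qdivN k x : qdiv k x -> qdiv k (- x).
Proof. by move=> [c ->]; exists (- c); rewrite mulrN. Qed.
Lemma qdivS k d x : (0 < d)%N -> qdiv k x -> qdiv k.+1 (q ^+ d * x).
Proof.
case: d => // d _ [c ->]; exists (q ^+ d * c); rewrite !exprS; ring.
Qed.

(* Satisfied by the generating functions of Frobenius symbols with d columns, *)
(* all (F) or none (G) of them of odd rank. By conjugation the index -1 has   *)
(* the same values as 0, in agreement with 0.-1 = 0.                          *)
Record strip_rec (K : nat) (F G : nat -> nat -> A) : Prop := StripRec {
  strip_F : forall a d, (0 < d)%N -> (a.+1 < K)%N ->
    F a d = q ^+ d * (G a.-1 d + G a.+1 d) - q ^+ (2 * d) * F a d;
  strip_G : forall a d, (0 < d)%N -> (a.+1 < K)%N ->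
    G a d = q ^+ d * (F a.-1 d + F a.+1 d) - q ^+ (2 * d) * G a d
            + q ^+ (2 * d).-1 * G a d.-1;
  strip_Ftop : forall a d, (0 < d)%N -> a.+1 = K -> F a d = q ^+ d * G a.-1 d;
  strip_Gtop : forall a d, (0 < d)%N -> a.+1 = K -> G a d = q ^+ d * F a.-1 d;
  strip_G0 : forall a, (a < K)%N -> G a 0%N = 1 }.

(** By induction on d, the terms with d - 1 cancel in the difference of two solutions. What remains
    has a factor q^d or q^(2d) on the right, so the difference is divisible by every power of q, in
    particular by q^M = 0. *)
Lemma strip_rec_uniq K F G F' G' : strip_rec K F G -> strip_rec K F' G' ->
  forall d a, (0 < d)%N -> (a < K)%N -> F a d = F' a d.
Proof.
move=> H H'.
suff W d : (forall a, (a < K)%N -> G a d = G' a d) /\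
    ((0 < d)%N -> forall a, (a < K)%N -> F a d = F' a d).
  by move=> d a d0 aK; apply: (W d).2.
elim: d => [|d [IH _]].
  by split=> // a aK; rewrite (strip_G0 H) ?(strip_G0 H').
have key k a : (a < K)%N ->
    qdiv k (F a d.+1 - F' a d.+1) /\ qdiv k (G a d.+1 - G' a d.+1).
  elim: k a => [|k IHk] a aK.
    by split; eexists; rewrite expr0 mul1r.
  have [/IHk[f1 g1]] : (a.-1 < K)%N by lia.
  have [f0 g0] := IHk a aK.
  case: (ltnP a.+1 K) => aK'; last first.
    have aK1 : a.+1 = K by lia.
    rewrite (strip_Ftop H _ aK1) // (strip_Ftop H' _ aK1) // (strip_Gtop H _ aK1) // (strip_Gtop H' _ aK1) //.
    by rewrite -!mulrBr; split; apply: qdivS.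
  have [f2 g2] := IHk _ aK'.
  rewrite (strip_F H _ aK') // (strip_F H' _ aK') // (strip_G H _ aK') // (strip_G H' _ aK') // IH //.
  have -> : q ^+ d.+1 * (G a.-1 d.+1 + G a.+1 d.+1) - q ^+ (2 * d.+1) * F a d.+1
     - (q ^+ d.+1 * (G' a.-1 d.+1 + G' a.+1 d.+1) - q ^+ (2 * d.+1) * F' a d.+1)
   = q ^+ d.+1 * (G a.-1 d.+1 - G' a.-1 d.+1 + (G a.+1 d.+1 - G' a.+1 d.+1))
     - q ^+ (2 * d.+1) * (F a d.+1 - F' a d.+1) by ring.
  have -> : q ^+ d.+1 * (F a.-1 d.+1 + F a.+1 d.+1) - q ^+ (2 * d.+1) * G a d.+1
     + q ^+ (2 * d.+1).-1 * G' a d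
     - (q ^+ d.+1 * (F' a.-1 d.+1 + F' a.+1 d.+1) - q ^+ (2 * d.+1) * G' a d.+1
        + q ^+ (2 * d.+1).-1 * G' a d)
   = q ^+ d.+1 * (F a.-1 d.+1 - F' a.-1 d.+1 + (F a.+1 d.+1 - F' a.+1 d.+1))
     - q ^+ (2 * d.+1) * (G a d.+1 - G' a d.+1) by ring.
  by split; apply: qdivD; try apply: qdivN; apply: qdivS => //; apply: qdivD.
split=> [|_] a aK; apply/eqP; rewrite -subr_eq0.
  by have [_ [c ->]] := key M a aK; rewrite qM mul0r.
by have [[c ->] _] := key M a aK; rewrite qM mul0r.
Qed.

Lemma zsum_single D (F : int -> A) : (forall j, j != 0 -> F j = 0) -> zsum D F = F 0.
Proof.
move=> F0; have lt : (D < D.*2.+1)%N by lia.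
rewrite /zsum (bigD1 (Ordinal lt)) //= subrr big1 ?addr0 // => k /eqP kD.
apply: F0; apply/eqP => E; apply: kD; apply: val_inj => /=; lia.
Qed.

Lemma strip_hat K D : (0 < M <= D)%N ->
  strip_rec K (fun a d => if (d < D)%N then Ahat q M K D a%:Z d else 0)
              (fun a d => if (d < D)%N then Bhat q M K D a%:Z d else 0).
Proof.
move=> /andP[M0 MD].
have predA a d : Ahat q M K D a.-1%:Z d = Ahat q M K D (a%:Z - 1) d.
  by case: a => [|a]; [rewrite sub0r Ahat_sym | congr Ahat; lia].
have predB a d : Bhat q M K D a.-1%:Z d = Bhat q M K D (a%:Z - 1) d.
  by case: a => [|a]; [rewrite sub0r Bhat_sym | congr Bhat; lia].
have S1 (a : nat) : a.+1%:Z = a%:Z + 1 by lia.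
have q2 d : qpow q (2 * d%:Z) = q ^+ (2 * d) by rewrite /qpow; congr (_ ^+ _); lia.
have q21 d : (0 < d)%N -> qpow q (2 * d%:Z - 1) = q ^+ (2 * d).-1.
  by move=> d0; rewrite /qpow; congr (_ ^+ _); lia.
have AE a d : (0 < d)%N -> (a < K)%N ->
    Ahat q M K D a%:Z d = q ^+ d * (Bhat q M K D a.-1%:Z d + Bhat q M K D a.+1%:Z d)
      - q ^+ (2 * d) * Ahat q M K D a%:Z d.
  move=> d0 aK; have aK' : 0 <= a%:Z <= K%:Z - 1 by lia.
  have := Ahat_rec q M D aK' d0; rewrite q2 qpow_nat -predB -S1 => <-; ring.
have BE a d : (0 < d)%N -> (a < K)%N ->
    Bhat q M K D a%:Z d = q ^+ d * (Ahat q M K D a.-1%:Z d + Ahat q M K D a.+1%:Z d)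
      - q ^+ (2 * d) * Bhat q M K D a%:Z d + q ^+ (2 * d).-1 * Bhat q M K D a%:Z d.-1.
  move=> d0 aK; have aK' : 0 <= a%:Z <= K%:Z - 1 by lia.
  have := Bhat_rec qM D aK' d0; rewrite q2 q21 // qpow_nat -predA -S1 => E.
  have -> : q ^+ d * (Ahat q M K D a.-1%:Z d + Ahat q M K D a.+1%:Z d)
     = Bhat q M K D a%:Z d * (1 + q ^+ (2 * d)) - q ^+ (2 * d).-1 * Bhat q M K D a%:Z d.-1.
    by rewrite E; ring.
  ring.
split=> [a d d0 aK|a d d0 aK|a d d0 aK|a d d0 aK|a aK].
- by case: ifP => dD; [apply: AE => //; apply: ltnW | ring].
- case: ifP => dD; first by rewrite ifT; [apply: BE => //; apply: ltnW | lia].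
  (* Beyond the cutoff d >= D the values are set to 0; the one equation that crosses it, at d = D,
     is safe because 2D - 1 >= M. *)
  have z1 : q ^+ (2 * d).-1 = 0 by apply: (qbig qM); lia.
  by rewrite z1; ring.
- case: ifP => dD; last by ring.
  have dD' : (0 < d < D)%N by rewrite d0.
  have W : Bhat q M K D a.+1%:Z d = q ^+ d * Ahat q M K D a%:Z d.
    have aE : a%:Z = K%:Z - 1 by lia.
    by have := Bhat_wall qM K dD'; rewrite qpow_nat -aE -aK.
  have aK' : (a < K)%N by rewrite -aK.
  by rewrite AE // W (_ : (2 * d = d + d)%N) ?exprD; [ring | lia].
- case: ifP => dD; last by ring.
  have dD' : (0 < d < D)%N by rewrite d0.
  have W : Ahat q M K D a.+1%:Z d
      = q ^+ d * Bhat q M K D a%:Z d - q ^+ d.-1 * Bhat q M K D a%:Z d.-1.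
    have aE : a%:Z = K%:Z - 1 by lia.
    have := Ahat_wall qM K dD'; rewrite qpow_nat -aE -aK => ->.
    by rewrite (_ : qpow q (d%:Z - 1) = q ^+ d.-1) // /qpow; congr (_ ^+ _); lia.
  have aK' : (a < K)%N by rewrite -aK.
  rewrite BE // W (_ : (2 * d = d + d)%N); last by lia.
  by rewrite (_ : (d + d).-1 = (d + d.-1)%N) ?exprD; [ring | lia].
- case: ifP => [_|]; last by lia.
  rewrite /Bhat zsum_single => [|j j0].
    rewrite /Bterm /coefB /sg /npoch /qpow /xB subr0 addr0 /= !big_ord0.
    rewrite (_ : 0 * a%:Z + K%:Z * 0 ^+ 2 + (1 - eps K a%:Z) * 0 = 0); last by ring.
    by rewrite !expr0 !mulr1.
  rewrite /Bterm /coefB; have [lt|ge] := ltrP j 0.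
    by rewrite [ipoch q M (0%:Z + j)]ipoch_neg ?add0r // !(mulr0, mul0r).
  by rewrite [ipoch q M (0%:Z - j)]ipoch_neg ?(mulr0, mul0r) //; lia.
Qed.

Definition gf (f : nat -> nat) : A := \sum_(n < M) (f n)%:R * q ^+ n.

Lemma eq_gf f g : (forall n, f n = g n) -> gf f = gf g.
Proof. by move=> E; apply: eq_bigr => n _; rewrite E. Qed.

Lemma gfD f g : gf (fun n => f n + g n)%N = gf f + gf g.
Proof. by rewrite /gf -big_split; apply: eq_bigr => n _; rewrite natrD mulrDl. Qed.

Lemma gf0 f : (forall n, f n = 0%N) -> gf f = 0.
Proof. by move=> E; apply: big1 => n _; rewrite E mul0r. Qed.

Lemma gf_shift f g d : (forall n, (n < d)%N -> f n = 0%N) ->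
  (forall n, f (n + d)%N = g n) -> gf f = q ^+ d * gf g.
Proof.
move=> f0 fg; rewrite /gf.
have -> : \sum_(n < M) (f n)%:R * q ^+ n = \sum_(n < d + M) (f n)%:R * q ^+ n.
  rewrite addnC big_split_ord /= [X in _ + X]big1 ?addr0 // => n _.
  by rewrite (qbig qM) ?mulr0 // leq_addr.
rewrite big_split_ord /= big1 ?add0r => [|n _]; last by rewrite f0 ?mul0r.
rewrite mulr_sumr; apply: eq_bigr => n _; rewrite addnC fg exprD; ring.
Qed.

Lemma gf_delta (f : nat -> nat) : (0 < M)%N -> (forall n, f n = (n == 0)%N :> nat) -> gf f = 1.
Proof.
move=> M0 E; rewrite /gf (bigD1 (Ordinal M0)) //= E expr0 mulr1 big1 ?addr0 // => n n0.
by rewrite E (_ : (n == 0 :> nat)%N = false) ?mul0r //; apply: contraNF n0.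
Qed.

Section Counts.
Variables (K : nat) (c : nat -> bool -> nat -> nat -> nat -> nat).
Hypotheses (M0 : (0 < M)%N) (Hc : burge_rec K c).

Let cF T a d := gf (c a T d 0%N).
Let cG T a d := gf (c a T d d).

(** [T] is eliminated: the true part at a + 1 is the total minus the false part, and the latter is
    q^d times a total at a. This produces the term with q^(2d), and at d - 1 the term with q^(2d -
    1). *)
Lemma strip_count :
  strip_rec K (fun a d => cF true a d + cF false a d) (fun a d => cG true a d + cG false a d).
Proof.
have Flow a d : (0 < d)%N -> (a < K)%N ->
    cF false a d = q ^+ d * (cG true a.-1 d + cG false a.-1 d).
  move=> d0 aK; rewrite -gfD; apply: gf_shift => [n nd|n].
    by rewrite (burge_small Hc) ?nd.
  by rewrite (burge_down Hc _ aK d0 (add0n d)).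
have Glow a d : (0 < d)%N -> (a < K)%N ->
    cG false a d = q ^+ d * (cF true a.-1 d + cF false a.-1 d).
  move=> d0 aK; rewrite -gfD; apply: gf_shift => [n nd|n].
    by rewrite (burge_small Hc) ?nd.
  by rewrite (burge_down Hc _ aK d0 (addn0 d)).
have Fup a d : (0 < d)%N -> (a.+1 < K)%N -> cF true a d = q ^+ d * cG true a.+1 d.
  move=> d0 aK; apply: gf_shift => [n nd|n].
    by rewrite (burge_small Hc) ?nd // ltnW.
  (* With d - 1 pairs, o = d is impossible. *)
  rewrite (burge_up Hc _ aK d0 (add0n d)) [X in (_ + X)%N](burge_small Hc) ?addn0 //.
  by case: (d) d0 => // d' _; rewrite leqnn orbT.
have Gup a d : (0 < d)%N -> (a.+1 < K)%N ->
    cG true a d = q ^+ d * (cF true a.+1 d + cF false a.+1 d.-1).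
  move=> d0 aK; rewrite -gfD; apply: gf_shift => [n nd|n].
    by rewrite (burge_small Hc) ?nd // ltnW.
  by rewrite (burge_up Hc _ aK d0 (addn0 d)).
have Ftop a d : a.+1 = K -> cF true a d = 0.
  by move=> aK; apply: gf0 => n; rewrite (burge_top Hc).
have Gtop a d : a.+1 = K -> cG true a d = 0.
  by move=> aK; apply: gf0 => n; rewrite (burge_top Hc).
have F0 a : (a < K)%N -> cF false a 0%N = 1.
  by move=> aK; rewrite /cF; apply: (gf_delta M0) => // n; rewrite (burge_d0 Hc).
have G0 a : (a < K)%N -> cG true a 0%N + cG false a 0%N = 1.
  move=> aK; rewrite [cG true a 0%N]gf0 ?add0r; last by move=> n; rewrite (burge_d0 Hc).
  by rewrite /cG; apply: (gf_delta M0) => // n; rewrite (burge_d0 Hc).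
have Flow1 a d : (a.+1 < K)%N ->
    cF false a.+1 d = q ^+ d * (cG true a d + cG false a d).
  by move=> aK; case: d => [|d]; [rewrite F0 // G0 ?expr0 ?mulr1 // ltnW | rewrite Flow].
split=> //.
- move=> a d d0 aK; have aK' := ltnW aK.
  rewrite Fup // Flow // (Glow a.+1) //= (_ : (2 * d = d + d)%N) ?exprD; last by lia.
  by rewrite Fup // [in RHS]Flow //; ring.
- move=> a d d0 aK; have aK' := ltnW aK.
  rewrite {1}Gup // {1}Glow // Flow1 // (Flow a.+1) //=.
  have -> : (2 * d).-1 = (d + d.-1)%N by lia.
  by rewrite (_ : (2 * d = d + d)%N) ?exprD; [ring | lia].
- by move=> a d d0 aK; rewrite Ftop // add0r Flow // -aK.
- by move=> a d d0 aK; rewrite Gtop // add0r Glow // -aK.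
Qed.
End Counts.

End Uniq.

(** * Summation over the number of columns *)

Section SumOverD.
Variables (A : comNzRingType) (q : A) (M : nat).
Hypotheses (M0 : (0 < M)%N) (qM : q ^+ M = 0).

Local Notation qz := (qpow q).
Local Notation ip := (ipoch q M).
Local Notation np := (npoch q).
Local Notation wA := (coefA q M).

Lemma geom_big n : (M <= n)%N -> geom q M n = 1.
Proof.
move=> Mn; rewrite /geom (bigD1 (Ordinal M0)) //= muln0 expr0 big1 ?addr0 // => l l0.
apply: (qbig qM); suff : (0 < l)%N by nia.
by rewrite lt0n; apply: contra l0.
Qed.

Lemma ipoch_big n : (M <= n)%N -> ip n%:Z = ip M%:Z.
Proof.
move=> Mn; rewrite -(subnKC Mn) /= big_split_ord /= [X in _ * X]big1 ?mulr1 // => r _.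
by rewrite geom_big //; lia.
Qed.

Lemma npoch_big n : (M <= n)%N -> np n = np M.
Proof.
move=> Mn; rewrite -(subnKC Mn) /npoch big_split_ord /= [X in _ * X]big1 ?mulr1 // => r _.
by rewrite (qbig qM) ?addr0 //; lia.
Qed.

Lemma qpow0 : qz 0 = 1.
Proof. exact: expr0. Qed.

Lemma ipoch0 : ip 0 = 1.
Proof. exact: big_ord0. Qed.

(* (-q^2; q^2)_oo / (q^2; q^2)_oo *)
Definition Phi : A := np M * ip M%:Z.

(** What is left of [Aterm] once the sign and the power [theta_exp j], both free of d, are taken
    out. *)
Definition tau (d : nat) (j : int) : A :=
  wA d j * (qz ((d ^ 2 + d)%N%:Z - j ^+ 2 - j) + qz ((d ^ 2 + d)%N%:Z - j ^+ 2 + j)).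

(** The telescoping certificate: it turns the difference of [tau] in j into a difference in d. *)
Definition Psi (j d : nat) : A :=
  (1 - qz (2 * (2 * j%:Z + 1))) * qz (d%:Z * (d%:Z + 1) - (j%:Z + 1) * (j%:Z + 2))
  * np d.-1 * ip (d%:Z - j%:Z - 1) * ip (d%:Z + j%:Z).

Lemma tau_step j d : (j < d)%N -> tau d j%:Z - tau d j.+1%:Z = Psi j d.+1 - Psi j d.
Proof.
move=> jd; rewrite /tau /Psi /coefA.
have S1 (a : nat) : a.+1%:Z = a%:Z + 1 by lia.
set g := d%:Z * (d%:Z + 1) - (j%:Z + 1) * (j%:Z + 2).
have g0 : 0 <= g by rewrite /g; nia.
have d2 : (d ^ 2 + d)%N%:Z = d%:Z * (d%:Z + 1) by rewrite expnS expn1; lia.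
rewrite d2 !S1.
rewrite (_ : d%:Z * (d%:Z + 1) - j%:Z ^+ 2 - j%:Z = g + 2 * (j%:Z + 1)); last by rewrite /g; ring.
rewrite (_ : d%:Z * (d%:Z + 1) - j%:Z ^+ 2 + j%:Z = g + 2 * (j%:Z + 1) + 2 * j%:Z); last by rewrite /g; ring.
rewrite (_ : d%:Z * (d%:Z + 1) - (j%:Z + 1) ^+ 2 - (j%:Z + 1) = g); last by rewrite /g; ring.
rewrite (_ : d%:Z * (d%:Z + 1) - (j%:Z + 1) ^+ 2 + (j%:Z + 1) = g + 2 * (j%:Z + 1)); last by rewrite /g; ring.
rewrite (_ : (d%:Z + 1) * (d%:Z + 1 + 1) - (j%:Z + 1) * (j%:Z + 2) = g + 2 * (d%:Z + 1)); last by rewrite /g; ring.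
rewrite (_ : d%:Z + 1 - j%:Z - 1 = d%:Z - j%:Z); last by ring.
rewrite (_ : d%:Z - (j%:Z + 1) = d%:Z - j%:Z - 1); last by ring.
rewrite (_ : d%:Z + 1 + j%:Z = d%:Z + j%:Z + 1); last by ring.
rewrite (_ : d%:Z + (j%:Z + 1) = d%:Z + j%:Z + 1); last by ring.
have -> : ip (d%:Z + j%:Z) = (1 - qz (2 * (d%:Z + j%:Z + 1))) * ip (d%:Z + j%:Z + 1).
  by rewrite -(ipoch_step qM) ?addrK //; lia.
have -> : ip (d%:Z - j%:Z - 1) = (1 - qz (2 * (d%:Z - j%:Z))) * ip (d%:Z - j%:Z).
  by rewrite (ipoch_step qM) //; lia.
have -> : np d.+1.-1 = np d.-1 * (1 + qz (2 * d%:Z)).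
  by case: (d) jd => // d' _; rewrite npochS.
pose X := qz (2 * (d%:Z - j%:Z)); pose Y := qz (2 * j%:Z); pose P := qz 2.
have e1 : qz (2 * (j%:Z + 1)) = Y * P by rewrite -qpowD; try lia; congr qpow; ring.
have e2 : qz (2 * (2 * j%:Z + 1)) = Y * Y * P.
  by rewrite -!qpowD; try lia; congr qpow; ring.
have e3 : qz (2 * d%:Z) = X * Y by rewrite -qpowD; try lia; congr qpow; ring.
have e4 : qz (2 * (d%:Z + j%:Z + 1)) = X * Y * Y * P.
  by rewrite -!qpowD; try lia; congr qpow; ring.
have e5 : qz (2 * (d%:Z + 1)) = X * Y * P by rewrite -!qpowD; try lia; congr qpow; ring.
have g1 : 0 <= 2 * (j%:Z + 1) by lia.
have g2 : 0 <= 2 * (d%:Z + 1) by lia.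
have g3 : 0 <= 2 * j%:Z by lia.
rewrite (qpowD q (addr_ge0 g0 g1) g3) (qpowD q g0 g1) (qpowD q g0 g2).
rewrite e1 e2 e3 e4 e5 -/X -/Y; ring.
Qed.

Variable D : nat.
Hypothesis MD : (M < D)%N.

(** The sum over all d of the factors of the j-th mode; [(j == 0)] stands for d = 0. *)
Definition Ssum (j : int) : A := (j == 0)%:R + \sum_(1 <= d < D) tau d j.

Lemma Ssum_base (j : nat) : (j < D)%N ->
  Ssum j%:Z = np j * ip (2 * j)%N%:Z + \sum_(j.+1 <= d < D) tau d j%:Z.
Proof.
move=> jD; rewrite /Ssum; case: j jD => [|j] jD.
  by rewrite eqxx /= /npoch !big_ord0 mul1r.
rewrite (_ : (j.+1%:Z == 0) = false) // add0r (@big_cat_nat _ _ _ j.+1) //=; last by lia.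
rewrite big_nat big1 ?add0r => [|d /andP[d0 dj]]; last first.
  by rewrite /tau (@coefA_big _ q M d) ?mul0r //; lia.
rewrite big_ltn //; congr (_ + _).
rewrite /tau /coefA npochS /= subrr /= big_ord0 mulr1.
have -> : (j.+1 ^ 2 + j.+1)%N%:Z - j.+1%:Z ^+ 2 - j.+1%:Z = 0.
  by rewrite expr2 expnS expn1; lia.
have -> : (j.+1 ^ 2 + j.+1)%N%:Z - j.+1%:Z ^+ 2 + j.+1%:Z = 2 * j.+1%:Z.
  by rewrite expr2 expnS expn1; lia.
have -> : (2 * j.+1)%N = (j.+1 + j.+1)%N by lia.
by rewrite {1}/qpow /= expr0; ring.
Qed.

Lemma Ssum_step (j : nat) : (j.+1 < D)%N -> Ssum j%:Z = Ssum j.+1%:Z.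
Proof.
move=> jD; rewrite Ssum_base; last by lia.
rewrite /Ssum (_ : (j.+1%:Z == 0) = false) // add0r (@big_cat_nat _ _ _ j.+1 1 D) //; last by lia.
rewrite [X in _ = X + _]big_nat [X in _ = X + _]big1 ?add0r => [|d /andP[d0 dj]]; last first.
  by rewrite /tau (@coefA_big _ q M d) ?mul0r //; lia.
apply/eqP; rewrite -subr_eq0 -addrA -sumrB big_nat.
under eq_bigr => d /andP[jd _] do rewrite tau_step //.
rewrite -big_nat telescope_sumr; last by lia.
(* The upper end of the telescope has an exponent at least 2D; the lower end cancels the diagonal
   term of [Ssum_base]. *)
have -> : Psi j D = 0.
  rewrite /Psi; set z := qz (_ - _); have -> : z = 0; last by ring.
  by apply: (qpow_big qM); nia.
rewrite sub0r /Psi; apply/eqP.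
have -> : j.+1%:Z * (j.+1%:Z + 1) - (j%:Z + 1) * (j%:Z + 2) = 0 by lia.
have -> : j.+1%:Z - j%:Z - 1 = 0 by lia.
have -> : j.+1%:Z + j%:Z = 2 * j%:Z + 1 by lia.
have -> : ip (2 * j)%N%:Z = (1 - qz (2 * (2 * j%:Z + 1))) * ip (2 * j%:Z + 1).
  by rewrite -(ipoch_step qM); [congr ipoch; lia | lia].
rewrite qpow0 ipoch0 /=; ring.
Qed.

Lemma Ssum_opp j : Ssum (- j) = Ssum j.
Proof.
rewrite /Ssum oppr_eq0; congr (_ + _); apply: eq_bigr => d _.
rewrite /tau /coefA sqrrN !opprK; ring.
Qed.

(** At j = D - 1 only the diagonal term is left, and its indices are at least M, so it has reached
    its limit. *)
Lemma Ssum_Phi j : `|j| < D%:Z -> Ssum j = Phi.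
Proof.
wlog j0 : j / 0 <= j => [W jD|].
  have [j0|j0] := lerP 0 j; first exact: W.
  by rewrite -Ssum_opp W ?normrN // oppr_ge0 ltW.
case: j j0 => // j _ jD.
have {}jD : (j < D)%N by lia.
have -> : Ssum j%:Z = Ssum D.-1%:Z.
  have W k : (j + k < D)%N -> Ssum j%:Z = Ssum (j + k)%N%:Z.
    elim: k => [|k IH] jk; first by rewrite addn0.
    by rewrite addnS -Ssum_step ?IH //; lia.
  by rewrite (W (D.-1 - j)%N) ?subnKC //; lia.
rewrite Ssum_base; last by lia.
rewrite big_geq ?addr0; last by lia.
by rewrite npoch_big ?ipoch_big //; lia.
Qed.

Variables (K i : nat).
Hypotheses (i0 : (0 < i)%N) (iK : (2 * i <= K + 1)%N).

Definition theta_exp (j : int) : int := (K%:Z + 1) * (j * (j + 1)) - 2 * i%:Z * j.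
Definition theta : A := zsum D (fun j => sg A j * qz (theta_exp j)).

Lemma theta_exp_ge0 j : 0 <= theta_exp j.
Proof. by rewrite /theta_exp; have [?|?] := lerP 0 j; nia. Qed.

Lemma sum_Ahat :
  1 + \sum_(1 <= d < D) Ahat q M K D (K + 1 - 2 * i)%N%:Z d = Phi * theta.
Proof.
set a := (K + 1 - 2 * i)%N%:Z.
have ea : eps K a = 0 by rewrite /eps ifT // /a; lia.
have term d j : (0 < d)%N -> Aterm q M K a d j = sg A j * qz (theta_exp j) * tau d j.
  move=> d0; rewrite /Aterm /tau.
  case: (boolP (- d%:Z <= j <= d%:Z)) => [jd|Njd]; last by rewrite (@coefA_big _ q M _ _ Njd); ring.
  have d2 : (d ^ 2)%N%:Z = d%:Z ^+ 2 by rewrite expnS expn1 expr2; lia.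
  have -> : xA K a d j + d%:Z + j = theta_exp j + ((d ^ 2 + d)%N%:Z - j ^+ 2 + j).
    rewrite /xA ea /theta_exp PoszD d2 (_ : a = K%:Z + 1 - 2 * i%:Z); last by rewrite /a; lia.
    by ring.
  have -> : xA K a d j + d%:Z - j = theta_exp j + ((d ^ 2 + d)%N%:Z - j ^+ 2 - j).
    rewrite /xA ea /theta_exp PoszD d2 (_ : a = K%:Z + 1 - 2 * i%:Z); last by rewrite /a; lia.
    by ring.
  have t0 := theta_exp_ge0 j.
  have b1 : 0 <= (d ^ 2 + d)%N%:Z - j ^+ 2 - j by rewrite PoszD d2; nia.
  have b2 : 0 <= (d ^ 2 + d)%N%:Z - j ^+ 2 + j by rewrite PoszD d2; nia.
  by rewrite (qpowD q t0 b1) (qpowD q t0 b2); ring.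
have -> : 1 = zsum D (fun j => sg A j * qz (theta_exp j) * (j == 0)%:R).
  rewrite zsum_single => [|j /negbTE ->]; last by rewrite mulr0.
  rewrite eqxx (_ : theta_exp 0 = 0); last by rewrite /theta_exp; ring.
  by rewrite qpow0 /sg /= expr0 !mulr1.
rewrite big_nat (eq_bigr (fun d => zsum D (fun j => sg A j * qz (theta_exp j) * tau d j))) => [|d /andP[d0 _]]; last first.
  by apply: eq_zsum => j _; apply: term.
rewrite -big_nat /zsum exchange_big -big_split /= /theta /zsum mulr_sumr.
apply: eq_bigr => k _; rewrite -mulr_sumr -mulrDr -/(Ssum _).
set j := k%:Z - D%:Z.
have jD : - D%:Z <= j <= D%:Z by rewrite /j; have := ltn_ord k; lia.
case: (ltrP `|j| D%:Z) => lt; first by rewrite Ssum_Phi // mulrC.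
(* At |j| = D, where [Ssum_Phi] does not apply, the theta power is already 0. *)
have -> : qz (theta_exp j) = 0; last by ring.
apply: (qpow_big qM); rewrite /theta_exp.
have [-> | ->] : j = D%:Z \/ j = - D%:Z by lia.
  by nia.
by nia.
Qed.

End SumOverD.

(** * The triple product *)

Section TripleProduct.
Variables (A : comNzRingType) (q : A) (M : nat).
Hypotheses (M0 : (0 < M)%N) (qM : q ^+ M = 0).
Variables (L i : nat).
Hypotheses (i0 : (0 < i)%N) (iL : (2 * i <= L)%N).

Let L0 : (0 < L)%N.
Proof. lia. Qed.

Let Q := q ^+ L.
Let QM : Q ^+ M = 0.
Proof. by rewrite /Q -exprM; apply: (qbig qM); have := L0; nia. Qed.

Local Notation I := (ipoch Q M).
Local Notation qz := (qpow q).

Definition pp (n : nat) : A := \prod_(r < n) (1 - q ^+ (2 * L * r.+1)).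

Lemma ppK n : pp n * I n%:Z = 1.
Proof.
rewrite /pp /= -big_split big1 //= => r _.
rewrite (_ : (2 * L * r.+1 = L * (2 * r.+1))%N); last by rewrite mulnCA mulnA.
by rewrite exprM (geomP QM).
Qed.

Lemma pp_big n : (M <= n)%N -> pp n = pp M.
Proof.
move=> Mn; rewrite -(subnKC Mn) /pp big_split_ord /= [X in _ * X]big1 ?mulr1 // => r _.
by rewrite (qbig qM) ?subr0 //; have := L0; nia.
Qed.

Definition tj (j : int) : A := qz (L%:Z * (j * (j - 1)) + 2 * i%:Z * j).

Lemma tj_ge0 (j : int) : 0 <= L%:Z * (j * (j - 1)) + 2 * i%:Z * j.
Proof.
rewrite (_ : _ + _ = j * (L%:Z * (j - 1) + 2 * i%:Z)); last by ring.
have [->|[j0|j0]] : j = 0 \/ 0 < j \/ j < 0 by lia.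
- by rewrite mul0r.
- by apply: mulr_ge0; nia.
- by apply: mulr_le0; nia.
Qed.

(** Up to the factor [pp (2 * n)], the Gaussian binomial coefficient of 2n over n + j in base
    q^(2L). *)
Definition bb (n : nat) (j : int) : A := I (n%:Z - j) * I (n%:Z + j).

Lemma QqpowE z : qpow Q z = qz (L%:Z * z).
Proof. by rewrite /qpow /Q -exprM; congr (_ ^+ _); lia. Qed.

Lemma I_step z : 0 <= z -> I (z - 1) = (1 - qz (2 * L%:Z * z)) * I z.
Proof.
by move=> z0; rewrite (ipoch_step QM) // QqpowE; congr ((1 - qpow q _) * _); ring.
Qed.

Lemma I_step2 z : 0 < z ->
  I (z - 2) = (1 - qz (2 * L%:Z * (z - 1))) * (1 - qz (2 * L%:Z * z)) * I z.
Proof.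
move=> z0; rewrite (_ : z - 2 = z - 1 - 1); last by ring.
by rewrite I_step ?I_step; [ring | lia | lia].
Qed.

(** The q-Pascal rule applied twice. *)
Lemma bb_rec n j :
  (1 - qz (2 * L%:Z * (2 * n%:Z + 1))) * (1 - qz (2 * L%:Z * (2 * n%:Z + 2))) * bb n.+1 j
  = (1 + qz (2 * L%:Z * (2 * n%:Z + 1))) * bb n j
    + qz (2 * L%:Z * (n%:Z + 1 - j)) * bb n (j - 1)
    + qz (2 * L%:Z * (n%:Z + 1 + j)) * bb n (j + 1).
Proof.
rewrite /bb.
pose m := n%:Z + 1 - j; pose k := n%:Z + 1 + j.
rewrite (_ : n.+1%:Z - j = m); last by rewrite /m; lia.
rewrite (_ : n.+1%:Z + j = k); last by rewrite /k; lia.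
rewrite (_ : n%:Z - j = m - 1); last by rewrite /m; ring.
rewrite (_ : n%:Z + j = k - 1); last by rewrite /k; ring.
rewrite (_ : n%:Z - (j - 1) = m); last by rewrite /m; ring.
rewrite (_ : n%:Z + (j - 1) = k - 2); last by rewrite /k; ring.
rewrite (_ : n%:Z - (j + 1) = m - 2); last by rewrite /m; ring.
rewrite (_ : n%:Z + (j + 1) = k); last by rewrite /k; ring.
rewrite -/m -/k.
have mk : m + k = 2 * n%:Z + 2 by rewrite /m /k; ring.
case: (ltrP m 0) => m0.
  by rewrite !(ipoch_neg Q M (z := m)) ?(ipoch_neg Q M (z := m - 1)) ?(ipoch_neg Q M (z := m - 2)) //; try lia; ring.
case: (ltrP k 0) => k0.
  by rewrite !(ipoch_neg Q M (z := k)) ?(ipoch_neg Q M (z := k - 1)) ?(ipoch_neg Q M (z := k - 2)) //; try lia; ring.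
rewrite (_ : 2 * n%:Z + 1 = m + k - 1); last by rewrite mk; ring.
rewrite -mk.
have q00 : qz (2 * L%:Z * 0) = 1 by rewrite mulr0 /qpow expr0.
have [mz|mz] := eqVneq m 0.
  rewrite (@ipoch_neg _ Q M (m - 1)) ?(@ipoch_neg _ Q M (m - 2)) ?I_step2; try lia.
  by rewrite mz q00 add0r; ring.
have [kz|kz] := eqVneq k 0.
  rewrite (@ipoch_neg _ Q M (k - 1)) ?(@ipoch_neg _ Q M (k - 2)) ?I_step2; try lia.
  by rewrite kz q00 addr0; ring.
rewrite !I_step2 ?I_step; try lia.
pose m' := qz (2 * L%:Z * (m - 1)); pose k' := qz (2 * L%:Z * (k - 1)).
pose Q2 := qz (2 * L%:Z).
have em : qz (2 * L%:Z * m) = m' * Q2.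
  by rewrite /m' /Q2 -qpowD; [congr qpow; ring | nia | lia].
have ek : qz (2 * L%:Z * k) = k' * Q2.
  by rewrite /k' /Q2 -qpowD; [congr qpow; ring | nia | lia].
have emk : qz (2 * L%:Z * (m + k)) = m' * k' * Q2 * Q2.
  by rewrite /m' /k' /Q2 -!qpowD; [congr qpow; ring | nia..].
have emk1 : qz (2 * L%:Z * (m + k - 1)) = m' * k' * Q2.
  by rewrite /m' /k' /Q2 -!qpowD; [congr qpow; ring | nia..].
rewrite emk emk1 em ek -/m' -/k'; ring.
Qed.

Variable D : nat.
Hypothesis MD : (2 * M < D)%N.

Lemma zsum_shift (F : int -> A) : F D%:Z = 0 -> F (- D%:Z - 1) = 0 ->
  zsum D (fun j => F (j - 1)) = zsum D F.
Proof.
move=> F1 F2; rewrite /zsum big_ord_recl [RHS]big_ord_recr /=.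
rewrite (_ : D.*2%:Z - D%:Z = D%:Z) ?F1 ?addr0; last by lia.
rewrite sub0r F2 add0r; apply: eq_bigr => k _; congr F.
by rewrite /bump /=; lia.
Qed.

Lemma bb_out n j : n%:Z < `|j| -> bb n j = 0.
Proof.
move=> nj; rewrite /bb; have [j0|j0] := lerP 0 j.
  by rewrite (@ipoch_neg _ Q M (n%:Z - j)) ?mul0r //; lia.
by rewrite (@ipoch_neg _ Q M (n%:Z + j)) ?mulr0 //; lia.
Qed.

Definition jt (n : nat) : A := zsum D (fun j => sg A j * tj j * bb n j).

Definition jp (n : nat) : A :=
  \prod_(r < n) ((1 - q ^+ (2 * i + 2 * L * r)) * (1 - q ^+ (2 * (L - i) + 2 * L * r))).

(** Multiplication by z = q^(2i + 2Ln) or by y = q^(2(L - i) + 2Ln) shifts the summation index by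
    one place. Expanding (1 - z)(1 - y) as 1 + zy - z - y therefore gives the three terms of
    [bb_rec]. *)
Lemma jt_rec n : (n.+1 < D)%N ->
  (1 - qz (2 * L%:Z * (2 * n%:Z + 1))) * (1 - qz (2 * L%:Z * (2 * n%:Z + 2))) * jt n.+1
  = (1 - q ^+ (2 * i + 2 * L * n)) * (1 - q ^+ (2 * (L - i) + 2 * L * n)) * jt n.
Proof.
move=> nD.
have ze : q ^+ (2 * i + 2 * L * n) = qz (2 * i%:Z + 2 * L%:Z * n%:Z).
  by rewrite /qpow; congr (_ ^+ _); lia.
have ye : q ^+ (2 * (L - i) + 2 * L * n) = qz (2 * (L%:Z - i%:Z) + 2 * L%:Z * n%:Z).
  by rewrite /qpow; congr (_ ^+ _); lia.
have b1 : 0 <= 2 * i%:Z + 2 * L%:Z * n%:Z by lia.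
have b2 : 0 <= 2 * (L%:Z - i%:Z) + 2 * L%:Z * n%:Z by lia.
have zG : qz (2 * i%:Z + 2 * L%:Z * n%:Z) * jt n =
    - zsum D (fun j => sg A j * tj j * (qz (2 * L%:Z * (n%:Z + 1 - j)) * bb n (j - 1))).
  rewrite /jt -zsumZ -zsum_shift; last first.
  - by rewrite bb_out ?mulr0 //; lia.
  - by rewrite bb_out ?mulr0 //; lia.
  rewrite -[RHS]mulN1r -zsumZ; apply: eq_zsum => j _.
  have -> : sg A (j - 1) = - sg A j by rewrite -[sg A j]sgN -sg_refl opprK addrC.
  case: (boolP (n%:Z < `|j - 1|)) => nj; first by rewrite bb_out //; ring.
  have E : qz (2 * i%:Z + 2 * L%:Z * n%:Z) * tj (j - 1) = tj j * qz (2 * L%:Z * (n%:Z + 1 - j)).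
    rewrite /tj -!qpowD; [congr qpow; ring | exact: tj_ge0 | nia | lia | exact: tj_ge0].
  rewrite [LHS](_ : _ = - sg A j * (qz (2 * i%:Z + 2 * L%:Z * n%:Z) * tj (j - 1)) * bb n (j - 1)); last by ring.
  by rewrite E; ring.
have yG : qz (2 * (L%:Z - i%:Z) + 2 * L%:Z * n%:Z) * jt n =
    - zsum D (fun j => sg A j * tj j * (qz (2 * L%:Z * (n%:Z + 1 + j)) * bb n (j + 1))).
  rewrite -[X in _ = - X]zsum_shift; last first.
  - by rewrite bb_out ?mulr0 //; lia.
  - by rewrite bb_out ?mulr0 //; lia.
  rewrite /jt -zsumZ -[RHS]mulN1r -zsumZ; apply: eq_zsum => j _.
  have -> : sg A (j - 1) = - sg A j by rewrite -[sg A j]sgN -sg_refl opprK addrC.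
  rewrite subrK; case: (boolP (n%:Z < `|j|)) => nj; first by rewrite bb_out //; ring.
  have E : qz (2 * (L%:Z - i%:Z) + 2 * L%:Z * n%:Z) * tj j = tj (j - 1) * qz (2 * L%:Z * (n%:Z + 1 + (j - 1))).
    rewrite /tj -!qpowD; [congr qpow; ring | exact: tj_ge0 | nia | lia | exact: tj_ge0].
  rewrite [LHS](_ : _ = sg A j * (qz (2 * (L%:Z - i%:Z) + 2 * L%:Z * n%:Z) * tj j) * bb n j); last by ring.
  by rewrite E; ring.
have zy : qz (2 * i%:Z + 2 * L%:Z * n%:Z) * qz (2 * (L%:Z - i%:Z) + 2 * L%:Z * n%:Z)
   = qz (2 * L%:Z * (2 * n%:Z + 1)).
  by rewrite -qpowD //; congr qpow; ring.
rewrite ze ye.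
have -> : (1 - qz (2 * i%:Z + 2 * L%:Z * n%:Z)) * (1 - qz (2 * (L%:Z - i%:Z) + 2 * L%:Z * n%:Z)) * jt n
  = (1 + qz (2 * i%:Z + 2 * L%:Z * n%:Z) * qz (2 * (L%:Z - i%:Z) + 2 * L%:Z * n%:Z)) * jt n
    - qz (2 * i%:Z + 2 * L%:Z * n%:Z) * jt n - qz (2 * (L%:Z - i%:Z) + 2 * L%:Z * n%:Z) * jt n.
  by ring.
rewrite zG yG zy !opprK /jt -!zsumZ -!zsumD; apply: eq_zsum => j _.
rewrite [LHS](_ : _ = sg A j * tj j * ((1 - qz (2 * L%:Z * (2 * n%:Z + 1))) * (1 - qz (2 * L%:Z * (2 * n%:Z + 2))) * bb n.+1 j)); last by ring.
by rewrite bb_rec; ring.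
Qed.

Lemma jp_jt n : (n < D)%N -> jp n = pp (2 * n) * jt n.
Proof.
elim: n => [|n IH] nD.
  rewrite /jp /jt big_ord0 zsum_single => [|j j0].
    have -> : bb 0 0 = 1 by rewrite /bb /= !big_ord0 mulr1.
    have -> : tj 0 = 1 by rewrite /tj mul0r !mulr0 addr0 /qpow expr0.
    by rewrite /pp muln0 big_ord0 /sg expr0 !mulr1.
  by rewrite bb_out ?mulr0 // normr_gt0.
rewrite /jp big_ord_recr /= -/(jp n) IH; last by lia.
rewrite [LHS](_ : _ = pp (2 * n) * ((1 - q ^+ (2 * i + 2 * L * n))
  * (1 - q ^+ (2 * (L - i) + 2 * L * n)) * jt n)); last by ring.
rewrite -jt_rec // (_ : (2 * n.+1 = (2 * n).+2)%N); last by lia.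
rewrite [pp _.+2]/pp !big_ord_recr /= -/(pp (2 * n)).
have -> : qz (2 * L%:Z * (2 * n%:Z + 1)) = q ^+ (2 * L * (2 * n).+1).
  by rewrite /qpow; congr (_ ^+ _); lia.
have -> : qz (2 * L%:Z * (2 * n%:Z + 2)) = q ^+ (2 * L * (2 * n).+2).
  by rewrite /qpow; congr (_ ^+ _); lia.
by ring.
Qed.

(** The finite identity [jp_jt] at n = 2M: for |j| > M the power [tj j] is 0, and otherwise both
    indices 2M - j and 2M + j are at least M, where [I] is inverse to the stable value of [pp]. *)
Theorem triple_product :
  zsum D (fun j => sg A j * tj j) = pp (2 * M) * jp (2 * M).
Proof.
rewrite jp_jt // /jt -!zsumZ; apply: eq_zsum => j _.
case: (ltrP M%:Z `|j|) => Mj.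
  have -> : tj j = 0; last by ring.
  by apply: (qpow_big qM); have := L0; have [?|?] := lerP 0 j; nia.
rewrite [RHS](_ : _ = sg A j * tj j * ((pp (2 * M) * I ((2 * M)%N%:Z - j))
   * (pp (2 * (2 * M)) * I ((2 * M)%N%:Z + j)))); last by rewrite /bb; ring.
suff one n z : (M <= n)%N -> M%:Z <= z -> pp n * I z = 1.
  by rewrite !one ?mulr1 //; lia.
move=> Mn; case: z => // z Mz.
by rewrite pp_big // -(@pp_big z) ?ppK.
Qed.

End TripleProduct.

(** * Product formulas *)

Section OverProduct.
Variables (A : comNzRingType) (q : A) (M : nat).
Hypotheses (M0 : (0 < M)%N) (qM : q ^+ M = 0).
Variables (u o : pred nat).

(** Overpartitions are counted in q^2, so that those of n meet the partitions of 2n. *)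
Let p := q ^+ 2.
Let pM : p ^+ M = 0.
Proof. by rewrite /p -exprM (qbig qM) //; lia. Qed.

Let T r := gf p M (over_count u o r).

Lemma over_gf_rec r :
  T r.+1 * (1 - (u r.+1)%:R * q ^+ (2 * r.+1)) = (1 + (o r.+1)%:R * q ^+ (2 * r.+1)) * T r.
Proof.
have E : T r.+1 = T r + ((o r.+1)%:R * (p ^+ r.+1 * T r) + (u r.+1)%:R * (p ^+ r.+1 * T r.+1)).
  rewrite {1}/T (eq_gf _ _ (over_count_rec u o r)) !gfD; congr (_ + (_ + _)).
    case: (o r.+1); rewrite ?mul1r ?mul0r; last by rewrite gf0 // => n; rewrite andbF.
    by apply: (gf_shift pM) => [n nr|n]; [rewrite ltnNge -ltnS nr | rewrite andbT addnK addnS ltnS leq_addl].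
  case: (u r.+1); rewrite ?mul1r ?mul0r; last by rewrite gf0 // => n; rewrite andbF.
  by apply: (gf_shift pM) => [n nr|n]; [rewrite ltnNge -ltnS nr | rewrite andbT addnK addnS ltnS leq_addl].
rewrite mulrBr mulr1 {1}E (_ : q ^+ (2 * r.+1) = p ^+ r.+1); first by ring.
by rewrite /p -exprM.
Qed.

Lemma over_gf0 : T 0 = 1.
Proof.
apply: (gf_delta _ M0) => n; apply: has_card_uniq (over_countP _ _ _ _) _.
have nil l : over_set u o 0 n l -> l = [::].
  case: l => // -[v b] l /and4P[/andP[/andP[_ /andP[/= v0 _]] _] /andP[/= vr _] _ _]; lia.
case: eqP => [n0|n0].
  apply: eq_has_card (has_card1 ([::] : seq (nat * bool))) => l.
  by apply/eqP/idP => [->|/nil //]; rewrite n0.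
by apply: has_card0 => l; apply/negP => Pl; move: (Pl); rewrite (nil l Pl) => /eqP /esym.
Qed.

Lemma over_gf r :
  T r * \prod_(s < r) (1 - (u s.+1)%:R * q ^+ (2 * s.+1))
  = \prod_(s < r) (1 + (o s.+1)%:R * q ^+ (2 * s.+1)).
Proof.
elim: r => [|r IH]; first by rewrite !big_ord0 over_gf0 mulr1.
by rewrite !big_ord_recr /= mulrCA over_gf_rec -IH; ring.
Qed.

End OverProduct.

Lemma big_ord_mul (A : comNzRingType) (F : nat -> A) n L :
  \prod_(s < n * L) F s = \prod_(b < n) \prod_(c < L) F (b * L + c)%N.
Proof.
elim: n => [|n IH]; first by rewrite !big_ord0.
by rewrite mulSnr big_split_ord /= IH big_ord_recr.
Qed.

Lemma prod_ord_pred1 (A : comNzRingType) L k (x : A) : (0 < k <= L)%N ->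
  \prod_(c < L) (if c.+1 == k then x else 1) = x.
Proof.
move=> /andP[k0 kL]; have lt : (k.-1 < L)%N by lia.
rewrite -big_mkcond /= (big_pred1 (Ordinal lt)) // => c.
rewrite /= -(inj_eq val_inj) /=; lia.
Qed.

(** * Product forms of the generating functions of R and O *)

Section Final.
Variables (A : comNzRingType) (q : A) (M : nat).
Hypotheses (M0 : (0 < M)%N) (qM : q ^+ M = 0).

Lemma gf_R K i D : (1 < K)%N -> (0 < i)%N -> (2 * i <= K + 1)%N -> (M < D)%N ->
  gf q M (R K i) = 1 + \sum_(1 <= d < D) Ahat q M K D (K + 1 - 2 * i)%N%:Z d.
Proof.
move=> K1 i0 iK MD; set a := (K + 1 - 2 * i)%N.
have aK : (a < K)%N by rewrite /a; lia.
have Hc := frob_burge K1.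
have -> : gf q M (R K i) = \sum_(0 <= d < D)
   (gf q M (frob_count K a true d 0) + gf q M (frob_count K a false d 0)).
  under [RHS]eq_bigr => d _ do rewrite -gfD.
  rewrite /gf exchange_big /=; apply: eq_bigr => n _.
  rewrite R_frob // -mulr_suml -natr_sum; congr (_%:R * _).
  have nD : (n.+1 <= D)%N by have := ltn_ord n; lia.
  rewrite [RHS](@big_cat_nat _ _ _ n.+1) //= [X in _ = (_ + X)%N]big_nat.
  rewrite [X in _ = (_ + X)%N]big1 ?addn0 // => d /andP[nd _].
  by rewrite !(burge_small Hc) // nd.
rewrite big_ltn; last by lia.
congr (_ + _).
  rewrite [gf _ _ _]gf0 ?add0r => [|n]; last by rewrite (burge_d0 Hc).
  by apply: (gf_delta _ M0) => n; rewrite (burge_d0 Hc).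
rewrite !big_nat; apply: eq_bigr => d /andP[d0 dD].
have MD' : (0 < M <= D)%N by rewrite M0 ltnW.
have := strip_rec_uniq qM (strip_count qM M0 Hc) (strip_hat qM K MD') d0 aK.
by rewrite /= dD.
Qed.

Lemma gf_R_product K i : (1 < K)%N -> (0 < i)%N -> (2 * i <= K + 1)%N ->
  gf q M (R K i) = Phi q M * (pp q (K + 1) (2 * M) * jp q (K + 1) i (2 * M)).
Proof.
move=> K1 i0 iK.
have D1 : (M < (2 * M).+1)%N by lia.
have D2 : (2 * M < (2 * M).+1)%N by lia.
rewrite (gf_R K1 i0 iK D1) (sum_Ahat M0 qM D1 i0 iK); congr (_ * _).
rewrite -(triple_product M0 qM i0 iK D2) /theta -zsum_opp; apply: eq_zsum => j _.
rewrite sgN /tj; congr (_ * qpow _ _); rewrite /theta_exp PoszD; ring.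
Qed.

Definition allprod (n : nat) : A := \prod_(s < n) (1 - q ^+ (2 * s.+1)).

Lemma allprodK n : allprod n * ipoch q M n%:Z = 1.
Proof.
by rewrite /allprod /= -big_split big1 //= => r _; rewrite (geomP qM).
Qed.

(** The bound on the parts gives 2M complete blocks of residues. As 2i < K + 1, the residues 0, i,
    -i are distinct, and the factors of the forbidden parts are those of [pp] and [jp]; multiplying
    by them completes the denominator to [allprod]. *)
Lemma over_residues K i : (0 < i)%N -> (2 * i < K + 1)%N ->
  gf (q ^+ 2) M (over_count
     (fun x => ~~ [|| x == 0 %[mod K + 1], x == i %[mod K + 1] | x + i == 0 %[mod K + 1]])%N
     xpredT (2 * M * (K + 1)))
  = Phi q M * (pp q (K + 1) (2 * M) * jp q (K + 1) i (2 * M)).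
Proof.
move=> i0 iK; set L := (K + 1)%N in iK *; set u := fun x => ~~ _.
set r := (2 * M * L)%N; have rM : (M <= r)%N by rewrite /r; nia.
have := over_gf M0 qM u xpredT r; rewrite /=; set T := gf _ _ _ => E.
have npE : \prod_(s < r) (1 + (true%:R : A) * q ^+ (2 * s.+1)) = npoch q M.
  by rewrite -(npoch_big M0 qM rM); apply: eq_bigr => s _; rewrite mul1r.
have bad : \prod_(s < r) (if u s.+1 then 1 else 1 - q ^+ (2 * s.+1))
    = pp q L (2 * M) * jp q L i (2 * M).
  rewrite (big_ord_mul (fun s => if u s.+1 then 1 else 1 - q ^+ (2 * s.+1))).
  rewrite /pp /jp -big_split /=; apply: eq_bigr => b _.
  pose f (k c : nat) : A := if c.+1 == k then 1 - q ^+ (2 * (b * L + k)) else 1.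
  rewrite (eq_bigr (fun c : 'I_L => f L c * (f i c * f (L - i)%N c))) => [|c _].
    rewrite !big_split /= !prod_ord_pred1; try lia.
    congr ((1 - q ^+ _) * ((1 - q ^+ _) * (1 - q ^+ _))); lia.
  have cL := ltn_ord c; rewrite /f /u.
  have -> : ((b * L + c).+1 == 0 %[mod L])%N = (c.+1 == L).
    rewrite -addnS mod0n modnMDl.
    case: (ltngtP c.+1 L) cL => // [lt|->] _; last by rewrite modnn eqxx.
    by rewrite modn_small.
  have -> : ((b * L + c).+1 == i %[mod L])%N = (c.+1 == i).
    rewrite -addnS modnMDl [(i %% L)%N]modn_small; last by lia.
    case: (ltngtP c.+1 L) cL => // [lt|->] _; first by rewrite modn_small.
    by rewrite modnn; lia.
  have -> : ((b * L + c).+1 + i == 0 %[mod L])%N = (c.+1 == L - i)%N.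
    rewrite -addnS -addnA mod0n modnMDl.
    case: (ltngtP (c.+1 + i)%N L) => [lt|gt|cE].
    - by rewrite modn_small //; lia.
    - by rewrite -(subnK (ltnW gt)) modnDr modn_small; lia.
    - by rewrite cE modnn; lia.
  case: (c.+1 =P L) => [cE|cE].
    have -> : (c.+1 == i) = false by lia.
    have -> : (c.+1 == L - i)%N = false by lia.
    by rewrite /= !mulr1; congr (1 - q ^+ _); lia.
  case: (c.+1 =P i) => [ci|ci].
    have -> : (c.+1 == L - i)%N = false by lia.
    by rewrite /= mulr1 mul1r; congr (1 - q ^+ _); lia.
  by case: (c.+1 =P (L - i)%N) => [cL1|cL1]; rewrite /= !mul1r //; congr (1 - q ^+ _); lia.
have split : \prod_(s < r) (1 - (u s.+1)%:R * q ^+ (2 * s.+1)) * (pp q L (2 * M) * jp q L i (2 * M))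
    = allprod r.
  rewrite -bad -big_split; apply: eq_bigr => s _.
  by case: (u s.+1); rewrite /= ?mul1r ?mul0r ?subr0 ?mulr1 ?mul1r.
have -> : Phi q M = npoch q M * ipoch q M r%:Z by rewrite /Phi (ipoch_big M0 qM rM).
rewrite -npE -E; transitivity (T * (allprod r * ipoch q M r%:Z)).
  by rewrite allprodK mulr1.
by rewrite -split; ring.
Qed.

Lemma prod_multiples k n (F : nat -> A) : (0 < k)%N ->
  \prod_(s < n * k) (if (k %| s.+1)%N then F s.+1 else 1) = \prod_(t < n) F (k * t.+1)%N.
Proof.
move=> k0; rewrite (big_ord_mul (fun s => if (k %| s.+1)%N then F s.+1 else 1)).
apply: eq_bigr => b _.
rewrite (eq_bigr (fun c : 'I_k => if c.+1 == k then F (k * b.+1)%N else 1)) => [|c _].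
  by rewrite prod_ord_pred1 // k0 leqnn.
have ck := ltn_ord c; rewrite -addnS dvdn_addr ?dvdn_mull //.
case: eqP => [cE|cE]; first by rewrite cE dvdnn mulnS mulnC addnC.
by rewrite gtnNdvd //; lia.
Qed.

(** Removing the multiples of k divides [Phi] by Xp / Xm. Euler's identity [Xp * Odd = 1], from
    [Xp * Xm = Even] and [Xm = Odd * Even], turns Xm / Xp into Odd^2 Even. The bound 4Mk gives 2M
    odd and 2M even multiples. *)
Lemma over_multiples k : (1 < k)%N ->
  gf (q ^+ 2) M (over_count (fun x => x != 0 %[mod k])%N (fun x => x != 0 %[mod k])%N (4 * M * k))
  = Phi q M * (pp q (2 * k) (2 * M) * jp q (2 * k) k (2 * M)).
Proof.
move=> k1; have k0 := ltnW k1; pose u x := (x != 0 %[mod k])%N; rewrite -/u.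
set r := (4 * M * k)%N; have rM : (M <= r)%N by rewrite /r; nia.
have := over_gf M0 qM u u r; rewrite /=; set T := gf _ _ _ => E.
have uE x : u x = ~~ (k %| x)%N by rewrite /u mod0n.
pose Xm := \prod_(t < 4 * M) (1 - q ^+ (2 * k * t.+1)).
pose Xp := \prod_(t < 4 * M) (1 + q ^+ (2 * k * t.+1)).
pose Odd := \prod_(b < 2 * M) (1 - q ^+ (2 * k * (2 * b).+1)).
set Even := pp q (2 * k) (2 * M).
have XmE : \prod_(s < r) (if u s.+1 then 1 else 1 - q ^+ (2 * s.+1)) = Xm.
  rewrite /Xm -[RHS](eq_bigr _ (fun t _ => congr1 (fun e => 1 - q ^+ e) (mulnA _ _ _))).
  rewrite -(prod_multiples _ (fun s => 1 - q ^+ (2 * s)) k0).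
  by apply: eq_bigr => s _; rewrite uE if_neg.
have XpE : \prod_(s < r) (if u s.+1 then 1 else 1 + q ^+ (2 * s.+1)) = Xp.
  rewrite /Xp -[RHS](eq_bigr _ (fun t _ => congr1 (fun e => 1 + q ^+ e) (mulnA _ _ _))).
  rewrite -(prod_multiples _ (fun s => 1 + q ^+ (2 * s)) k0).
  by apply: eq_bigr => s _; rewrite uE if_neg.
have jpE : jp q (2 * k) k (2 * M) = Odd * Odd.
  rewrite /jp /Odd -big_split /=; apply: eq_bigr => b _.
  by congr ((1 - q ^+ _) * (1 - q ^+ _)); lia.
have XmOE : Xm = Odd * Even.
  rewrite /Xm /Odd /Even /pp (_ : (4 * M = 2 * M * 2)%N); last by lia.
  rewrite (big_ord_mul (fun t => 1 - q ^+ (2 * k * t.+1))) -big_split /=.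
  apply: eq_bigr => b _; rewrite !big_ord_recl big_ord0 mulr1 /=.
  by congr ((1 - q ^+ _) * (1 - q ^+ _)); rewrite /bump /=; lia.
have XX : Xp * Xm = Even.
  rewrite /Even (pp_big M0 qM k0 (leqnn (2 * k))); last by lia.
  rewrite -(pp_big M0 qM k0 (leqnn (2 * k)) (n := 4 * M)); last by lia.
  rewrite /Xp /Xm -big_split; apply: eq_bigr => t _ /=.
  have -> : q ^+ (2 * (2 * k) * t.+1) = q ^+ (2 * k * t.+1) * q ^+ (2 * k * t.+1).
    by rewrite -exprD; congr (_ ^+ _); lia.
  by ring.
have XO : Xp * Odd = 1.
  have e := ppK M0 qM k0 (leqnn (2 * k)) (2 * M); rewrite -/Even in e.
  rewrite -[LHS]mulr1 -{1}e mulrA -[_ * _ * Even]mulrA -XmOE XX; exact: e.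
have minus : \prod_(s < r) (1 - (u s.+1)%:R * q ^+ (2 * s.+1)) * Xm = allprod r.
  rewrite -XmE -big_split; apply: eq_bigr => s _.
  by case: (u s.+1); rewrite /= ?mul1r ?mul0r ?subr0 ?mulr1 ?mul1r.
have plus : \prod_(s < r) (1 + (u s.+1)%:R * q ^+ (2 * s.+1)) * Xp = npoch q M.
  rewrite -(npoch_big M0 qM rM) -XpE -big_split; apply: eq_bigr => s _.
  by case: (u s.+1); rewrite /= ?mul1r ?mul0r ?addr0 ?mulr1 ?mul1r.
have TX : T * Xp = Phi q M * Xm.
  rewrite /Phi -(ipoch_big M0 qM rM) -plus -E.
  transitivity (T * Xp * (allprod r * ipoch q M r%:Z)); first by rewrite allprodK mulr1.
  by rewrite -minus; ring.
transitivity (T * Xp * Odd); first by rewrite -mulrA XO mulr1.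
by rewrite TX XmOE jpE; ring.
Qed.

End Final.

(** * Coefficients in Z[X]/(X^M) *)

Section Truncation.
Variable M : nat.
Hypothesis M0 : (0 < M)%N.

Definition trunc_X : {poly %/ ('X^M : {poly int})} := in_qpoly ('X^M) 'X.

Lemma trunc_XM : trunc_X ^+ M = 0.
Proof.
rewrite /trunc_X -rmorphXn; apply/val_eqP => /=.
by rewrite mk_monic_Xn prednK // Pdiv.RingMonic.rmodpp ?monicXn.
Qed.

Lemma in_qpoly_coef (P P' : {poly int}) n : (n < M)%N ->
  in_qpoly 'X^M P = in_qpoly 'X^M P' -> P`_n = P'`_n.
Proof.
move=> nM /(congr1 val) /=; rewrite mk_monic_Xn prednK // => E.
rewrite (Pdiv.RingMonic.rdivp_eq (monicXn int M) P) (Pdiv.RingMonic.rdivp_eq (monicXn int M) P').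
by rewrite !coefD !coefMXn nM E.
Qed.

Lemma gf_coef (f g : nat -> nat) n : (2 * n < M)%N ->
  gf trunc_X M f = gf (trunc_X ^+ 2) M g -> f (2 * n)%N = g n.
Proof.
move=> nM E; pose P := \sum_(k < M) ((f k)%:R : int) *: 'X^k : {poly int}.
pose P' := \sum_(k < M) ((g k)%:R : int) *: 'X^(2 * k) : {poly int}.
have PE : in_qpoly 'X^M P = gf trunc_X M f.
  rewrite /P /gf rmorph_sum; apply: eq_bigr => k _.
  by rewrite -mul_polyC polyC_natr rmorphM rmorph_nat rmorphXn.
have PE' : in_qpoly 'X^M P' = gf (trunc_X ^+ 2) M g.
  rewrite /P' /gf rmorph_sum; apply: eq_bigr => k _.
  by rewrite -mul_polyC polyC_natr rmorphM rmorph_nat rmorphXn exprM.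
have := in_qpoly_coef nM (etrans PE (etrans E (esym PE'))).
rewrite /P /P' !coef_sum (bigD1 (Ordinal nM)) //= [X in _ + X]big1 => [|k nk]; last first.
  rewrite coefZ coefXn (_ : (2 * n == k)%N = false) ?mulr0 //.
  by apply: contraNF nk => /eqP nk; apply/eqP/val_inj.
have nM' : (n < M)%N by lia.
rewrite [RHS](bigD1 (Ordinal nM')) //= [X in _ = _ + X]big1 => [|k nk]; last first.
  rewrite coefZ coefXn (_ : (2 * n == 2 * k)%N = false) ?mulr0 //.
  apply: contraNF nk => /eqP nk; apply/eqP/val_inj; move: nk => /=; lia.
rewrite !coefZ !coefXn !eqxx !mulr1 !addr0.
by move/eqP; rewrite eqr_nat => /eqP.
Qed.

End Truncation.

Local Close Scope ring_scope.

Theorem theorem2 (K i kappa eps : nat)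
  (hi : 0 < i) (hkappa : 0 < kappa) (heps : eps \in [:: 0; 1])
  (hK : 2 < K) (hKkappa : K = 2 * kappa - eps) (hikappa : 1 <= i <= kappa) :
  forall n m : nat,
    Jlen K i n m = E K i (2 * n) m /\
    J K i n = R K i (2 * n) /\
    R K i (2 * n) = O K kappa eps i n.
Proof.
move=> n m; have [_ ik] := andP hikappa.
have e01 : eps = 0 \/ eps = 1 by move: heps; rewrite !inE => /orP[]/eqP; [left|right].
have iK : 2 * i <= K + 1 by lia.
split; first exact: Jlen_eq_E.
split; first exact: J_eq_R.
(* The coefficient to be compared is that of q^(2n), so truncation at 2n + 1 suffices. *)
pose M := (2 * n).+1; have M0 : 0 < M by [].
have qM := trunc_XM M0; set q := trunc_X M in qM.
have gR := gf_R_product M0 qM (ltnW hK) hi iK.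
have ext r : n <= r -> over_count (over_u K kappa eps i) (over_o kappa eps i) r n
    = O K kappa eps i n.
  by move=> nr; rewrite -(O_over hi hkappa heps hKkappa ik nr).
case: (boolP ((eps == 1) && (i == kappa))) => [/andP[/eqP e1 /eqP ik1]|Ne].
  have k1 : 1 < kappa by lia.
  (* Here i and -i are the same residue modulo K + 1, so the product has a double factor and
     [over_multiples] replaces [over_residues]. *)
  have KE : K + 1 = 2 * kappa by lia.
  rewrite ik1 KE in gR; have H := over_multiples M0 qM k1; rewrite -gR in H.
  rewrite {1}ik1 (gf_coef M0 (ltnSn _) (esym H)) -(ext (4 * M * kappa)); last by nia.
  by rewrite /over_u /over_o e1 ik1 !eqxx.
have lt : 2 * i < K + 1.
  by have := Ocases hi hkappa heps hKkappa ik; rewrite Ne => /andP[].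
have H := over_residues M0 qM hi lt; rewrite -gR in H.
rewrite (gf_coef M0 (ltnSn _) (esym H)) -(ext (2 * M * (K + 1))); last by nia.
by rewrite /over_u /over_o (negbTE Ne).
Qed.
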